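(* Let $\ell>0$, $I=(-\ell,\ell)$, $u_+<0<u_-$, and let $f:\mathbb R\to\mathbb R$ satisfy, for some $c_0>0$, $$f''(u)\ge c_0>0,\qquad f'(u_+)<0<f'(u_-),\qquad f(u_+)=f(u_-).$$ Then, for any $u_0\in BV(-\ell,\ell)$, the (entropy) solution $u$ to the initial-boundary value problem $$\partial_t u+\partial_x f(u)=0\quad (x\in I,\ t>0),\qquad u(x,0)=u_0(x)\quad(x\in I),\qquad u(\pm\ell,t)=u_\pm\quad(t>0),$$ with boundary conditions understood in the sense of Bardos–le Roux–Nédélec, is such that for some $T>0$ and $\xi\in[-\ell,\ell]$ there holds $$u(x,T)=U_{\mathrm{hyp}}(x;\xi):=u_-\,\chi_{(-\ell,\xi)}(x)+u_+\,\chi_{(\xi,\ell)}(x)$$ for almost every $x\in I$.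
   Context: Here $\chi_A$ is the characteristic function of the set $A$. The solution is the entropy solution of the scalar conservation law. The boundary conditions $u(\pm\ell,t)=u_\pm$ are understood in the sense of Bardos–le Roux–Nédélec: let $u_\ast\in(u_+,u_-)$ be the unique value with $f'(u_\ast)=0$, and set $\mathcal R u:=w$ if there is $w\ne u$ with $f(w)=f(u)$, and $\mathcal R u_\ast:=u_\ast$. Then the boundary conditions mean that the traces of $u$ at the boundary satisfy $$u(-\ell+0,t)\in(-\infty,\mathcal R u_-]\cup\{u_-\},\qquad u(\ell-0,t)\in\{u_+\}\cup[\mathcal R u_+,+\infty).$$ Since $f(u_+)=f(u_-)$, one has $\mathcal R u_\pm=u_\mp$, so these read $u(-\ell+0,t)\in(-\infty,u_+]\cup\{u_-\}$ and $u(\ell-0,t)\in\{u_+\}\cup[u_-,+\infty)$. *)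

(* Defs.v *)
From HB Require Import structures.
From mathcomp Require Import all_boot all_order all_algebra.
From mathcomp Require Import all_classical all_reals all_analysis.

Set Implicit Arguments.
Unset Strict Implicit.
Unset Printing Implicit Defensive.
Import Order.TTheory GRing.Theory Num.Theory.
Import numFieldNormedType.Exports.

Local Open Scope ring_scope.
Local Open Scope classical_set_scope.

(* Functions of space and time take pairs p = (x, t), with x = p.1, t = p.2. *)

Section ScalarConservationLaw.
Context {R : realType}.
Local Notation mu := (@lebesgue_measure R).
Implicit Types (l : R) (f : R -> R) (u phi : R * R -> R).

Definition dom_x l : set R := `]- l, l[.
Definition spacetime l : set (R * R) := dom_x l `*` `]0, +oo[.

(* BV of the open interval ]a, b[ consists of classes modulo a.e. equality,
   whereas the library's bounded_variation a b is pointwise on [a, b]; a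
   representative of bounded pointwise variation on ]a, b[ extends by its
   one-sided limits to [a, b]. *)
Definition in_BV (a b : R) (v : R -> R) : Prop :=
  exists2 w : R -> R, bounded_variation a b w &
    {ae mu, forall x : R, a < x < b -> v x = w x}.

Definition deriv_x phi (p : R * R) : R := ((fun x => phi (x, p.2))^`() p.1)%classic.
Definition deriv_t phi (p : R * R) : R := ((fun t => phi (p.1, t))^`() p.2)%classic.

Record C1 phi : Prop := {
  C1_x : forall x t, derivable (fun y => phi (y, t)) x 1 ;
  C1_t : forall x t, derivable (fun s => phi (x, s)) t 1 ;
  C1_deriv_x : continuous (deriv_x phi) ;
  C1_deriv_t : continuous (deriv_t phi) }.

Definition tsupport phi : set (R * R) := closure [set p | phi p != 0].

Record test_function l phi : Prop := {
  test_C1 : C1 phi ;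
  test_compact : compact (tsupport phi) ;
  test_support : tsupport phi `<=` spacetime l ;
  test_ge0 : forall p, 0 <= phi p }.

(* Essential one-sided limits g(a + 0) = c and g(a - 0) = c. *)
Definition right_trace (g : R -> R) (a c : R) : Prop :=
  forall e : R, 0 < e -> exists2 d : R, 0 < d &
    {ae mu, forall x : R, a < x < a + d -> `|g x - c| < e}.
Definition left_trace (g : R -> R) (a c : R) : Prop :=
  forall e : R, 0 < e -> exists2 d : R, 0 < d &
    {ae mu, forall x : R, a - d < x < a -> `|g x - c| < e}.

(* When f is strictly convex there is at most one w != v with f w = f v; if
   there is none, i.e. at the minimum point of f, the default v is returned. *)
Definition reflect_flux f (v : R) : R :=
  xget v [set w | w != v /\ f w = f v].

Definition BLN_left f (um : R) : set R :=
  `]-oo, reflect_flux f um] `|` [set um].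
Definition BLN_right f (up : R) : set R :=
  [set up] `|` `[reflect_flux f up, +oo[.

Definition kruzhkov_ineq l f u : Prop :=
  forall (k : R) phi, test_function l phi ->
    0 <= \int[(mu \x mu)%E]_(p in spacetime l)
           (`|u p - k| * deriv_t phi p
            + Num.sg (u p - k) * (f (u p) - f k) * deriv_x phi p).

(* Entropy solution of
     u_t + f(u)_x = 0 in ]-l, l[ x ]0, +oo[,  u(., 0) = u0,
     u(-l, t) = um, u(l, t) = up in the Bardos-le Roux-Nedelec sense,
   as an element of C([0, +oo[; L^1(-l, l)) bounded on bounded time intervals.
   Time continuity gives a meaning to u(., t) for every single t. *)
Record entropy_solution l f (um up : R) (u0 : R -> R) u : Prop := {
  es_measurable : measurable_fun (dom_x l `*` `[0, +oo[ : set (R * R)) u ;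
  es_bounded : forall T : R, 0 < T -> exists M : R,
    {ae (mu \x mu)%E, forall p,
      (dom_x l `*` `]0, T[ : set (R * R)) p -> `|u p| <= M} ;
  es_continuous : forall t : R, 0 <= t ->
    (\int[mu]_(x in dom_x l) (`|u (x, s) - u (x, t)|%R)%:E)%E
      @[s --> within `[0, +oo[ (nbhs t)] --> 0%E ;
  es_initial : {ae mu, forall x : R, - l < x < l -> u (x, 0) = u0 x} ;
  es_kruzhkov : kruzhkov_ineq l f u ;
  es_left : {ae mu, forall t, 0 < t ->
    exists2 c, right_trace (fun x => u (x, t)) (- l) c & BLN_left f um c} ;
  es_right : {ae mu, forall t, 0 < t ->
    exists2 c, left_trace (fun x => u (x, t)) l c & BLN_right f up c} }.

Definition U_hyp l (um up xi x : R) : R :=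
  um * \1_(`]- l, xi[) x + up * \1_(`]xi, l[) x.

End ScalarConservationLaw.

(* Main.v *)
Require Import Defs.
From HB Require Import structures.
From mathcomp Require Import all_boot all_order all_algebra.
From mathcomp Require Import all_classical all_reals all_analysis.
From mathcomp Require Import measurable_realfun ring lra.

Set Implicit Arguments.
Unset Strict Implicit.
Unset Printing Implicit Defensive.
Import Order.TTheory GRing.Theory Num.Theory.
Import numFieldNormedType.Exports.

Local Open Scope ring_scope.
Local Open Scope classical_set_scope.

(* Write m = up, M = um and F = f - f M, so that F m = F M = 0 and F <= 0 on
   [m, M].

   Averaging in time turns the Kruzhkov inequalities into integrated ones,
   valid between any two positive times and, under a sign condition on the
   boundary flux, for weights that do not vanish at the end points.

   Trapping.  Above M the wave speed is at least f'(M) > 0, and no excess over M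
   enters at -l, so the mass of (u - M)^+ weighted by exp(- a x) decays at the
   rate a f'(M).  Letting a tend to infinity, (u - M)^+ vanishes after a finite
   time, and so does (m - u)^+.  From then on u takes its values in [m, M] and
   F(u) vanishes at both ends, so the mass of u is conserved.

   Extinction.  Put a(x,t) = \int_(-l)^x (M - u), b(x,t) = \int_x^l (u - m),
   z = a b and G(z) = z / (eps + z).  Conservation gives a_t = b_t = F(u) <= 0.
   For m < k1 < k2 < M let J(t) = \int G(z) (|u - k1| + |u - k2|).  Strong
   convexity of f and |u - k1| + |u - k2| >= k2 - k1 give
     J' <= - c \int G'(z) (b (M - u) + a (u - m)) <= - c G(z(y,t))
   for every y, because the middle integrand dominates |G(z)_x| and z vanishes at
   -l; here c > 0 does not depend on eps.  Since J is bounded independently of eps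
   and z(y,.) does not increase, taking eps = z(y,T) contradicts z(y,T) > 0 as
   soon as T is large.  Finally, z(.,T) = 0 says that u(.,T) is M to the left and
   m to the right of some point xi. *)

(** * Strong convexity of the flux *)

(** Why the product [z = a b] is the right quantity: [z_t = (a + b) F(u)] and
    [z_x = b (M - u) - a (u - m)]. For an entropy [eta = |u - k|] with flux [q], the density of [J']
    is therefore at most [G'(z)] times [b (eta F + q (M - u)) + a (eta F - q (u - m))]. Each bracket
    is nonpositive by convexity, with a gain proportional to [M - u] and to [u - m] respectively.
    Since [z] vanishes at both ends, so does the weight [G(z)], and no boundary condition on
    [|u - k|] is needed.

    The obstacle is regularity. The solution is only continuous in time with values in L^1, so
    neither [J] nor [z] may be differentiated in time. Two times [s < t] are compared instead, with
    the weight frozen at [s] and an error [o(t - s)]; a lemma on real functions then sums these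
    comparisons. In space the weights are built from the solution, hence merely Lipschitz, so the
    inequalities tested with C^1 functions must first be extended to Lipschitz weights. *)

Section Convexity.
Context {R : realType} (c0 : R) (f : R -> R).
Hypothesis c0_gt0 : 0 < c0.
Hypothesis f_derivable : forall v : R, derivable f v 1.
Hypothesis df_derivable : forall v : R, derivable (f^`())%classic v 1.
Hypothesis f_convex : forall v : R, c0 <= (f^`(2) v)%classic.
Local Notation df := (f^`())%classic.

Lemma is_derive_derive1 (g : R -> R) (x : R) :
  derivable g x 1 -> is_derive x 1 g (g^`()%classic x).
Proof. by move=> dg; rewrite derive1E; apply: derivableP. Qed.

Lemma derivable_mean_value (g : R -> R) (x y : R) :
  (forall v, derivable g v 1) -> x <= y ->
  exists2 c, x <= c <= y & g y - g x = g^`()%classic c * (y - x).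
Proof.
move=> dg xy; have [||c] := @MVT_segment R g (g^`())%classic x y xy.
- by move=> v _; apply: is_derive_derive1.
- by apply: derivable_within_continuous => v _.
- by rewrite in_itv/= => ? ?; exists c.
Qed.

Lemma strong_monotone_derive (x y : R) : x <= y -> c0 * (y - x) <= df y - df x.
Proof.
move=> xy; have [c _ ->] := derivable_mean_value df_derivable xy.
by apply: ler_wpM2r; rewrite ?subr_ge0//; have := f_convex c.
Qed.

Lemma le_derive (x y : R) : x <= y -> df x <= df y.
Proof.
move=> xy; rewrite -subr_ge0; apply: le_trans (strong_monotone_derive xy).
by rewrite mulr_ge0 ?subr_ge0// ltW.
Qed.

Lemma tangent_le_right (a x : R) : a <= x -> df a * (x - a) <= f x - f a.
Proof.
move=> ax; have [c /andP[ac _] ->] := derivable_mean_value f_derivable ax.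
by apply: ler_wpM2r; rewrite ?subr_ge0// le_derive.
Qed.

Lemma tangent_le_left (a x : R) : x <= a -> - df a * (a - x) <= f x - f a.
Proof.
move=> xa; have [c /andP[_ ca]] := derivable_mean_value f_derivable xa.
have := ler_wpM2r (ltac:(by rewrite subr_ge0) : 0 <= a - x) (le_derive ca).
by move=> ? ?; lra.
Qed.

(** Without the parabola, [g v = f v - c0 / 2 * v ^+ 2] still has a nondecreasing derivative, so its
    chord over [[x, y]] is no steeper than its chord over [[y, z]]; the cubic term is what the
    parabola contributes. Multiplying slopes by [(y - x) * (z - y)] instead of dividing covers
    [x = y] and [y = z]. *)
Lemma strong_convexity (x y z : R) : x <= y -> y <= z ->
  (z - x) * f y <=
  (z - y) * f x + (y - x) * f z - c0 / 2 * (z - y) * (y - x) * (z - x).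
Proof.
move=> xy yz; pose g v := f v - c0 / 2 * v ^+ 2.
have dg v : is_derive v (1:R) g (df v - c0 * v).
  have fd := is_derive_derive1 (@f_derivable v).
  rewrite /g; apply: is_derive_eq.
  by rewrite /GRing.scale/=; field.
have dgv v : derivable g v 1 by have := dg v; case.
have dgE v : g^`()%classic v = df v - c0 * v.
  by have [_ <-] := dg v; rewrite derive1E.
have [c /andP[_ cy] E1] := derivable_mean_value dgv xy.
have [d /andP[yd _] E2] := derivable_mean_value dgv yz.
rewrite !dgE in E1 E2.
have dc := strong_monotone_derive (le_trans cy yd).
have slope : df c - c0 * c <= df d - c0 * d by lra.
have := ler_wpM2r (ltac:(by rewrite mulr_ge0 ?subr_ge0) :
  0 <= (y - x) * (z - y)) slope.
have -> : (df c - c0 * c) * ((y - x) * (z - y)) = (g y - g x) * (z - y).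
  by rewrite E1 mulrA.
have -> : (df d - c0 * d) * ((y - x) * (z - y)) = (g z - g y) * (y - x).
  by rewrite E2; ring.
by rewrite /g; lra.
Qed.

(** The derivative is monotone, hence bounded on [[- K, K]] by its values at the two ends. *)
Lemma convex_lipschitz (K : R) : exists2 L, 0 <= L &
  forall x y, `|x| <= K -> `|y| <= K -> `|f x - f y| <= L * `|x - y|.
Proof.
exists (Num.max `|df K| `|df (- K)|); first by rewrite le_max normr_ge0.
have aux x y : x <= y -> `|x| <= K -> `|y| <= K ->
    `|f y - f x| <= Num.max `|df K| `|df (- K)| * `|y - x|.
  move=> xy xK yK; move: (xK) (yK); rewrite (ler_norml x) (ler_norml y).
  move=> /andP[xl xr] /andP[yl yr].
  have [c /andP[xc cy] ->] := derivable_mean_value f_derivable xy.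
  rewrite normrM; apply: ler_wpM2r => //.
  have h1 : df (- K) <= df c by apply: le_derive; lra.
  have h2 : df c <= df K by apply: le_derive; lra.
  have [c0'|c0'] := leP 0 (df c).
    by rewrite le_max ger0_norm// (le_trans h2 (ler_norm _)).
  rewrite le_max ltr0_norm//; apply/orP; right.
  by rewrite (@le_trans _ _ (- df (- K))) ?lerN2// -normrN ler_norm.
move=> x y xK yK; have [xy|/ltW yx] := leP x y; last exact: aux.
by rewrite distrC (distrC x); apply: aux.
Qed.

End Convexity.

(** * Entropy fluxes and dissipation between the two shock states *)

Section ShockInequalities.
Context {R : realType} (m M c0 : R) (f : R -> R).
Hypothesis c0_gt0 : 0 < c0.
Hypothesis f_derivable : forall v : R, derivable f v 1.
Hypothesis df_derivable : forall v : R, derivable (f^`())%classic v 1.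
Hypothesis f_convex : forall v : R, c0 <= (f^`(2) v)%classic.
Hypothesis f_eq : f m = f M.

(* Equal to [Num.sg (y - k) * (f y - f k)], but visibly continuous in [y]. *)
Definition kflux (k y : R) : R := f (Num.max y k) - f (Num.min y k).

Lemma kfluxE (k y : R) : kflux k y = Num.sg (y - k) * (f y - f k).
Proof.
rewrite /kflux; have [yk|yk|->] := ltgtP y k; last by rewrite !subrr mulr0.
- by rewrite ltr0_sg ?subr_lt0// mulN1r opprB.
- by rewrite gtr0_sg ?subr_gt0// mul1r.
Qed.

Lemma flux_between_le0 (y : R) : m <= y <= M -> f y - f M <= 0.
Proof.
move=> /andP[my yM]; have [mM|mM] := eqVneq m M.
  by have -> : y = M by [lra|]; rewrite subrr.
have {}mM : 0 < M - m by rewrite subr_gt0 lt_neqAle mM; lra.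
have := strong_convexity f_derivable df_derivable f_convex my yM.
rewrite f_eq => h; have h2 : 0 <= c0 / 2 * (M - y) * (y - m) * (M - m).
  by rewrite !mulr_ge0// ?subr_ge0// ltW// ?subr_gt0//; lra.
by rewrite -(pmulr_rle0 _ mM); lra.
Qed.

(* Both cases are strong convexity at the middle one of [k], [y] and [M]. *)
Lemma left_dissipation (k y : R) : k <= M -> y <= M ->
  `|y - k| * (f y - f M) + kflux k y * (M - y)
    <= - (c0 / 2) * (M - k) * (M - y) * `|y - k|.
Proof.
move=> kM yM; rewrite kfluxE.
have sc := strong_convexity f_derivable df_derivable f_convex.
have [yk|yk|->] := ltgtP y k; last by rewrite !subrr normr0; lra.
- rewrite ltr0_norm ?subr_lt0// ltr0_sg ?subr_lt0//.
  by have := sc _ _ _ (ltW yk) kM; lra.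
- rewrite gtr0_norm ?subr_gt0// gtr0_sg ?subr_gt0//.
  by have := sc _ _ _ (ltW yk) yM; lra.
Qed.

(** Mirror image of [left_dissipation] at the state [m]: as [f m = f M], the quantity [f y - f M] is
    also [f y - f m], and strong convexity is used at the middle one of [m], [k] and [y]. *)
Lemma right_dissipation (k y : R) : m <= k -> m <= y ->
  `|y - k| * (f y - f M) - kflux k y * (y - m)
    <= - (c0 / 2) * (k - m) * (y - m) * `|y - k|.
Proof.
move=> mk my; rewrite kfluxE -f_eq.
have sc := strong_convexity f_derivable df_derivable f_convex.
have [yk|yk|->] := ltgtP y k; last by rewrite !subrr normr0; lra.
- rewrite ltr0_norm ?subr_lt0// ltr0_sg ?subr_lt0//.
  by have := sc _ _ _ my (ltW yk); lra.
- rewrite gtr0_norm ?subr_gt0// gtr0_sg ?subr_gt0//.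
  by have := sc _ _ _ mk (ltW yk); lra.
Qed.

End ShockInequalities.

(** * Integrals of bounded functions *)

Section AlmostEverywhere.
Context d (T : measurableType d) (R : realType).
Variables (mu : {measure set T -> \bar R}).
Implicit Types P Q : T -> Prop.

Lemma ae_imp P Q : (forall x, P x -> Q x) ->
  {ae mu, forall x, P x} -> {ae mu, forall x, Q x}.
Proof. by move=> PQ; apply: filterS. Qed.

Lemma ae_imp2 P1 P2 Q : (forall x, P1 x -> P2 x -> Q x) ->
  {ae mu, forall x, P1 x} -> {ae mu, forall x, P2 x} -> {ae mu, forall x, Q x}.
Proof. by move=> PQ; apply: filterS2. Qed.

End AlmostEverywhere.

Section BoundedMeasurable.
Context d (T : measurableType d) (R : realType).
Variables (mu : {measure set T -> \bar R}).

(** Measurability is asked on the whole space and the bound only on [D]: sections and compositions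
    then need no domain conditions, and on a [D] of finite measure the bound gives integrability. *)
Definition bm (D : set T) (g : T -> R) : Prop :=
  measurable_fun setT g /\ exists K : R, forall x, D x -> `|g x| <= K.

Section closure.
Variable D : set T.
Implicit Types g h : T -> R.

Lemma bm_cst (c : R) : bm D (fun=> c).
Proof. by split; [exact: measurable_cst|exists `|c|]. Qed.

Lemma bmD g h : bm D g -> bm D h -> bm D (fun x => g x + h x).
Proof.
move=> [mg [K gK]] [mh [L hL]]; split; first exact: measurable_funD.
exists (K + L) => x Dx; rewrite (le_trans (ler_normD _ _))// lerD ?gK ?hL//.
Qed.

Lemma bmN g : bm D g -> bm D (fun x => - g x).
Proof.
move=> [mg [K gK]]; split; first exact: measurableT_comp.
by exists K => x Dx; rewrite normrN gK.
Qed.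

Lemma bmB g h : bm D g -> bm D h -> bm D (fun x => g x - h x).
Proof. by move=> bg bh; apply: bmD => //; exact: bmN. Qed.

Lemma bmM g h : bm D g -> bm D h -> bm D (fun x => g x * h x).
Proof.
move=> [mg [K gK]] [mh [L hL]]; split; first exact: measurable_funM.
by exists (K * L) => x Dx; rewrite normrM ler_pM ?gK ?hL.
Qed.

Lemma bmZ (c : R) g : bm D g -> bm D (fun x => c * g x).
Proof. by move=> bg; apply: bmM => //; exact: bm_cst. Qed.

Lemma bm_norm g : bm D g -> bm D (fun x => `|g x|).
Proof.
move=> [mg [K gK]]; split; first exact: measurableT_comp.
by exists K => x Dx; rewrite normr_id gK.
Qed.

Lemma bm_max g h : bm D g -> bm D h -> bm D (fun x => Num.max (g x) (h x)).
Proof.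
move=> [mg [K gK]] [mh [L hL]]; split; first exact: measurable_maxr.
exists (K + L) => x Dx; have := gK _ Dx; have := hL _ Dx.
have := normr_ge0 (g x); have := normr_ge0 (h x).
by rewrite /Num.max; case: ifP => _ *; lra.
Qed.

End closure.

Lemma bmS (D E : set T) g : D `<=` E -> bm E g -> bm D g.
Proof. by move=> DE [mg [K gK]]; split => //; exists K => x /DE /gK. Qed.

Variables (D : set T) (mD : measurable D) (finD : (mu D < +oo)%E).
Implicit Types g h : T -> R.

Lemma bm_integrable g : bm D g -> mu.-integrable D (EFin \o g).
Proof.
move=> [mg [K gK]]; apply: measurable_bounded_integrable => //.
  exact: measurable_funS mg.
exists K; split; first exact: num_real.
by move=> L KL x Dx; apply: (le_trans (gK _ Dx)); exact: ltW.
Qed.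

Lemma RintD g h : bm D g -> bm D h ->
  \int[mu]_(x in D) (g x + h x) = \int[mu]_(x in D) g x + \int[mu]_(x in D) h x.
Proof. by move=> bg bh; apply: RintegralD => //; exact: bm_integrable. Qed.

Lemma RintB g h : bm D g -> bm D h ->
  \int[mu]_(x in D) (g x - h x) = \int[mu]_(x in D) g x - \int[mu]_(x in D) h x.
Proof. by move=> bg bh; apply: RintegralB => //; exact: bm_integrable. Qed.

Lemma RintZ (c : R) g : bm D g ->
  \int[mu]_(x in D) (c * g x) = c * \int[mu]_(x in D) g x.
Proof. by move=> bg; apply: RintegralZl => //; exact: bm_integrable. Qed.

Lemma RintN g : bm D g -> \int[mu]_(x in D) (- g x) = - \int[mu]_(x in D) g x.
Proof.
move=> bg; rewrite -[RHS]mulN1r -RintZ//.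
by apply: eq_Rintegral => x _; rewrite mulN1r.
Qed.

Lemma eq_Rint g h : (forall x, D x -> g x = h x) ->
  \int[mu]_(x in D) g x = \int[mu]_(x in D) h x.
Proof. by move=> gh; apply: eq_Rintegral => x /set_mem /gh. Qed.

Lemma le_Rint g h : bm D g -> bm D h -> (forall x, D x -> g x <= h x) ->
  \int[mu]_(x in D) g x <= \int[mu]_(x in D) h x.
Proof. by move=> bg bh gh; apply: le_Rintegral => //; exact: bm_integrable. Qed.

Lemma eq_Rint_ae g h : bm D g -> bm D h ->
  {ae mu, forall x, D x -> g x = h x} ->
  \int[mu]_(x in D) g x = \int[mu]_(x in D) h x.
Proof.
move=> [mg _] [mh _] gh; congr fine; apply: ae_eq_integral => //.
- by apply/measurable_EFinP; exact: measurable_funS mg.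
- by apply/measurable_EFinP; exact: measurable_funS mh.
- by apply: filterS gh => x gh Dx; rewrite gh.
Qed.

Lemma le_Rint_ae g h : bm D g -> bm D h ->
  {ae mu, forall x, D x -> g x <= h x} ->
  \int[mu]_(x in D) g x <= \int[mu]_(x in D) h x.
Proof.
move=> bg bh gh.
(* Replacing [h] by the maximum, equal to it almost everywhere, makes the comparison hold
   everywhere. *)
rewrite (@eq_Rint_ae h (fun x => Num.max (g x) (h x)))//; last 2 first.
- exact: bm_max.
- by apply: filterS gh => x gh /gh /max_r.
by apply: le_Rint => [//||x _]; [exact: bm_max|rewrite le_max lexx].
Qed.

Lemma norm_Rint_le g : bm D g ->
  `|\int[mu]_(x in D) g x| <= \int[mu]_(x in D) `|g x|.
Proof. by move=> bg; apply: le_normr_Rintegral => //; exact: bm_integrable. Qed.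

Lemma Rint_cst (c : R) : \int[mu]_(x in D) c = c * fine (mu D).
Proof. exact: Rintegral_cst. Qed.

Lemma norm_Rint_le_cst g (K : R) : bm D g -> (forall x, D x -> `|g x| <= K) ->
  `|\int[mu]_(x in D) g x| <= K * fine (mu D).
Proof.
move=> bg gK; rewrite (le_trans (norm_Rint_le bg))// -Rint_cst.
by apply: le_Rint => //; [exact: bm_norm|exact: bm_cst].
Qed.

Lemma Rint_eq0_ae g : bm D g -> (forall x, D x -> 0 <= g x) ->
  \int[mu]_(x in D) g x = 0 -> {ae mu, forall x, D x -> g x = 0}.
Proof.
move=> bg g0 ig.
have mg : measurable_fun D (EFin \o g).
  by have /integrableP[] := bm_integrable bg.
have : (\int[mu]_(x in D) `|(EFin \o g) x| = 0)%E.
  rewrite (@eq_integral _ _ _ mu D (fun x => (g x)%:E)); last first.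
    by move=> x /set_mem /g0 g0x; rewrite /= ger0_norm.
  rewrite -[LHS]fineK; first by congr EFin.
  exact: integrable_fin_num (bm_integrable bg).
move/(ae_eq_integral_abs mu mD mg); apply: filterS => x gx Dx.
by have [] := gx Dx.
Qed.

Lemma bounded_cvg (g_ : nat -> T -> R) g (K : R) :
  (forall n, measurable_fun setT (g_ n)) -> measurable_fun setT g ->
  (forall n x, D x -> `|g_ n x| <= K) ->
  {ae mu, forall x, D x -> g_ ^~ x @ \oo --> g x} ->
  \int[mu]_(x in D) g_ n x @[n --> \oo] --> \int[mu]_(x in D) g x.
Proof.
move=> mg_ mg gK cg.
have [|||||ig _ h] := @dominated_convergence _ _ _ mu D mD
  (fun n => EFin \o g_ n) (EFin \o g) (fun=> K%:E).
- by move=> n; apply/measurable_EFinP; exact: measurable_funS (mg_ n).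
- by apply/measurable_EFinP; exact: measurable_funS mg.
- apply: (filterS _ cg) => x {}cg Dx; apply: (@cvg_comp _ _ _ _ EFin _ _ _ (cg Dx)).
  exact: cvg_id.
- by apply: (bm_integrable (bm_cst _ _)).
- by apply: aeW => x n Dx; rewrite /= lee_fin gK.
apply: fine_cvg; rewrite fineK; last exact: integrable_fin_num.
exact: h.
Qed.

End BoundedMeasurable.

(** * Fubini's theorem on boxes and sections of null sets *)

Section Fubini.
Context (R : realType).
Implicit Types d : measure_display.

(** Integrability is not assumed: the integral is by definition the difference of the integrals of
    the positive and negative parts, and Tonelli's theorem makes each of these measurable. *)
Lemma measurable_fine_fubini_G d d' (S : measurableType d)
    (S' : measurableType d') (m : {sigma_finite_measure set S -> \bar R})
    (F : S * S' -> R) : measurable_fun setT F ->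
  measurable_fun setT (fun t => fine (\int[m]_x (F (x, t))%:E)%E).
Proof.
move=> mF; have mEF : measurable_fun setT (EFin \o F) by exact/measurable_EFinP.
apply: measurableT_comp => //=.
have -> : (fun t => \int[m]_x (F (x, t))%:E)%E =
    (fubini_G m (EFin \o F)^\+ \- fubini_G m (EFin \o F)^\-)%E.
  apply/funext => t; rewrite [LHS]integralE.
  by congr (_ - _)%E; apply: eq_integral => x _; rewrite ?funeposE ?funenegE.
apply: emeasurable_funB; apply: measurable_fun_fubini_tonelli_G => //.
  exact: measurable_funepos.
exact: measurable_funeneg.
Qed.

Lemma measurable_fine_fubini_F d d' (S : measurableType d)
    (S' : measurableType d') (m : {sigma_finite_measure set S' -> \bar R})
    (F : S * S' -> R) : measurable_fun setT F ->
  measurable_fun setT (fun x => fine (\int[m]_t (F (x, t))%:E)%E).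
Proof.
move=> mF; have mEF : measurable_fun setT (EFin \o F) by exact/measurable_EFinP.
apply: measurableT_comp => //=.
have -> : (fun x => \int[m]_t (F (x, t))%:E)%E =
    (fubini_F m (EFin \o F)^\+ \- fubini_F m (EFin \o F)^\-)%E.
  apply/funext => t; rewrite [LHS]integralE.
  by congr (_ - _)%E; apply: eq_integral => x _; rewrite ?funeposE ?funenegE.
apply: emeasurable_funB; apply: measurable_fun_fubini_tonelli_F => //.
  exact: measurable_funepos.
exact: measurable_funeneg.
Qed.

Section Box.
Context d1 d2 (T1 : measurableType d1) (T2 : measurableType d2).
Variables (m1 : {sigma_finite_measure set T1 -> \bar R}).
Variables (m2 : {sigma_finite_measure set T2 -> \bar R}).
Variables (A : set T1) (B : set T2).
Hypotheses (mA : measurable A) (mB : measurable B).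
Implicit Types F : T1 * T2 -> R.

Lemma measurable_Rint_fst F : measurable_fun setT F ->
  measurable_fun setT (fun t => \int[m1]_(x in A) F (x, t)).
Proof.
move=> mF; pose G p := F p * \1_A p.1.
have -> : (fun t => \int[m1]_(x in A) F (x, t)) =
    (fun t => fine (\int[m1]_x (G (x, t))%:E)%E).
  apply/funext => t; rewrite Rintegral_mkcond; apply: eq_Rintegral => x _.
  by rewrite patchE/G indicE/=; case: ifP; rewrite ?(mulr1, mulr0).
apply: measurable_fine_fubini_G; apply: measurable_funM => //.
by apply: measurableT_comp => //; exact: measurable_indic.
Qed.

Lemma measurable_Rint_snd F : measurable_fun setT F ->
  measurable_fun setT (fun x => \int[m2]_(t in B) F (x, t)).
Proof.
move=> mF; pose G p := F p * \1_B p.2.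
have -> : (fun x => \int[m2]_(t in B) F (x, t)) =
    (fun x => fine (\int[m2]_t (G (x, t))%:E)%E).
  apply/funext => t; rewrite Rintegral_mkcond; apply: eq_Rintegral => x _.
  by rewrite patchE/G indicE/=; case: ifP; rewrite ?(mulr1, mulr0).
apply: measurable_fine_fubini_F; apply: measurable_funM => //.
by apply: measurableT_comp => //; exact: measurable_indic.
Qed.

Hypotheses (finA : (m1 A < +oo)%E) (finB : (m2 B < +oo)%E).

Lemma measure_box_lty : ((m1 \x m2)%E (A `*` B) < +oo)%E.
Proof.
rewrite product_measure1E//; apply: lte_mul_pinfty => //.
by rewrite ge0_fin_numE.
Qed.

Lemma Rint_box_snd_fst F : bm (A `*` B) F ->
  \int[(m1 \x m2)%E]_(p in A `*` B) F p =
  \int[m2]_(t in B) \int[m1]_(x in A) F (x, t).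
Proof.
move=> bF; pose G := F \_ (A `*` B).
have iG : (m1 \x m2)%E.-integrable setT (EFin \o G).
  have := bm_integrable (measurableX mA mB) measure_box_lty bF.
  by move/(integrable_mkcond _ (measurableX mA mB)); rewrite restrict_EFin.
rewrite Rintegral_mkcond -/G /Rintegral -integral21_prod_meas1//.
rewrite [in RHS]integral_mkcond; congr fine; apply: eq_integral => t _.
rewrite patchE /fubini_G/=; case: ifPn => tB.
  rewrite fineK.
    rewrite [RHS]integral_mkcond; apply: eq_integral => x _.
    rewrite restrict_EFin/= /G !patchE in_setX tB andbT; by case: ifP.
  apply: integrable_fin_num => //.
  have bFt : bm A (fun x => F (x, t)).
    case: bF => mF [K FK]; split; first exact: measurable_fun_pair1.
    by exists K => x Ax; apply: FK; split => //=; exact: set_mem.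
  exact: bm_integrable.
rewrite (_ : (fun x => _) = cst 0%E) ?integral0//; apply/funext => x/=.
by rewrite /G patchE in_setX (negbTE tB) andbF.
Qed.

Lemma Rint_box_fst_snd F : bm (A `*` B) F ->
  \int[(m1 \x m2)%E]_(p in A `*` B) F p =
  \int[m1]_(x in A) \int[m2]_(t in B) F (x, t).
Proof.
move=> bF; pose G := F \_ (A `*` B).
have iG : (m1 \x m2)%E.-integrable setT (EFin \o G).
  have := bm_integrable (measurableX mA mB) measure_box_lty bF.
  by move/(integrable_mkcond _ (measurableX mA mB)); rewrite restrict_EFin.
rewrite Rintegral_mkcond -/G /Rintegral -integral12_prod_meas1//.
rewrite [in RHS]integral_mkcond; congr fine; apply: eq_integral => t _.
rewrite patchE /fubini_F/=; case: ifPn => tB.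
  rewrite fineK.
    rewrite [RHS]integral_mkcond; apply: eq_integral => x _.
    rewrite restrict_EFin/= /G !patchE in_setX tB /=; by case: ifP.
  apply: integrable_fin_num => //.
  have bFt : bm B (fun x => F (t, x)).
    case: bF => mF [K FK]; split; first exact: measurable_fun_pair2.
    by exists K => x Ax; apply: FK; split => //=; exact: set_mem.
  exact: bm_integrable.
rewrite (_ : (fun x => _) = cst 0%E) ?integral0//; apply/funext => x/=.
by rewrite /G patchE in_setX (negbTE tB).
Qed.

Lemma Rint_swap F : bm (A `*` B) F ->
  \int[m2]_(t in B) \int[m1]_(x in A) F (x, t) =
  \int[m1]_(x in A) \int[m2]_(t in B) F (x, t).
Proof. by move=> bF; rewrite -Rint_box_snd_fst// Rint_box_fst_snd. Qed.

Lemma ae_box_fst (P : T1 -> Prop) : {ae m1, forall x, P x} ->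
  {ae (m1 \x m2)%E, forall p, P p.1}.
Proof.
move=> [N [mN N0 PN]]; exists (N `*` setT); split.
- exact: measurableX.
- rewrite product_measure1E// -[RHS](mul0e (m2 setT)).
  by congr (_ * _)%E; exact: N0.
- by move=> p /= nP; split => //; exact: PN.
Qed.

Lemma ae_box_snd (P : T2 -> Prop) : {ae m2, forall x, P x} ->
  {ae (m1 \x m2)%E, forall p, P p.2}.
Proof.
move=> [N [mN N0 PN]]; exists (setT `*` N); split.
- exact: measurableX.
- rewrite product_measure1E// -[RHS](mule0 (m1 setT)).
  by congr (_ * _)%E; exact: N0.
- by move=> p /= nP; split => //; exact: PN.
Qed.

(** By Tonelli, the measures of the sections of a null set integrate to zero. This is how a bound
    known almost everywhere in space-time is obtained at a single, suitably chosen time. *)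
Lemma ae_section (P : T1 * T2 -> Prop) : {ae (m1 \x m2)%E, forall p, P p} ->
  {ae m2, forall t, {ae m1, forall x, P (x, t)}}.
Proof.
move=> [N [mN N0 PN]].
have mI : measurable_fun setT (EFin \o (\1_N : T1 * T2 -> R)).
  by apply/measurable_EFinP; exact: measurable_indic.
have : (\int[m2]_t fubini_G m1 (EFin \o (\1_N : T1 * T2 -> R)) t = 0)%E.
  rewrite -fubini_tonelli2//; last by move=> p; rewrite lee_fin.
  by rewrite integral_indic// setIT; exact: N0.
move=> h0.
have G0 t : (0 <= fubini_G m1 (EFin \o (\1_N : T1 * T2 -> R)) t)%E.
  by apply: integral_ge0 => x _; rewrite lee_fin.
have : (\int[m2]_t `|fubini_G m1 (EFin \o (\1_N : T1 * T2 -> R)) t| = 0)%E.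
  by rewrite -h0; apply: eq_integral => t _; rewrite gee0_abs.
have mG : measurable_fun setT (fubini_G m1 (EFin \o (\1_N : T1 * T2 -> R))).
  by apply: measurable_fun_fubini_tonelli_G => // p; rewrite lee_fin.
move/(ae_eq_integral_abs m2 measurableT mG); apply: filterS => t /(_ I) Gt.
exists (ysection N t); split; first exact: measurable_ysection.
  have my := measurable_ysection t mN.
  have := integral_indic m1 measurableT my; rewrite setIT => <-.
  transitivity (fubini_G m1 (EFin \o (\1_N : T1 * T2 -> R)) t); last exact: Gt.
  by apply: eq_integral => x _; rewrite /= !indicE mem_ysection.
by move=> x /= nP; rewrite /ysection/= inE; exact: PN.
Qed.

End Box.
End Fubini.

(** * Lipschitz functions of one variable and the fundamental theorem of calculus *)

Section OneVariable.
Context {R : realType}.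
Local Notation mu := (@lebesgue_measure R).
Implicit Types (f g psi : R -> R) (a b c d x : R).

Lemma lebesgue_itv_lty a b (b0 b1 : bool) :
  (mu [set` Interval (BSide b0 a) (BSide b1 b)] < +oo)%E.
Proof.
by rewrite lebesgue_measure_itv/=; case: ifP => // _; rewrite -EFinB ltry.
Qed.

Lemma is_derive_quotient f x (df : R) : is_derive x 1 f df ->
  h^-1 * (f (x + h) - f x) @[h --> 0^'] --> df.
Proof.
move=> [dfx <-].
have -> : (fun h => h^-1 * (f (x + h) - f x)) =
    (fun h => h^-1 *: ((f \o shift x) (h *: (1 : R)) - f x)).
  by apply/funext => h /=; rewrite /GRing.scale/= mulr1 [x + h]addrC.
exact: dfx.
Qed.

Lemma is_derive_quotient_seq f x (df : R) (h_ : nat -> R) :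
  is_derive x 1 f df -> (forall n, 0 < h_ n) -> h_ @ \oo --> 0 ->
  (h_ n)^-1 * (f (x + h_ n) - f x) @[n --> \oo] --> df.
Proof.
move=> /is_derive_quotient fx h0 hcvg.
have : h_ @ \oo --> 0^'.
  move=> A /= /nbhs_ballP[e /= e0 eA].
  move/cvgrPdist_lt/(_ _ e0) : hcvg; apply: filterS => n hn.
  by apply: eA => //; rewrite gt_eqF.
by move=> hh; apply: cvg_comp hh fx.
Qed.

Lemma lipschitz_continuous f (L : R) :
  (forall x y, `|f x - f y| <= L * `|x - y|) -> continuous f.
Proof.
move=> fL x; apply/cvgrPdist_lt => e e0.
have L0 : 0 < `|L| + 1 by rewrite ltr_wpDl.
near=> y; rewrite (le_lt_trans (fL _ _))//.
rewrite (@le_lt_trans _ _ ((`|L| + 1) * `|x - y|))//.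
  by apply: ler_wpM2r => //; rewrite (le_trans (ler_norm L)) ?lerDl.
rewrite -ltr_pdivlMl//; near: y; apply: cvgr_dist_lt => //.
by rewrite mulr_gt0 ?invr_gt0.
Unshelve. all: by end_near. Qed.

Lemma lipschitz_measurable f (L : R) :
  (forall x y, `|f x - f y| <= L * `|x - y|) -> measurable_fun setT f.
Proof. by move=> /lipschitz_continuous /continuous_measurable_fun. Qed.

(** Vanishing to the left of [c] makes [f] integrable on every half-line []-oo, x]], so a single
    formula gives an antiderivative on the whole line. *)
Lemma continuous_antiderivative f c : continuous f ->
  (forall x, x <= c -> f x = 0) ->
  exists P : R -> R, forall x, is_derive x (1 : R) P (f x).
Proof.
move=> cf f0; pose P x : R := \int[mu]_(t in `]-oo, x]) f t.
exists P => x.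
have iu (u : R) : mu.-integrable `]-oo, u] (EFin \o f).
  have i1 : mu.-integrable `[c, Num.max c u] (EFin \o f).
    apply: continuous_compact_integrable; first exact: segment_compact.
    by apply: continuous_subspaceT => z; exact: cf.
  have : mu.-integrable setT (EFin \o (f \_ `[c, Num.max c u])).
    by move: i1; rewrite integrable_mkcond//= restrict_EFin.
  move=> i2.
  have i3 : mu.-integrable `]-oo, u] (EFin \o (f \_ `[c, Num.max c u])).
    by apply: (integrableS measurableT _ _ i2).
  apply: eq_integrable i3 => // z; rewrite inE/= in_itv/= => zu.
  congr EFin; rewrite patchE; case: ifPn => //.
  rewrite notin_setE/= in_itv/= le_max zu orbT andbT => /negP; rewrite -ltNge.
  by move=> zc; rewrite f0// ltW.
have [||dP dPE] := @continuous_FTC1 R f -oo%O x (x + 1) _ (iu _) _ (@cf x).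
- by rewrite ltrDl.
- by rewrite ltNyr.
by rewrite -dPE; apply: is_derive_derive1.
Qed.

(** For [a <= b] this is the projection onto [[a, b]]. Composition with it extends a function on
    [[a, b]] by constants without increasing its Lipschitz constant. *)
Definition clamp a b x := Num.max a (Num.min b x).

Lemma clamp_itv a b x : a <= b -> a <= clamp a b x <= b.
Proof. by move=> ab; rewrite /clamp le_max lexx/= ge_max ab ge_min lexx. Qed.

Lemma clamp_id a b x : a <= x <= b -> clamp a b x = x.
Proof. by move=> /andP[ax xb]; rewrite /clamp min_r// max_r. Qed.

Lemma maxr_lip k x y : `|Num.max x k - Num.max y k| <= `|x - y|.
Proof.
wlog xy : x y / x <= y.
  by move=> h; have [/h//|/ltW/h] := leP x y; rewrite distrC (distrC y).
rewrite distrC (distrC x) !ger0_norm ?subr_ge0//; last first.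
  by rewrite ge_max !le_max xy lexx orbT.
rewrite lerBlDr ge_max; apply/andP; split.
  by rewrite -lerBlDl opprB addrC subrK le_max lexx.
by rewrite -[leLHS]add0r lerD ?subr_ge0// le_max lexx orbT.
Qed.

Lemma minr_lip k x y : `|Num.min x k - Num.min y k| <= `|x - y|.
Proof.
have E z : Num.min z k = - Num.max (- z) (- k) by rewrite -oppr_min opprK.
by rewrite !E opprK addrC (le_trans (maxr_lip _ _ _))// opprK addrC.
Qed.

Lemma clamp_lip a b x y : `|clamp a b x - clamp a b y| <= `|x - y|.
Proof.
rewrite /clamp !(maxC a) !(minC b).
exact: le_trans (maxr_lip _ _ _) (minr_lip _ _ _).
Qed.

Lemma clamp_left a b x : a <= b -> x <= a -> clamp a b x = a.
Proof. by move=> ab xa; rewrite /clamp min_r ?max_l// (le_trans xa). Qed.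

(* The difference quotients are bounded and converge almost everywhere. *)
Lemma lipschitz_FTC a b psi g (L K : R) : a < b ->
  (forall x y, a <= x <= b -> a <= y <= b ->
    `|psi x - psi y| <= L * `|x - y|) ->
  measurable_fun setT g -> (forall x, a < x < b -> `|g x| <= K) ->
  {ae mu, forall x, a < x < b -> is_derive x (1 : R) psi (g x)} ->
  \int[mu]_(x in `]a, b[) g x = psi b - psi a.
Proof.
move=> ab psiL mg gK dpsi.
have ab' := ltW ab.
(* Extended by constants and normalised at [a], the function becomes Lipschitz on the line and
   vanishes left of [a], hence has an antiderivative. *)
pose phi x := psi (clamp a b x) - psi a.
have L0 : 0 <= L.
  have := psiL a b; rewrite !lexx ab' => /(_ isT isT) h.
  have : 0 < `|a - b| by rewrite normr_gt0 subr_eq0 lt_eqF.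
  by move=> h2; rewrite -(pmulr_lge0 _ h2) (le_trans _ h).
have phiL x y : `|phi x - phi y| <= L * `|x - y|.
  rewrite /phi opprB addrA subrK.
  rewrite (le_trans (psiL _ _ (clamp_itv _ ab') (clamp_itv _ ab')))//.
  by rewrite ler_wpM2l// clamp_lip.
have phi0 x : x <= a -> phi x = 0 by move=> xa; rewrite /phi clamp_left// subrr.
have cphi := lipschitz_continuous phiL.
have [P dP] := continuous_antiderivative cphi phi0.
pose h_ n : R := n.+1%:R^-1.
have h0 n : 0 < h_ n by rewrite invr_gt0.
have hcvg : h_ @ \oo --> 0 by exact: cvg_harmonic.
pose q n x := (h_ n)^-1 * (phi (x + h_ n) - phi x).
have cq n : continuous (q n).
  move=> x; apply: cvgM; first exact: cvg_cst.
  apply: cvgB; last exact: cphi.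
  apply: (@cvg_comp _ _ _ (fun x => x + h_ n) phi _ (nbhs (x + h_ n))).
    by apply: cvgD; [exact: cvg_id|exact: cvg_cst].
  exact: cphi.
have qL n x : `|q n x| <= L.
  rewrite /q normrM gtr0_norm ?invr_gt0// ler_pdivrMl// mulrC.
  by rewrite (le_trans (phiL _ _))// addrAC subrr add0r gtr0_norm.
have finI : (mu `]a, b[ < +oo)%E by rewrite lebesgue_measure_itv/= lte_fin ab ltry.
have c1 : \int[mu]_(x in `]a, b[) q n x @[n --> \oo] -->
    \int[mu]_(x in `]a, b[) g x.
  apply: (@bounded_cvg _ _ _ mu _ _ finI q g L) => //.
    by move=> n; exact: continuous_measurable_fun.
  apply: ae_imp dpsi => x dx /=; rewrite in_itv/= => xab.
  apply: is_derive_quotient_seq => //.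
  have : is_derive x (1 : R) (fun z => psi z - psi a) (g x - 0).
    by have := dx xab => dx'; apply: is_deriveB.
  rewrite subr0; apply: near_eq_is_derive.
  near=> z; rewrite /phi clamp_id//.
  by apply/andP; split; apply/ltW; near: z; [apply: lt_nbhsr|apply: lt_nbhsl];
    case/andP : xab.
(* A difference quotient integrates to the mean of [phi] over [[b, b + h_ n]] minus its mean over
   [[a, a + h_ n]]; these means tend to [phi b] and [phi a]. *)
have c2 n : \int[mu]_(x in `]a, b[) q n x =
    (h_ n)^-1 * (P (b + h_ n) - P b) - (h_ n)^-1 * (P (a + h_ n) - P a).
  pose Q x := (h_ n)^-1 * (P (x + h_ n) - P x).
  have dQ x : is_derive x (1 : R) Q (q n x).
    have d1 := dP x; have d2 := dP (x + h_ n).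
    have d3 : is_derive x (1 : R) (P \o (fun z => z + h_ n)) (phi (x + h_ n) * 1).
      apply: is_derive1_comp.
      by have := @is_derive_shift R x (1 : R) (h_ n).
    rewrite mulr1 in d3.
    have d4 := is_deriveB d3 d1.
    have := is_deriveZ (h_ n)^-1 d4.
    by [].
  have -> : \int[mu]_(x in `]a, b[) q n x = \int[mu]_(x in `[a, b]) q n x.
    have iq (b0 b1 : bool) : mu.-integrable
        [set` Interval (BSide b0 a) (BSide b1 b)] (EFin \o q n).
      apply: bm_integrable => //; first exact: lebesgue_itv_lty.
      by split; [exact: continuous_measurable_fun|exists L => ? _].
    by rewrite -Rintegral_itv_obnd_cbnd// -Rintegral_itv_bndo_bndc.
  rewrite /Rintegral (@continuous_FTC2 _ _ Q)//.
  - by apply: continuous_subspaceT; exact: cq.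
  - have cQ : continuous Q.
      move=> x; apply: differentiable_continuous; apply/derivable1_diffP.
      by have [] := dQ x.
    split; [by move=> x _; have [] := dQ x| |].
      exact: (cvg_at_right_filter (cQ a)).
    exact: (cvg_at_left_filter (cQ b)).
  - by move=> x _; rewrite derive1E; have [] := dQ x.
have c3 : \int[mu]_(x in `]a, b[) q n x @[n --> \oo] --> phi b - phi a.
  rewrite (_ : (fun n => _) = (fun n => (h_ n)^-1 * (P (b + h_ n) - P b) -
     (h_ n)^-1 * (P (a + h_ n) - P a))); last exact/funext.
  by apply: cvgB; apply: is_derive_quotient_seq.
rewrite (cvg_unique _ c1 c3)//= /phi !clamp_id ?lexx ?ab'// subrr subr0//.
Unshelve. all: by end_near. Qed.

End OneVariable.

(** * Test functions and inequalities at fixed times *)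

Section Profiles.
Context {R : realType}.
Local Notation mu := (@lebesgue_measure R).
Implicit Types (psi g S D : R -> R) (c d x s t r : R).

Record smooth_profile c d S D : Prop := {
  sp_ge0 : forall x, 0 <= S x ;
  sp_der : forall x, is_derive x (1 : R) S (D x) ;
  sp_cont : continuous D ;
  sp_supp : exists2 r, 0 < r &
    forall x, ~~ (c + r <= x <= d - r) -> S x = 0 /\ D x = 0 }.

(** The derivative of a Lipschitz weight exists only almost everywhere, so a bounded measurable
    representative [g], defined at every point, is carried along with it. *)
Record lip_profile c d psi g : Prop := {
  lp_ge0 : forall x, 0 <= psi x ;
  lp_lip : exists L, forall x y, `|psi x - psi y| <= L * `|x - y| ;
  lp_meas : measurable_fun setT g ;
  lp_bound : exists K, forall x, `|g x| <= K ;
  lp_supp : exists2 r, 0 < r &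
    forall x, ~~ (c + r <= x <= d - r) -> psi x = 0 /\ g x = 0 ;
  lp_der : {ae mu, forall x, c < x < d -> is_derive x (1 : R) psi (g x)} }.

(* [S n] is the Steklov average [h^-1 * \int_x^(x+h) psi] for some [h] of order
   [1 / n], and [D n] is its derivative. *)
Lemma steklov c d psi g : lip_profile c d psi g ->
  exists S D : nat -> R -> R, exists C : R,
  [/\ forall n, smooth_profile c d (S n) (D n),
      forall n x, `|S n x| <= C /\ `|D n x| <= C,
      forall x, S ^~ x @ \oo --> psi x &
      {ae mu, forall x, D ^~ x @ \oo --> g x}].
Proof.
move=> [psi0 [L psiL] _ _ [r r0 psis] dpsi].
have cpsi := lipschitz_continuous psiL.
have psic x : x <= c -> psi x = 0.
  move=> xc; have [] := psis x; last by [].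
  by rewrite negb_and -ltNge (le_lt_trans xc)// ltrDl.
have [P dP] := continuous_antiderivative cpsi psic.
(* Averaging over [[x, x + h]] enlarges the support to the left by [h <= r / 2], which leaves half
   of the margin [r]. *)
pose h_ n : R := (r / 2) * n.+1%:R^-1.
have h0 n : 0 < h_ n by rewrite mulr_gt0// ?invr_gt0// divr_gt0.
have hr n : h_ n <= r / 2.
  rewrite /h_ ler_piMr ?divr_ge0// ?(ltW r0)//.
  by rewrite invf_le1// ler1n.
have hcvg : h_ @ \oo --> 0.
  rewrite -[X in _ --> X](mulr0 (r / 2)).
  by apply: cvgM; [exact: cvg_cst|exact: cvg_harmonic].
pose S n x := (h_ n)^-1 * (P (x + h_ n) - P x).
pose D n x := (h_ n)^-1 * (psi (x + h_ n) - psi x).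
(* An average of [psi] is one of its values, by the mean value theorem. Sign, bound and support of
   [S n] all follow from this. *)
have SE n x : exists2 z, x <= z <= x + h_ n & S n x = psi z.
  have dP' v : derivable P v 1 by have [] := dP v.
  have [|z zx E] := @derivable_mean_value _ P x (x + h_ n) dP'.
    by rewrite lerDl ltW.
  exists z => //; rewrite /S E.
  have [_] := dP z; rewrite -derive1E => ->.
  by rewrite addrAC subrr add0r mulrC mulfK// gt_eqF.
have L0 : 0 <= L by have := psiL 0 1; rewrite sub0r normrN normr1 mulr1; apply: le_trans.
have psiC x : `|psi x| <= L * `|d - c|.
  have [xin|/psis[-> _]] := boolP (c + r <= x <= d - r); last first.
    by rewrite normr0 mulr_ge0.
  have -> : psi x = psi x - psi c by rewrite (psic c)// subr0.
  rewrite (le_trans (psiL _ _))// ler_wpM2l//.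
  by case/andP: xin => ? ?; rewrite !ger0_norm; lra.
exists S, D, (L * `|d - c| + L); split.
- move=> n; split.
  + by move=> x; have [z _ ->] := SE n x.
  + move=> x.
    have d1 := dP x; have d2 := dP (x + h_ n).
    have d3 : is_derive x (1 : R) (P \o (fun z => z + h_ n)) (psi (x + h_ n) * 1).
      apply: is_derive1_comp.
      by have := @is_derive_shift R x (1 : R) (h_ n).
    rewrite mulr1 in d3.
    exact: (is_deriveZ (h_ n)^-1 (is_deriveB d3 d1)).
  + move=> x; apply: cvgM; first exact: cvg_cst.
    apply: cvgB; last exact: cpsi.
    apply: (@cvg_comp _ _ _ (fun x => x + h_ n) psi _ (nbhs (x + h_ n))).
      by apply: cvgD; [exact: cvg_id|exact: cvg_cst].
    exact: cpsi.
  + exists (r / 2); first by rewrite divr_gt0.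
    move=> x xout.
    have psi_0 z : x <= z <= x + h_ n -> psi z = 0.
      move=> /andP[xz zx]; have [] := psis z; last by [].
      move: xout; rewrite !negb_and -!ltNge => /orP[] ?; apply/orP.
        by left; have := hr n; lra.
      by right; lra.
    have [z zx ->] := SE n x; rewrite psi_0//; split => //.
    by rewrite /D !psi_0 ?subrr ?mulr0// lexx lerDl ltW.
- move=> n x; split.
    by have [z _ ->] := SE n x; rewrite (le_trans (psiC z))// lerDl.
  rewrite /D normrM gtr0_norm ?invr_gt0// ler_pdivrMl//.
  rewrite (le_trans (psiL _ _))// addrAC subrr add0r gtr0_norm// mulrC.
  by rewrite ler_wpM2l ?(ltW (h0 n))// lerDr mulr_ge0.
- move=> x; have [_ <-] := dP x; rewrite -/(S _ _).
  by apply: is_derive_quotient_seq => //; have [] := dP x => ? ?; apply: derivableP.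
- apply: ae_imp dpsi => x dx.
  have [cxd|cxd] := boolP (c < x < d).
    by apply: is_derive_quotient_seq => //; exact: dx.
  have -> : g x = 0.
    have [] := psis x; last by [].
    by move: cxd; rewrite !negb_and -!leNgt -!ltNge => /orP[] ?; apply/orP;
      [left|right]; lra.
  rewrite (_ : (fun n => _) = cst 0); first exact: cvg_cst.
  apply/funext => n /=; rewrite /D.
  have -> : psi x = 0.
    have [] := psis x; last by [].
    by move: cxd; rewrite !negb_and -!leNgt -!ltNge => /orP[] ?; apply/orP;
      [left|right]; lra.
  have [|-> _] := psis (x + h_ n); last by rewrite subrr mulr0.
  have := hr n; have := h0 n.
  by move: cxd; rewrite !negb_and -!leNgt -!ltNge => /orP[] ? ? ?; apply/orP;
      [left|right]; lra.
Qed.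

Definition ramp s r x := clamp 0 1 ((x - s) / r).
(** Besides being the derivative of [ramp] away from the two corners, this is the uniform
    probability density on []s, s + r[]: integrating against it takes a mean just to the right of
    [s]. *)
Definition dramp s r x := r^-1 * \1_(`]s, s + r[ : set R) x.

Section ramp.
Variables (s r : R).
Hypothesis r0 : 0 < r.

Lemma ramp_itv x : 0 <= ramp s r x <= 1.
Proof. exact: clamp_itv. Qed.

Lemma ramp_le x : x <= s -> ramp s r x = 0.
Proof.
move=> xs; rewrite /ramp clamp_left// pmulr_lle0 ?invr_gt0//.
by rewrite subr_le0.
Qed.

Lemma ramp_ge x : s + r <= x -> ramp s r x = 1.
Proof.
move=> sx; rewrite /ramp /clamp min_l ?max_r//.
by rewrite ler_pdivlMr// mul1r; lra.
Qed.

Lemma ramp_mid x : s <= x <= s + r -> ramp s r x = (x - s) / r.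
Proof.
move=> /andP[sx xs]; rewrite /ramp clamp_id//.
apply/andP; split; first by rewrite divr_ge0 ?subr_ge0// ltW.
by rewrite ler_pdivrMr// mul1r; lra.
Qed.

Lemma ramp_lip x y : `|ramp s r x - ramp s r y| <= r^-1 * `|x - y|.
Proof.
rewrite (le_trans (clamp_lip _ _ _ _))// -mulrBl normrM mulrC.
rewrite gtr0_norm ?invr_gt0// ler_wpM2l ?invr_ge0 ?(ltW r0)//.
by rewrite (_ : x - s - (y - s) = x - y)//; ring.
Qed.

Lemma measurable_dramp : measurable_fun setT (dramp s r).
Proof.
by apply: measurable_funM; [exact: measurable_cst|exact: measurable_indic].
Qed.

Lemma dramp_out x : ~~ (s < x < s + r) -> dramp s r x = 0.
Proof.
move=> xs; rewrite /dramp indicE (_ : (_ \in _) = false) ?mulr0//.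
by apply/negP => /set_mem/=; rewrite in_itv/= (negbTE xs).
Qed.

Lemma dramp_in x : s < x < s + r -> dramp s r x = r^-1.
Proof.
by move=> xs; rewrite /dramp indicE mem_set ?mulr1//= in_itv.
Qed.

Lemma dramp_ge0 x : 0 <= dramp s r x.
Proof. by rewrite mulr_ge0// invr_ge0 ltW. Qed.

Lemma dramp_bound x : `|dramp s r x| <= r^-1.
Proof.
have [xs|xs] := boolP (s < x < s + r).
  by rewrite dramp_in// ger0_norm// invr_ge0 ltW.
by rewrite dramp_out// normr0 invr_ge0 ltW.
Qed.

Lemma ramp_is_derive x : x != s -> x != s + r ->
  is_derive x (1 : R) (ramp s r) (dramp s r x).
Proof.
move=> xs xsr; have [xs1|xs1|/eqP] := ltgtP x s; last by rewrite (negbTE xs).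
- rewrite dramp_out; last by rewrite negb_and -leNgt ltW.
  apply: (@near_eq_is_derive _ _ _ (cst 0)).
  by near=> z; rewrite ramp_le//; near: z; exact: lt_le_nbhsl.
- have [xr1|xr1|/eqP] := ltgtP x (s + r); last by rewrite (negbTE xsr).
  + rewrite dramp_in ?xs1//.
    apply: (@near_eq_is_derive _ _ _ (fun z => r^-1 * (z - s))); last first.
      have h := is_deriveZ r^-1 (is_deriveB (is_derive_id x (1 : R))
        (is_derive_cst s x (1 : R))).
      by apply: is_derive_eq h _; rewrite subr0 /GRing.scale/= mulr1.
    near=> z; have sz : s <= z.
      by near: z; exact: lt_le_nbhsr.
    have zs : z <= s + r by near: z; exact: lt_le_nbhsl.
    by rewrite ramp_mid ?sz// mulrC.
  + rewrite dramp_out; last by rewrite negb_and -!leNgt (ltW xr1) orbT.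
    apply: (@near_eq_is_derive _ _ _ (cst (1 : R))).
    by near=> z; rewrite ramp_ge//; near: z; exact: lt_le_nbhsr.
Unshelve. all: by end_near. Qed.

End ramp.

Lemma ae_neq (s : R) : {ae mu, forall x, x != s}.
Proof.
exists [set s]; split => //; first exact: lebesgue_measure_set1.
by move=> x /= /negP; rewrite negbK => /eqP.
Qed.

Lemma ramp_ae_derive s r : 0 < r ->
  {ae mu, forall x, is_derive x (1 : R) (ramp s r) (dramp s r x)}.
Proof.
move=> r0; apply: ae_imp2 (ae_neq s) (ae_neq (s + r)) => x.
exact: ramp_is_derive.
Qed.

(** A trapezoid, when [s + r <= t]: it rises on [[s, s + r]] and falls on [[t, t + r]]. *)
Definition bump s t r x := ramp s r x - ramp t r x.
Definition dbump s t r x := dramp s r x - dramp t r x.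

Section bump.
Variables (s t r : R).
Hypotheses (r0 : 0 < r) (st : s + r <= t).

Lemma bump_itv x : 0 <= bump s t r x <= 1.
Proof.
rewrite /bump; have /andP[a1 a2] := ramp_itv s r x.
have /andP[b1 b2] := ramp_itv t r x.
have [xt|/ltW xt] := leP x t; first by rewrite (ramp_le r0 xt); lra.
by rewrite (@ramp_ge s)//; have := st; have := r0; move=> *; lra.
Qed.

Lemma bump_out x : ~~ (s < x < t + r) -> bump s t r x = 0 /\ dbump s t r x = 0.
Proof.
have rpos := r0; have sle := st.
rewrite negb_and -!leNgt /bump /dbump => /orP[] xs.
  have xt : x <= t by lra.
  by rewrite !ramp_le// !dramp_out ?subrr// negb_and -!leNgt ?xs ?xt.
rewrite !ramp_ge//; last by lra.
by rewrite !dramp_out ?subrr// negb_and -!leNgt; apply/orP; right; lra.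
Qed.

Lemma bump_in x : s + r <= x <= t -> bump s t r x = 1.
Proof. by move=> /andP[sx xt]; rewrite /bump ramp_ge// ramp_le// subr0. Qed.

Lemma bump_lip x y : `|bump s t r x - bump s t r y| <= 2 * r^-1 * `|x - y|.
Proof.
have := ramp_lip s r0 x y; have := ramp_lip t r0 x y.
rewrite /bump !ler_norml => /andP[? ?] /andP[? ?]; apply/andP; split; lra.
Qed.

Lemma measurable_dbump : measurable_fun setT (dbump s t r).
Proof. by apply: measurable_funB; exact: measurable_dramp. Qed.

Lemma dbump_bound x : `|dbump s t r x| <= 2 * r^-1.
Proof.
have := dramp_bound s r0 x; have := dramp_bound t r0 x.
rewrite /dbump !ler_norml => /andP[? ?] /andP[? ?]; apply/andP; split; lra.
Qed.

Lemma bump_ae_derive :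
  {ae mu, forall x, is_derive x (1 : R) (bump s t r) (dbump s t r x)}.
Proof.
apply: ae_imp2 (ramp_ae_derive s r0) (ramp_ae_derive t r0) => x ? ?.
exact: is_deriveB.
Qed.

Lemma bump_profile c d : c < s -> t + r < d ->
  lip_profile c d (bump s t r) (dbump s t r).
Proof.
move=> cs td; split.
- by move=> x; have /andP[] := bump_itv x.
- by exists (2 * r^-1) => x y; exact: bump_lip.
- exact: measurable_dbump.
- by exists (2 * r^-1) => x; exact: dbump_bound.
- exists (Num.min (s - c) (d - (t + r))).
    by rewrite lt_min !subr_gt0 cs.
  move=> x; set e := Num.min _ _; have e1 : e <= s - c by rewrite ge_min lexx.
  have e2 : e <= d - (t + r) by rewrite ge_min lexx orbT.
  rewrite negb_and -!ltNge => xout; apply: bump_out; rewrite negb_and -!leNgt.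
  by case/orP : xout => ?; apply/orP; [left|right]; lra.
- by apply: ae_imp bump_ae_derive.
Qed.

End bump.

End Profiles.

(** * From space-time test functions to inequalities between two single times *)

Section ExactTime.
Context {R : realType}.
Local Notation mu := (@lebesgue_measure R).
Local Notation mu2 := ((@lebesgue_measure R \x @lebesgue_measure R)%E).
Implicit Types (psi g S D : R -> R) (E Q F : R * R -> R) (s t r x : R).

Lemma bmT_pair1 (A : set R) F t : bm setT F -> bm A (fun x => F (x, t)).
Proof.
move=> [mF [K FK]]; split; first exact: measurable_fun_pair1.
by exists K => x _; exact: FK.
Qed.

Lemma bmT_pair2 (A : set R) F x : bm setT F -> bm A (fun t => F (x, t)).
Proof.
move=> [mF [K FK]]; split; first exact: measurable_fun_pair2.
by exists K => t _; exact: FK.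
Qed.

Lemma bmT_fst (A B : set R) g : bm A g -> bm (A `*` B) (fun p : R * R => g p.1).
Proof.
move=> [mg [K gK]]; split; first exact: measurableT_comp.
by exists K => -[x t] [/= Ax _]; exact: gK.
Qed.

Lemma bmT_snd (A B : set R) g : bm B g -> bm (A `*` B) (fun p : R * R => g p.2).
Proof.
move=> [mg [K gK]]; split; first exact: measurableT_comp.
by exists K => -[x t] [/= _ Bt]; exact: gK.
Qed.

Lemma bm_Rint_fst (A B : set R) F : measurable A -> (mu A < +oo)%E ->
  bm (A `*` B) F -> bm B (fun t => \int[mu]_(x in A) F (x, t)).
Proof.
move=> mA fA [mF [K FK]]; split; first exact: measurable_Rint_fst.
exists (K * fine (mu A)) => t Bt; apply: norm_Rint_le_cst => //.
  by split; [exact: measurable_fun_pair1|exists K => x Ax; exact: FK].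
by move=> x Ax; exact: FK.
Qed.

Lemma bm_itv (a b : R) (f : R -> R) : continuous f -> bm `]a, b[ f.
Proof.
move=> cf; split; first exact: continuous_measurable_fun.
have /compact_bounded : compact (f @` `[a, b]).
  apply: continuous_compact; last exact: segment_compact.
  by apply: continuous_subspaceT => x; exact: cf.
move=> [M [_ MP]]; exists (M + 1) => x xab.
apply: (MP (M + 1)); first by rewrite ltrDl.
by exists x => //; apply: subset_itv_oo_cc.
Qed.

Lemma Rint_indic_mul (D A : set R) g : A `<=` D ->
  \int[mu]_(x in D) (\1_A x * g x) = \int[mu]_(x in A) g x.
Proof.
move=> AD; rewrite -[in RHS](setIidr AD) Rintegral_mkcondr.
apply: eq_Rint => x _; rewrite patchE indicE.
by case: (x \in A); rewrite ?mul1r ?mul0r.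
Qed.

Lemma fine_lebesgue_itv (a b : R) (b0 b1 : bool) : a <= b ->
  fine (mu [set` Interval (BSide b0 a) (BSide b1 b)]) = b - a.
Proof.
move=> ab; rewrite lebesgue_measure_itv/= lte_fin; case: ltP => //= ba.
by have -> : a = b by [lra|]; rewrite subrr.
Qed.

Variables (a b Tm : R).
Local Notation I := (`]a, b[%classic : set R).
Local Notation J := (`]0, Tm[%classic : set R).

(** Products of a space factor and a time factor are enough: the space factor becomes the weight,
    and the time factor is specialised to a trapezoid. *)
Definition smooth_weak E Q : Prop := forall S D Th dTh,
  smooth_profile a b S D -> smooth_profile 0 Tm Th dTh ->
  0 <= \int[mu2]_(p in I `*` J)
         (E p * (S p.1 * dTh p.2) + Q p * (D p.1 * Th p.2)).

Definition L1_continuous E : Prop := forall t, 0 < t < Tm ->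
  forall e : R, 0 < e -> exists2 d : R, 0 < d & forall s, 0 < s < Tm ->
    `|s - t| < d -> \int[mu]_(x in I) `|E (x, s) - E (x, t)| < e.

(** Integrated form of [E_t + Q_x <= 0], free of time derivatives. The lower time bound [T0] is 0 at
    first and the trapping time later. *)
Definition entropic (T0 : R) E Q : Prop := forall psi g, lip_profile a b psi g ->
  forall s t, T0 < s -> s < t -> t < Tm ->
  \int[mu]_(x in I) (E (x, t) * psi x) - \int[mu]_(x in I) (E (x, s) * psi x)
  <= \int[mu]_(tau in `]s, t[) \int[mu]_(x in I) (Q (x, tau) * g x).

Let finI : (mu I < +oo)%E. Proof. exact: lebesgue_itv_lty. Qed.
Let finJ : (mu J < +oo)%E. Proof. exact: lebesgue_itv_lty. Qed.
Let finIJ : (mu2 (I `*` J) < +oo)%E.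
Proof. by apply: measure_box_lty. Qed.

Lemma smooth_profile_cont c d S D : smooth_profile c d S D -> continuous S.
Proof.
move=> [_ dS _ _] x; apply: differentiable_continuous.
by apply/derivable1_diffP; have [] := dS x.
Qed.

Lemma lip_profile_bm c d psi g : lip_profile c d psi g ->
  bm `]c, d[ psi /\ bm `]c, d[ g.
Proof.
move=> [_ [L psiL] mg [K gK] _ _]; split; last by split => //; exists K => x _.
by apply: bm_itv; exact: lipschitz_continuous psiL.
Qed.

(** Steklov averages of both factors are admissible and uniformly bounded, and they converge almost
    everywhere together with their derivatives; bounded convergence does the rest. *)
Lemma smooth_weak_lip E Q : bm setT E -> bm setT Q -> smooth_weak E Q ->
  forall psi g th dth, lip_profile a b psi g -> lip_profile 0 Tm th dth ->
  0 <= \int[mu2]_(p in I `*` J)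
         (E p * (psi p.1 * dth p.2) + Q p * (g p.1 * th p.2)).
Proof.
move=> [mE [K EK]] [mQ [K' QK']] wEQ psi g th dth pp pt.
have [S [D [C [sS SC Sc Dc]]]] := steklov pp.
have [Th [dTh [C' [sT TC Tc dTc]]]] := steklov pt.
have [[mpsi _] [mg _]] := lip_profile_bm pp.
have [[mth _] [mdth _]] := lip_profile_bm pt.
pose F n p := E p * (S n p.1 * dTh n p.2) + Q p * (D n p.1 * Th n p.2).
have m1 (h : R -> R) : measurable_fun setT h -> measurable_fun setT (fun p : R * R => h p.1).
  by move=> mh; apply: measurableT_comp.
have m2 (h : R -> R) : measurable_fun setT h -> measurable_fun setT (fun p : R * R => h p.2).
  by move=> mh; apply: measurableT_comp.
have : \int[mu2]_(p in I `*` J) F n p @[n --> \oo] -->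
    \int[mu2]_(p in I `*` J)
      (E p * (psi p.1 * dth p.2) + Q p * (g p.1 * th p.2)).
  apply: (@bounded_cvg _ _ _ mu2 (I `*` J) _ finIJ _ _ (K * (C * C') + K' * (C * C'))).
  - exact: measurableX.
  - move=> n; apply: measurable_funD; apply: measurable_funM => //;
      apply: measurable_funM.
    + by apply: m1; apply: continuous_measurable_fun; exact: smooth_profile_cont (sS n).
    + by apply: m2; apply: continuous_measurable_fun; have [] := sT n.
    + by apply: m1; apply: continuous_measurable_fun; have [] := sS n.
    + by apply: m2; apply: continuous_measurable_fun; exact: smooth_profile_cont (sT n).
  - by apply: measurable_funD; apply: measurable_funM => //;
      apply: measurable_funM; [exact: m1|exact: m2|exact: m1|exact: m2].
  - move=> n p _; rewrite (le_trans (ler_normD _ _))// !normrM.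
    have [s1 s2] := SC n p.1; have [t1 t2] := TC n p.2.
    by apply: lerD; apply: ler_pM => //; rewrite ?mulr_ge0//;
      [exact: EK|apply: ler_pM|exact: QK'|apply: ler_pM].
  - apply: ae_imp2 (@ae_box_fst _ _ _ _ _ mu mu _ Dc)
      (@ae_box_snd _ _ _ _ _ mu mu _ dTc) => p h1 h2 _.
    apply: cvgD; apply: cvgM; [exact: cvg_cst| |exact: cvg_cst|].
      by apply: cvgM; [exact: Sc|exact: h2].
    by apply: cvgM; [exact: h1|exact: Tc].
move=> h; apply: (ler_cvg_to (cvg_cst 0) h).
by apply: nearW => n; exact: wEQ.
Qed.

Lemma Rint_weight_cvg E psi t : bm setT E -> L1_continuous E -> bm I psi ->
  0 < t < Tm -> forall e : R, 0 < e -> exists2 d : R, 0 < d & forall s, 0 < s < Tm ->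
    `|s - t| < d ->
    `|\int[mu]_(x in I) (E (x, s) * psi x) -
      \int[mu]_(x in I) (E (x, t) * psi x)| < e.
Proof.
move=> bE cE bpsi tT e e0.
have [_ [C psiC]] := bpsi.
have C0 : 0 < `|C| + 1 by rewrite ltr_wpDl.
have [|d d0 dE] := cE t tT (e / (`|C| + 1)); first by rewrite divr_gt0.
exists d => // s sT /(dE s sT) h.
have bE1 s' : bm I (fun x => E (x, s')) by exact: bmT_pair1.
have bEp s' : bm I (fun x => E (x, s') * psi x) by exact: bmM.
have bEE : bm I (fun x => `|E (x, s) - E (x, t)|) by exact: (bm_norm (bmB (bE1 s) (bE1 t))).
rewrite -(RintB _ finI (bEp s) (bEp t))//.
apply: (le_lt_trans (norm_Rint_le _ finI _)) => //; first exact: (bmB (bEp s) (bEp t)).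
apply: (@le_lt_trans _ _ (\int[mu]_(x in I) ((`|C| + 1) * `|E (x, s) - E (x, t)|))).
  apply: le_Rint => //; [exact: (bm_norm (bmB (bEp s) (bEp t)))|exact: bmZ|].
  move=> x Ix; rewrite -mulrBl normrM mulrC ler_wpM2r//.
  rewrite (le_trans (psiC x Ix))// (le_trans (ler_norm C))//.
  by rewrite lerDl.
by rewrite RintZ// -ltr_pdivlMl// mulrC.
Qed.

(** With a trapezoid in time, the time derivative produces the mean of the weighted mass [H] over
    [[s, s + r]] minus its mean over [[t, t + r]]. By continuity in L^1 these tend to [H s] and
    [H t] as the ramps become steep. *)
Lemma exact_time E Q : bm setT E -> bm setT Q -> L1_continuous E ->
  smooth_weak E Q -> entropic 0 E Q.
Proof.
move=> bE bQ cE wEQ psi g pp s t s0 st tT.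
have [bpsi bg] := lip_profile_bm pp.
pose H tau := \int[mu]_(x in I) (E (x, tau) * psi x).
pose G tau := \int[mu]_(x in I) (Q (x, tau) * g x).
rewrite -/(H t) -/(H s).
have bH : bm J H.
  apply: (@bm_Rint_fst I J (fun p => E p * psi p.1)) => //.
  by apply: bmM; [exact: bmS bE|exact: bmT_fst].
have bG : bm J G.
  apply: (@bm_Rint_fst I J (fun p => Q p * g p.1)) => //.
  by apply: bmM; [exact: bmS bQ|exact: bmT_fst].
(* Half of the minimum keeps the two ramps disjoint and the second one strictly before [Tm]. *)
pose r n : R := Num.min (t - s) (Tm - t) / 2 * n.+1%:R^-1.
have m0 : 0 < Num.min (t - s) (Tm - t) by rewrite lt_min !subr_gt0 st.
have r0 n : 0 < r n by rewrite mulr_gt0 ?invr_gt0// divr_gt0.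
have rm n : r n <= Num.min (t - s) (Tm - t) / 2.
  by rewrite ler_piMr ?divr_ge0 ?(ltW m0)// invf_le1// ler1n.
have rs n : s + r n <= t.
  have h : Num.min (t - s) (Tm - t) <= t - s by rewrite ge_min lexx.
  by have := rm n; lra.
have rT n : t + r n < Tm.
  have h : Num.min (t - s) (Tm - t) <= Tm - t by rewrite ge_min lexx orbT.
  by have := rm n; lra.
have rc : r @ \oo --> 0.
  rewrite -[X in _ --> X](mulr0 (Num.min (t - s) (Tm - t) / 2)).
  by apply: cvgM; [exact: cvg_cst|exact: cvg_harmonic].
have rlt y : 0 < y -> \forall n \near \oo, r n < y.
  by move=> y0; exact: (cvgr_lt _ rc).
pose th n := bump s t (r n); pose dth n := dbump s t (r n).
have pt n : lip_profile 0 Tm (th n) (dth n) by exact: bump_profile.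
have bth n : bm J (th n) by have [] := lip_profile_bm (pt n).
have bdth n : bm J (dth n) by have [] := lip_profile_bm (pt n).
have w n : 0 <= \int[mu]_(tau in J) (dth n tau * H tau) +
                \int[mu]_(tau in J) (th n tau * G tau).
  have := smooth_weak_lip bE bQ wEQ pp (pt n).
  rewrite Rint_box_snd_fst//; last first.
    apply: bmD; apply: bmM; [exact: bmS bE| |exact: bmS bQ|];
      by apply: bmM; [exact: bmT_fst|exact: bmT_snd].
  rewrite -RintD//; [|exact: (bmM (bdth n) bH)|exact: (bmM (bth n) bG)].
  congr (_ <= _); apply: eq_Rint => tau Jt /=.
  have bEt : bm I (fun x => E (x, tau)) by exact: bmT_pair1.
  have bQt : bm I (fun x => Q (x, tau)) by exact: bmT_pair1.
  rewrite -!RintZ//; [|exact: bmM|exact: bmM].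
  rewrite -RintD//; [|by apply/bmZ/bmM|by apply/bmZ/bmM].
  by apply: eq_Rint => x Ix; ring.
have c1 : \int[mu]_(tau in J) (th n tau * G tau) @[n --> \oo] -->
    \int[mu]_(tau in `]s, t[) G tau.
  have sub : `]s, t[ `<=` J.
    by apply: subset_itv; rewrite bnd_simp ltW// (lt_trans _ tT).
  rewrite -(Rint_indic_mul _ sub).
  have [mG [KG GK]] := bG.
  apply: (@bounded_cvg _ _ _ mu J _ _ _ _ KG) => //.
  - by move=> n; apply: measurable_funM => //; have [] := bth n.
  - by apply: measurable_funM => //; exact: measurable_indic.
  - move=> n x Jx; rewrite normrM -[leRHS]mul1r ler_pM ?GK//.
    by have /andP[? ?] := bump_itv (r0 n) (rs n) x; rewrite ger0_norm.
  apply: ae_imp (ae_neq t) => tau tneq _; apply: cvgM; last exact: cvg_cst.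
  rewrite indicE; have [/set_mem|/negP stn] := boolP (tau \in `]s, t[%classic).
    rewrite /= in_itv/= => /andP[sta tat].
    apply: cvg_near_cst; have := rlt (tau - s).
    rewrite subr_gt0 => /(_ sta); apply: filterS => n rn.
    by rewrite /th bump_in//; apply/andP; split; lra.
  have [ts|tt] : tau <= s \/ t < tau.
  - have [h|h] := leP tau s; first by left.
    right; rewrite lt_neqAle eq_sym tneq/= leNgt; apply/negP => h2; apply: stn.
    by rewrite inE/= in_itv/= h h2.
  - apply: cvg_near_cst; apply: nearW => n; rewrite /th.
    by have [|->] := @bump_out _ s t (r n) (r0 n) (rs n) tau; rewrite ?negb_and -?leNgt ?ts.
  - apply: cvg_near_cst; have := rlt (tau - t).
    rewrite subr_gt0 => /(_ tt); apply: filterS => n rn; rewrite /th.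
    have [|->//] := @bump_out _ s t (r n) (r0 n) (rs n) tau.
    by rewrite negb_and -!leNgt; apply/orP; right; lra.
apply/ler_addgt0Pr => e e0.
have [||d1 d10 d1H] := @Rint_weight_cvg E psi s bE cE bpsi _ (e / 2).
- by rewrite s0 (lt_trans st).
- by rewrite divr_gt0.
have [||d2 d20 d2H] := @Rint_weight_cvg E psi t bE cE bpsi _ (e / 2).
- by rewrite tT (lt_trans s0).
- by rewrite divr_gt0.
rewrite -/(H _) in d1H d2H.
suff : 0 <= (H s - H t + e) + \int[mu]_(tau in `]s, t[) G tau by rewrite /G; lra.
apply: (ler_cvg_to (cvg_cst 0) (cvgD (cvg_cst (H s - H t + e)) c1)).
have n1 := rlt _ d10; have n2 := rlt _ d20.
apply: filterS2 n1 n2 => n rn1 rn2 /=; apply: (le_trans (w n)); rewrite lerD2r.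
pose B1 := `]s, (s + r n)[%classic : set R; pose B2 := `]t, (t + r n)[%classic : set R.
have sB1 : B1 `<=` J.
  apply: subset_itv; rewrite bnd_simp ?(ltW s0)//.
  by have := rs n; move=> ?; lra.
have sB2 : B2 `<=` J.
  by apply: subset_itv; rewrite bnd_simp; have := rT n; move=> ?; lra.
have bI1 (B : set R) : measurable B -> bm J (\1_B : R -> R).
  move=> mB; split; first exact: measurable_indic.
  by exists 1 => x _; rewrite indicE; case: (_ \in _); rewrite ?normr0 ?normr1.
have mB1 : measurable B1 by exact: measurable_itv.
have mB2 : measurable B2 by exact: measurable_itv.
(* A step function above [dth n * H]: on each ramp [H] is within [e / 2] of its value at the nominal
   time. Its integral is exactly [H s - H t + e]. *)
pose U tau := (r n)^-1 * (\1_B1 tau * (H s + e / 2) - \1_B2 tau * (H t - e / 2)).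
have bU : bm J U.
  by apply: bmZ; apply: bmB; apply: bmM; [exact: (bI1 _ mB1)|exact: bm_cst|exact: (bI1 _ mB2)|exact: bm_cst].
apply: (@le_trans _ _ (\int[mu]_(tau in J) U tau)).
  apply: le_Rint => // [|tau Jt]; first exact: (bmM (bdth n) bH).
  rewrite /U /dth /dbump /dramp -/B1 -/B2 -mulrBr -mulrA.
  rewrite ler_wpM2l ?invr_ge0 ?(ltW (r0 n))// mulrBl lerB//.
    rewrite indicE; have [/set_mem|] := boolP (tau \in B1); last by rewrite !mul0r.
    rewrite !mul1r /B1/= in_itv/= => /andP[ts tr].
    have hd : `|tau - s| < d1.
      by rewrite gtr0_norm ?subr_gt0// ltrBlDl (lt_trans tr)// ltrD2l.
    move: Jt; rewrite /= in_itv/= => Jt; have := d1H tau Jt hd.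
    by rewrite ltr_norml -/(H tau) => /andP[_ h]; lra.
  rewrite indicE; have [/set_mem|] := boolP (tau \in B2); last by rewrite !mul0r.
  rewrite !mul1r /B2/= in_itv/= => /andP[ts tr].
  have hd : `|tau - t| < d2.
    by rewrite gtr0_norm ?subr_gt0// ltrBlDl (lt_trans tr)// ltrD2l.
  move: Jt; rewrite /= in_itv/= => Jt; have := d2H tau Jt hd.
  by rewrite ltr_norml -/(H tau) -/(H t) => /andP[h _]; lra.
rewrite /U RintZ//; last first.
  by apply: bmB; apply: bmM; [exact: (bI1 _ mB1)|exact: bm_cst|exact: (bI1 _ mB2)|exact: bm_cst].
rewrite RintB//; [|by apply: bmM; [exact: (bI1 _ mB1)|exact: bm_cst]|by apply: bmM; [exact: (bI1 _ mB2)|exact: bm_cst]].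
rewrite (Rint_indic_mul _ sB1) (Rint_indic_mul _ sB2) !Rint_cst//.
rewrite /B1 /B2 !fine_lebesgue_itv ?lerDl ?(ltW (r0 n))//.
rewrite (_ : s + r n - s = r n); last by ring.
rewrite (_ : t + r n - t = r n); last by ring.
rewrite -mulrBl mulrCA mulVf ?gt_eqF// mulr1.
by rewrite (_ : _ - _ = H s - H t + e)//; field.
Qed.

Hypothesis ab : a < b.

Lemma lip_profile_Rint0 psi g : lip_profile a b psi g ->
  \int[mu]_(x in I) g x = 0.
Proof.
move=> [_ [L psiL] mg [K gK] [r r0 psis] dpsi].
rewrite (@lipschitz_FTC _ a b psi g L K) //.
have ab' := ab.
have [|-> _] := psis a; first by rewrite negb_and -!ltNge; apply/orP; left; lra.
have [|-> _] := psis b; first by rewrite negb_and -!ltNge; apply/orP; right; lra.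
by rewrite subrr.
Qed.

(** A constant flux contributes nothing because [g] is the derivative of a weight vanishing near
    both ends. Adding constants turns absolute values into affine functions or positive parts. *)
Lemma entropic_cst (T0 c1 c2 : R) : entropic T0 (fun=> c1) (fun=> c2).
Proof.
move=> psi g pp s t s0 st tT; rewrite subrr.
have [bpsi bg] := lip_profile_bm pp.
rewrite (@eq_Rint _ _ _ _ _ _ (fun=> 0)).
  by rewrite Rint_cst// mul0r.
by move=> tau _; rewrite RintZ// (lip_profile_Rint0 pp) mulr0.
Qed.

Lemma entropicD (T0 : R) E1 Q1 E2 Q2 : bm setT E1 -> bm setT Q1 -> bm setT E2 ->
  bm setT Q2 -> entropic T0 E1 Q1 -> entropic T0 E2 Q2 ->
  entropic T0 (fun p => E1 p + E2 p) (fun p => Q1 p + Q2 p).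
Proof.
move=> bE1 bQ1 bE2 bQ2 h1 h2 psi g pp s t s0 st tT.
have [bpsi bg] := lip_profile_bm pp.
have bI F (h : R -> R) t' : bm setT F -> bm I h -> bm I (fun x => F (x, t') * h x).
  by move=> bF bh; apply: bmM => //; exact: bmT_pair1.
have split F1 F2 (h : R -> R) t' : bm setT F1 -> bm setT F2 -> bm I h ->
    \int[mu]_(x in I) ((F1 (x, t') + F2 (x, t')) * h x) =
    \int[mu]_(x in I) (F1 (x, t') * h x) + \int[mu]_(x in I) (F2 (x, t') * h x).
  move=> b1 b2 bh; rewrite -RintD//; [|exact: bI|exact: bI].
  by apply: eq_Rint => x _; rewrite mulrDl.
rewrite !split// [leRHS](_ : _ =
    \int[mu]_(tau in `]s, t[) \int[mu]_(x in I) (Q1 (x, tau) * g x) +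
    \int[mu]_(tau in `]s, t[) \int[mu]_(x in I) (Q2 (x, tau) * g x)); last first.
  rewrite -RintD//.
  - by apply: eq_Rint => tau _; rewrite split.
  - exact: lebesgue_itv_lty.
  - apply: (@bm_Rint_fst I `]s, t[ (fun p => Q1 p * g p.1)) => //.
    by apply: bmM; [exact: bmS bQ1|exact: bmT_fst].
  - apply: (@bm_Rint_fst I `]s, t[ (fun p => Q2 p * g p.1)) => //.
    by apply: bmM; [exact: bmS bQ2|exact: bmT_fst].
rewrite opprD addrACA; apply: lerD; [exact: h1|exact: h2].
Qed.

End ExactTime.

(** * Weights reaching the boundary *)

Section Boundary.
Context {R : realType}.
Local Notation mu := (@lebesgue_measure R).
Implicit Types (psi g : R -> R) (E Q F : R * R -> R) (s t r x : R).
Variables (a b : R).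
Hypothesis ab : a < b.
Local Notation I := (`]a, b[%classic : set R).

(** In contrast to [lip_profile], nothing is required to vanish near the end points, and regularity
    is asked on [[a, b]] only. *)
Record profile psi g : Prop := {
  pr_ge0 : forall x, a <= x <= b -> 0 <= psi x ;
  pr_lip : exists L : R, forall x y, a <= x <= b -> a <= y <= b ->
    `|psi x - psi y| <= L * `|x - y| ;
  pr_bm : bm I psi ;
  pr_bmD : bm I g ;
  pr_der : {ae mu, forall x, a < x < b -> is_derive x (1 : R) psi (g x)} }.

(** The cutoff rises on [[a + r, a + 2 r]] and falls on [[b - 2 r, b - r]], leaving a margin [r] at
    both ends; the factor 1/8 keeps the two ramps apart. *)
Definition cutoff_width (n : nat) : R := (b - a) / 8 * n.+1%:R^-1.
Local Notation r := cutoff_width.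
Definition cutoff n x := bump (a + r n) (b - 2 * r n) (r n) x.
Definition dcutoff n x := dbump (a + r n) (b - 2 * r n) (r n) x.

Lemma cutoff_width_gt0 n : 0 < r n.
Proof. by rewrite mulr_gt0 ?invr_gt0// divr_gt0// subr_gt0. Qed.

Lemma cutoff_width_le n : r n <= (b - a) / 8.
Proof.
have ab' := ab.
by rewrite ler_piMr ?divr_ge0 ?subr_ge0 ?(ltW ab')// invf_le1// ler1n.
Qed.

Lemma cutoff_width_order n : a + r n + r n <= b - 2 * r n.
Proof. by have ab' := ab; have := cutoff_width_le n; move=> ?; lra. Qed.

Lemma cutoff_width_lt (y : R) : 0 < y -> \forall n \near \oo, r n < y.
Proof.
move=> y0; have rc : r @ \oo --> 0.
  rewrite -[X in _ --> X](mulr0 ((b - a) / 8)).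
  by apply: cvgM; [exact: cvg_cst|exact: cvg_harmonic].
exact: (cvgr_lt _ rc).
Qed.

Lemma cutoff_itv n x : 0 <= cutoff n x <= 1.
Proof. exact: (bump_itv (cutoff_width_gt0 n) (cutoff_width_order n)). Qed.

Lemma measurable_cutoff n : measurable_fun setT (cutoff n).
Proof. exact: lipschitz_measurable (bump_lip _ _ (cutoff_width_gt0 n)). Qed.

Lemma bm_cutoff (A : set R) n : bm A (cutoff n).
Proof.
split; first exact: measurable_cutoff.
by exists 1 => x _; have /andP[? ?] := cutoff_itv n x; rewrite ger0_norm.
Qed.

Lemma bm_dcutoff (A : set R) n : bm A (dcutoff n).
Proof.
split; first exact: measurable_dbump.
by exists (2 * (r n)^-1) => x _; exact: (dbump_bound _ _ (cutoff_width_gt0 n)).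
Qed.

Lemma cutoff_cvg x : a < x < b -> cutoff n x @[n --> \oo] --> (1 : R).
Proof.
move=> /andP[ax xb]; apply: cvg_near_cst.
have xa2 : 0 < (x - a) / 2 by rewrite divr_gt0// subr_gt0.
have xb2 : 0 < (b - x) / 2 by rewrite divr_gt0// subr_gt0.
apply: filterS2 (cutoff_width_lt xa2) (cutoff_width_lt xb2) => n h1 h2.
rewrite /cutoff bump_in//; first exact: cutoff_width_gt0.
by apply/andP; split; lra.
Qed.

(** Nothing is known of [psi] outside [[a, b]], hence the composition with [clamp]; the cutoff
    vanishes there, so the product is not affected. *)
Lemma profile_cutoff psi g n : profile psi g ->
  lip_profile a b (fun x => psi (clamp a b x) * cutoff n x)
    (fun x => g x * cutoff n x + psi x * dcutoff n x).
Proof.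
move=> [psi0 [L0 psiL0] [mpsi [C psiC]] [mg [K gK]] dpsi].
have ab' := ltW ab; have r0 := cutoff_width_gt0 n.
have ro := cutoff_width_order n.
have cin x := clamp_itv x ab'.
pose L := `|L0|; have L_ge0 : 0 <= L by exact: normr_ge0.
have psiL x y : a <= x <= b -> a <= y <= b -> `|psi x - psi y| <= L * `|x - y|.
  move=> xab yab; rewrite (le_trans (psiL0 x y xab yab))//.
  by rewrite ler_wpM2r// ler_norm.
have out x : ~~ (a + r n <= x <= b - r n) -> cutoff n x = 0 /\ dcutoff n x = 0.
  rewrite negb_and -!ltNge => xout; apply: (bump_out r0 ro).
  by rewrite negb_and -!leNgt; case/orP : xout => ?; apply/orP; [left|right]; lra.
have outI x : ~~ (a < x < b) -> cutoff n x = 0 /\ dcutoff n x = 0.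
  move=> xout; apply: out; move: xout; rewrite !negb_and -!leNgt -!ltNge.
  by case/orP => ?; apply/orP; [left|right]; lra.
pose C' := `|psi a| + L * (b - a).
have C'0 : 0 <= C' by rewrite addr_ge0// mulr_ge0// subr_ge0.
have psiC' x : a <= x <= b -> `|psi x| <= C'.
  move=> xab; rewrite -[psi x](subrK (psi a)) addrC (le_trans (ler_normD _ _))//.
  rewrite lerD2l (le_trans (psiL x a xab _))// ?lexx//.
  rewrite ler_wpM2l//; case/andP : xab => ax xb.
  by rewrite ger0_norm ?subr_ge0// lerD2r.
split.
- move=> x; rewrite mulr_ge0//; first by apply: psi0; exact: cin.
  by have /andP[] := cutoff_itv n x.
- exists (C' * (2 * (r n)^-1) + L) => x y.
  have -> : psi (clamp a b x) * cutoff n x - psi (clamp a b y) * cutoff n y =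
    psi (clamp a b x) * (cutoff n x - cutoff n y) +
    (psi (clamp a b x) - psi (clamp a b y)) * cutoff n y by ring.
  rewrite (le_trans (ler_normD _ _))// [leRHS]mulrDl; apply: lerD.
    rewrite normrM -mulrA; apply: ler_pM => //; first exact: psiC'.
    exact: bump_lip.
  rewrite normrM -[leRHS]mulr1; apply: ler_pM => //.
    by rewrite (le_trans (psiL _ _ (cin _) (cin _)))// ler_wpM2l// clamp_lip.
  by have /andP[? ?] := cutoff_itv n y; rewrite ger0_norm.
- by apply: measurable_funD; apply: measurable_funM => //;
    [exact: measurable_cutoff|exact: measurable_dbump].
- exists (`|K| + `|C| * (2 * (r n)^-1)) => x.
  have [xab|/outI[-> ->]] := boolP (a < x < b); last first.
    rewrite !mulr0 addr0 normr0 addr_ge0// mulr_ge0// mulr_ge0// invr_ge0.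
    exact: ltW.
  have Ix : I x by rewrite /= in_itv.
  rewrite (le_trans (ler_normD _ _))//; apply: lerD; rewrite normrM.
    rewrite -[leRHS]mulr1; apply: ler_pM => //.
      by rewrite (le_trans (gK x Ix))// ler_norm.
    by have /andP[? ?] := cutoff_itv n x; rewrite ger0_norm.
  apply: ler_pM => //; first by rewrite (le_trans (psiC x Ix))// ler_norm.
  exact: dbump_bound.
- exists (r n) => // x /out[-> ->]; by rewrite !mulr0 addr0.
- apply: ae_imp2 dpsi (bump_ae_derive (a + r n) (b - 2 * r n) r0) => x dx d2 xab.
  have d1 : is_derive x (1 : R) (psi \o clamp a b) (g x).
    move: (dx xab); apply: near_eq_is_derive.
    case/andP : xab => ax xb.
    near=> z; have az : a <= z by near: z; exact: lt_le_nbhsr.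
    have zb : z <= b by near: z; exact: lt_le_nbhsl.
    by rewrite /= clamp_id// az.
  have d3 := is_deriveM d1 d2.
  apply: is_derive_eq d3 _.
  rewrite /= /GRing.scale/= clamp_id; last by case/andP : xab => ? ?; rewrite !ltW.
  by rewrite addrC mulrC.
Unshelve. all: by end_near. Qed.

Lemma Rint_dramp (s t : R) : 0 < t -> a <= s -> s + t <= b ->
  \int[mu]_(x in I) dramp s t x = 1.
Proof.
move=> t0 as_ sb; have sub : `]s, (s + t)[%classic `<=` I.
  by apply: subset_itv; rewrite bnd_simp.
have bi : bm I (\1_(`]s, (s + t)[%classic : set R) : R -> R).
  split; first exact: measurable_indic.
  by exists 1 => x _; rewrite indicE; case: (_ \in _); rewrite ?normr0 ?normr1.
rewrite /dramp RintZ//; last exact: lebesgue_itv_lty.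
have -> : \int[mu]_(x in I) \1_(`]s, (s + t)[ : set R) x = t.
  transitivity (\int[mu]_(x in I) (\1_(`]s, (s + t)[ : set R) x * 1)).
    by apply: eq_Rint => x _; rewrite mulr1.
  rewrite (Rint_indic_mul _ sub) Rint_cst// fine_lebesgue_itv ?lerDl ?(ltW t0)//.
  by rewrite mul1r addrAC subrr add0r.
by rewrite mulVf// gt_eqF.
Qed.

(** Nothing enters through either end: the essential upper limit of [Q psi] at [a] is at most 0 and
    its essential lower limit at [b] is at least 0. The limits themselves need not exist. *)
Definition outflow Q psi (t : R) : Prop :=
  (forall e : R, 0 < e -> exists2 d : R, 0 < d &
    {ae mu, forall x, a < x < a + d -> Q (x, t) * psi x <= e}) /\
  (forall e : R, 0 < e -> exists2 d : R, 0 < d &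
    {ae mu, forall x, b - d < x < b -> - e <= Q (x, t) * psi x}).

Lemma Rint_abs_dcutoff n :
  \int[mu]_(x in I) (dramp (a + r n) (r n) x + dramp (b - 2 * r n) (r n) x) = 2.
Proof.
have r0 := cutoff_width_gt0 n; have ro := cutoff_width_order n.
have bd s : bm I (dramp s (r n)).
  split; first exact: measurable_dramp.
  by exists (r n)^-1 => x _; exact: dramp_bound.
rewrite RintD//; [|exact: lebesgue_itv_lty|exact: bd|exact: bd].
rewrite !Rint_dramp//; have ab' := ab; lra.
Qed.

Lemma norm_dcutoff n x :
  `|dcutoff n x| <= dramp (a + r n) (r n) x + dramp (b - 2 * r n) (r n) x.
Proof.
have r0 := cutoff_width_gt0 n.
have := dramp_ge0 (a + r n) r0 x; have := dramp_ge0 (b - 2 * r n) r0 x.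
rewrite /dcutoff /dbump ler_norml => ? ?; apply/andP; split; lra.
Qed.

(** [dcutoff] is a probability density near [a] minus one near [b], which matches the signs in
    [outflow]; each of the two contributes at most [e / 2]. *)
Lemma outflow_cutoff Q psi (t : R) : bm setT Q -> bm I psi -> outflow Q psi t ->
  forall e : R, 0 < e -> \forall n \near \oo,
    \int[mu]_(x in I) (Q (x, t) * psi x * dcutoff n x) <= e.
Proof.
move=> bQ bpsi [hl hr] e e0.
have e2 : 0 < e / 2 by rewrite divr_gt0.
have [d1 d10 h1] := hl _ e2; have [d2 d20 h2] := hr _ e2.
have d12 : 0 < d1 / 2 by rewrite divr_gt0.
have d22 : 0 < d2 / 2 by rewrite divr_gt0.
apply: filterS2 (cutoff_width_lt d12) (cutoff_width_lt d22) => n n1 n2.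
have r0 := cutoff_width_gt0 n; have ro := cutoff_width_order n.
have finI : (mu I < +oo)%E by exact: lebesgue_itv_lty.
have bd s : bm I (dramp s (r n)).
  split; first exact: measurable_dramp.
  by exists (r n)^-1 => x _; exact: dramp_bound.
have bdd : bm I (fun x => dramp (a + r n) (r n) x + dramp (b - 2 * r n) (r n) x).
  exact: (bmD (bd _) (bd _)).
apply: (@le_trans _ _ (\int[mu]_(x in I) (e / 2 *
    (dramp (a + r n) (r n) x + dramp (b - 2 * r n) (r n) x)))); last first.
  by rewrite RintZ// Rint_abs_dcutoff; lra.
apply: le_Rint_ae => //.
- apply: bmM; last exact: bm_dcutoff.
  by apply: bmM => //; exact: bmT_pair1.
- exact: bmZ.
apply: ae_imp2 h1 h2 => x; set q := Q (x, t) * psi x => h1 h2 Ix.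
rewrite /dcutoff /dbump.
have [xl|xl] := boolP (a + r n < x < a + r n + r n).
  rewrite [dramp (b - 2 * r n) _ _]dramp_out ?subr0 ?addr0; last first.
    by case/andP : xl => ? ?; rewrite negb_and -!leNgt; apply/orP; left; lra.
  rewrite ler_wpM2r ?dramp_ge0//; apply: h1.
  by case/andP : xl => ? ?; apply/andP; split; lra.
rewrite (dramp_out xl) sub0r add0r mulrN -mulNr.
have [xr|xr] := boolP (b - 2 * r n < x < b - 2 * r n + r n); last first.
  by rewrite dramp_out// !mulr0.
rewrite ler_wpM2r ?dramp_ge0// lerNl; apply: h2.
by case/andP : xr => ? ?; apply/andP; split; lra.
Qed.

(** The weight [psi] times the cutoff is admissible. As the cutoff tends to 1, the only extra term
    is the boundary term [P n], and [outflow] makes its upper limit nonpositive at almost every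
    time. *)
Lemma entropic_boundary (T0 Tm : R) E Q psi g :
  bm setT E -> bm setT Q -> entropic a b Tm T0 E Q -> profile psi g ->
  {ae mu, forall t, T0 < t < Tm -> outflow Q psi t} ->
  forall s t, T0 < s -> s < t -> t < Tm ->
  \int[mu]_(x in I) (E (x, t) * psi x) - \int[mu]_(x in I) (E (x, s) * psi x)
  <= \int[mu]_(tau in `]s, t[) \int[mu]_(x in I) (Q (x, tau) * g x).
Proof.
move=> bE bQ EQ pp bc s t s0 st tT.
have finI : (mu I < +oo)%E by exact: lebesgue_itv_lty.
have finst : (mu (`]s, t[ : set R) < +oo)%E by exact: lebesgue_itv_lty.
have [_ _ bpsi bg _] := pp.
have ab' := ltW ab.
have clampE x : I x -> clamp a b x = x.
  by rewrite /= in_itv/= => /andP[? ?]; rewrite clamp_id// !ltW.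
have bEt tau : bm I (fun x => E (x, tau)) by exact: bmT_pair1.
have bQt tau : bm I (fun x => Q (x, tau)) by exact: bmT_pair1.
have bcut n := bm_cutoff I n.
have bdcut n := bm_dcutoff I n.
pose H n tau := \int[mu]_(x in I) (E (x, tau) * psi x * cutoff n x).
pose A n tau := \int[mu]_(x in I) (Q (x, tau) * g x * cutoff n x).
pose P n tau := \int[mu]_(x in I) (Q (x, tau) * psi x * dcutoff n x).
have bF2 F (h k : R -> R) : bm setT F -> bm I h -> bm I k ->
    bm (I `*` `]s, t[) (fun p => F p * h p.1 * k p.1).
  move=> bF bh bk; apply: bmM; last exact: bmT_fst.
  by apply: bmM; [exact: bmS bF|exact: bmT_fst].
have bA n : bm `]s, t[ (A n).
  by apply: (@bm_Rint_fst _ I `]s, t[ (fun p => Q p * g p.1 * cutoff n p.1)) => //;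
    exact: bF2.
have bP n : bm `]s, t[ (P n).
  by apply: (@bm_Rint_fst _ I `]s, t[ (fun p => Q p * psi p.1 * dcutoff n p.1)) => //;
    exact: bF2.
have bPm n : bm `]s, t[ (fun tau => Num.max 0 (P n tau)).
  by apply: bm_max; [exact: bm_cst|exact: bP].
(* Only the positive part of [P n] is kept: [outflow] bounds [P n] from above alone, whereas its
   positive part converges to 0. *)
have key n : H n t - H n s <= \int[mu]_(tau in `]s, t[) A n tau +
    \int[mu]_(tau in `]s, t[) Num.max 0 (P n tau).
  have := EQ _ _ (profile_cutoff n pp) s t s0 st tT.
  have HE tau : \int[mu]_(x in I) (E (x, tau) * (psi (clamp a b x) * cutoff n x)) =
      H n tau.
    by apply: eq_Rint => x Ix; rewrite clampE// mulrA.
  rewrite !HE => h; apply: (le_trans h).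
  rewrite -RintD//; [|exact: bA|exact: bPm].
  apply: le_Rint => //.
  - apply: (@bm_Rint_fst _ I `]s, t[ (fun p => Q p * (g p.1 * cutoff n p.1 +
      psi p.1 * dcutoff n p.1))) => //.
    apply: bmM; first exact: bmS bQ.
    apply: (@bmT_fst _ I `]s, t[ (fun x => g x * cutoff n x + psi x * dcutoff n x)).
    by apply: bmD; apply: bmM.
  - by apply: bmD; [exact: bA|exact: bPm].
  move=> tau _; apply: (@le_trans _ _ (A n tau + P n tau)).
    rewrite -RintD//; [|exact: (bmM (bmM (bQt tau) bg) (bcut n))|
      exact: (bmM (bmM (bQt tau) bpsi) (bdcut n))].
    by rewrite le_eqVlt; apply/orP; left; apply/eqP; apply: eq_Rint => x _; ring.
  by rewrite lerD2l le_max lexx orbT.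
have [_ [KE EK]] := bE; have [_ [KQ QK]] := bQ.
have [mpsi [Kp pK]] := bpsi; have [mg [Kg gK]] := bg.
have cutb n x : `|cutoff n x| <= 1.
  by have /andP[? ?] := cutoff_itv n x; rewrite ger0_norm.
have cH tau : H n tau @[n --> \oo] --> \int[mu]_(x in I) (E (x, tau) * psi x).
  have [mEt _] := bEt tau.
  apply: (@bounded_cvg _ _ _ mu I _ finI _ _ (KE * Kp * 1)) => //.
  - by move=> n; apply: measurable_funM; [exact: measurable_funM|exact: measurable_cutoff].
  - exact: measurable_funM.
  - move=> n x Ix; rewrite !normrM; apply: ler_pM => //.
    by apply: ler_pM => //; [exact: EK|exact: pK].
  - apply: aeW => x; rewrite /= in_itv/= => xab.
    rewrite -[X in _ --> X]mulr1; apply: cvgM; first exact: cvg_cst.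
    exact: cutoff_cvg.
have cA' tau : A n tau @[n --> \oo] --> \int[mu]_(x in I) (Q (x, tau) * g x).
  have [mQt _] := bQt tau.
  apply: (@bounded_cvg _ _ _ mu I _ finI _ _ (KQ * Kg * 1)) => //.
  - by move=> n; apply: measurable_funM; [exact: measurable_funM|exact: measurable_cutoff].
  - exact: measurable_funM.
  - move=> n x Ix; rewrite !normrM; apply: ler_pM => //.
    by apply: ler_pM => //; [exact: QK|exact: gK].
  - apply: aeW => x; rewrite /= in_itv/= => xab.
    rewrite -[X in _ --> X]mulr1; apply: cvgM; first exact: cvg_cst.
    exact: cutoff_cvg.
have cA : \int[mu]_(tau in `]s, t[) A n tau @[n --> \oo] -->
    \int[mu]_(tau in `]s, t[) \int[mu]_(x in I) (Q (x, tau) * g x).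
  apply: (@bounded_cvg _ _ _ mu _ _ finst _ _ (KQ * Kg * 1 * fine (mu I))) => //.
  - by move=> n; have [] := bA n.
  - have [] : bm `]s, t[ (fun tau => \int[mu]_(x in I) (Q (x, tau) * g x)); last by [].
    apply: (@bm_Rint_fst _ I `]s, t[ (fun p => Q p * g p.1)) => //.
    by apply: bmM; [exact: bmS bQ|exact: bmT_fst].
  - move=> n tau _; apply: norm_Rint_le_cst => //.
      exact: (bmM (bmM (bQt tau) bg) (bcut n)).
    move=> x Ix; rewrite !normrM; apply: ler_pM => //.
    by apply: ler_pM => //; [exact: QK|exact: gK].
  - by apply: aeW => tau _; exact: cA'.
(* [dcutoff n] blows up pointwise, but the integral of its absolute value is at most 2 for all [n];
   this gives the bound uniform in [n] and [tau]. *)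
have cP : \int[mu]_(tau in `]s, t[) Num.max 0 (P n tau) @[n --> \oo] --> (0 : R).
  have I0 : \int[mu]_(tau in `]s, t[) (0 : R) = 0 by rewrite Rint_cst// mul0r.
  rewrite -[X in _ --> X]I0.
  apply: (@bounded_cvg _ _ _ mu _ _ finst _ _ (KQ * Kp * 2)) => //.
  - by move=> n; apply: measurable_maxr => //; have [] := bP n.
  - move=> n tau _.
    suff h : `|P n tau| <= KQ * Kp * 2.
      rewrite ger0_norm ?le_max ?lexx// ge_max (le_trans _ h)//=.
      exact: le_trans (ler_norm _) h.
    have bPi : bm I (fun x => Q (x, tau) * psi x * dcutoff n x).
      exact: (bmM (bmM (bQt tau) bpsi) (bdcut n)).
    apply: (le_trans (norm_Rint_le _ finI bPi)) => //.
    rewrite -(Rint_abs_dcutoff n).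
    have bd s' : bm I (dramp s' (r n)).
      split; first exact: measurable_dramp.
      by exists (r n)^-1 => x _; exact/dramp_bound/cutoff_width_gt0.
    have bdd := bmD (bd (a + r n)) (bd (b - 2 * r n)).
    rewrite -RintZ//; apply: le_Rint => //; [exact: bm_norm|exact: bmZ|].
    move=> x Ix; rewrite !normrM; apply: ler_pM => //.
      by apply: ler_pM => //; [exact: QK|exact: pK].
    exact: norm_dcutoff.
  apply: ae_imp bc => tau bct; rewrite /= in_itv/= => /andP[stau taut].
  have {}bct : outflow Q psi tau.
    by apply: bct; rewrite (lt_trans s0)// (lt_trans taut).
  apply/cvgrPdist_lt => e e0.
  have e2 : 0 < e / 2 by rewrite divr_gt0.
  apply: filterS (outflow_cutoff bQ bpsi bct e2) => n hn.
  rewrite sub0r normrN ger0_norm ?le_max ?lexx//.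
  by rewrite gt_max e0 (le_lt_trans hn)//; lra.
have := ler_cvg_to (cvgB (cH t) (cH s)) (cvgD cA cP); rewrite addr0; apply.
by apply: nearW.
Qed.

End Boundary.

(** * Trapping in finite time *)

Section Decay.
Context {R : realType}.
Local Notation mu := (@lebesgue_measure R).
Implicit Types (psi g : R -> R) (E Q F : R * R -> R) (s t r x : R).

Lemma C1_profile (a b : R) psi g : a < b ->
  (forall x, is_derive x (1 : R) psi (g x)) -> continuous g ->
  (forall x, 0 <= psi x) -> profile a b psi g.
Proof.
move=> ab dpsi cg psi0.
have cpsi : continuous psi.
  move=> x; apply: differentiable_continuous; apply/derivable1_diffP.
  by have [] := dpsi x.
have [_ [K gK]] := @bm_itv R (a - 1) (b + 1) g cg.
split => //.
- exists K => x y xab yab.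
  wlog xy : x y xab yab / x <= y.
    move=> h; have [xy|/ltW yx] := leP x y; first exact: h.
    by rewrite distrC (distrC x); exact: h.
  have dv v : derivable psi v 1 by have [] := dpsi v.
  have [c /andP[xc cy] E] := derivable_mean_value dv xy.
  rewrite distrC E normrM distrC ler_wpM2r//.
  have [_] := dpsi c; rewrite -derive1E => ->; apply: gK; rewrite /= in_itv/=.
  by case/andP : xab => ? ?; case/andP : yab => ? ?; apply/andP; split; lra.
- exact: bm_itv.
- exact: bm_itv.
- by apply: aeW => x _.
Qed.

Lemma outflow_scale (a b : R) Q psi (C t : R) : a < b ->
  (forall x, a <= x <= b -> 0 <= psi x <= C) ->
  outflow a b Q (fun=> 1) t -> outflow a b Q psi t.
Proof.
move=> ab psiC [hl hr].
have C1 : 0 < `|C| + 1 by rewrite ltr_wpDl.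
split => e e0.
- have [|d d0 h] := hl (e / (`|C| + 1)); first by rewrite divr_gt0.
  exists (Num.min d (b - a)); first by rewrite lt_min d0 subr_gt0.
  apply: ae_imp h => x h /andP[ax xd].
  have [h1 h2] : x < a + d /\ x < b.
    split; rewrite (lt_le_trans xd)//.
      by rewrite lerD2l ge_min lexx.
    by rewrite -lerBrDl ge_min lexx orbT.
  have /andP[p0 pC] : 0 <= psi x <= C by apply: psiC; rewrite !ltW.
  have := h; rewrite ax h1 mulr1 => /(_ isT) qe.
  apply: (@le_trans _ _ (e / (`|C| + 1) * psi x)); first exact: ler_wpM2r.
  rewrite mulrAC ler_pdivrMr// ler_wpM2l ?(ltW e0)// (le_trans pC)//.
  by rewrite (le_trans (ler_norm _))// lerDl.
- have [|d d0 h] := hr (e / (`|C| + 1)); first by rewrite divr_gt0.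
  exists (Num.min d (b - a)); first by rewrite lt_min d0 subr_gt0.
  apply: ae_imp h => x h /andP[xd xb].
  have [h1 h2] : b - d < x /\ a < x.
    split; rewrite (le_lt_trans _ xd)//.
      by rewrite lerD2l lerN2 ge_min lexx.
    by rewrite lerBrDr -lerBrDl ge_min lexx orbT.
  have /andP[p0 pC] : 0 <= psi x <= C by apply: psiC; rewrite !ltW.
  have := h; rewrite h1 xb mulr1 => /(_ isT) qe.
  apply: (@le_trans _ _ (- (e / (`|C| + 1)) * psi x)); last exact: ler_wpM2r.
  rewrite mulNr lerN2 mulrAC ler_pdivrMr// ler_wpM2l ?(ltW e0)// (le_trans pC)//.
  by rewrite (le_trans (ler_norm _))// lerDl.
Qed.

(** The sign [sigma] is the direction of transport: 1 for the excess over [M], which moves right,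
    and -1 for the deficit below [m], which moves left. The weight decreases in that direction. *)
Definition exp_weight (sigma al x : R) := expR (- (al * sigma * x)).
Definition weighted_mass (l sigma : R) E (al t : R) :=
  \int[mu]_(x in `]- l, l[) (E (x, t) * exp_weight sigma al x).

Lemma contraction_arith (P S A k d : R) : 0 <= k -> S * d <= A ->
  S - P <= - k * A -> (1 + k * d) * S <= P.
Proof. by move=> k0 h1; have h := ler_wpM2l k0 h1; move=> h2; lra. Qed.

Variables (l Tm c sigma : R) (E Q : R * R -> R).
Hypotheses (l0 : 0 < l) (c0 : 0 < c) (sigma1 : `|sigma| = 1).
Hypotheses (bE : bm setT E) (bQ : bm setT Q) (EQ : entropic (- l) l Tm 0 E Q).
Hypotheses (E0 : forall p, 0 <= E p) (speed : forall p, c * E p <= sigma * Q p).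
Hypothesis out : {ae mu, forall t, 0 < t < Tm -> outflow (- l) l Q (fun=> 1) t}.
Local Notation I := (`]- l, l[%classic : set R).

Local Notation weight := (exp_weight sigma).
Local Notation X := (weighted_mass l sigma E).

Let ll : - l < l. Proof. by rewrite gtrN. Qed.

Let weight_derive al x :
  is_derive x (1 : R) (weight al) (- (al * sigma) * weight al x).
Proof.
rewrite /exp_weight.
have d1 : is_derive x (1 : R) (fun z : R => - (al * sigma * z)) (- (al * sigma)).
  by apply: is_derive_eq; rewrite /GRing.scale/= mulr1.
have d2 := @is_derive1_comp _ expR _ x _ _ (is_derive_expR (- (al * sigma * x))) d1.
exact: (is_derive_eq d2 (mulrC _ _)).
Qed.

Let weight_gt0 al x : 0 < weight al x. Proof. exact: expR_gt0. Qed.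

Let weight_cont al : continuous (weight al).
Proof.
move=> x; apply: differentiable_continuous; apply/derivable1_diffP.
by have [] := weight_derive al x.
Qed.

Let weight_bounds al x : 0 <= al -> - l <= x <= l ->
  expR (- (al * l)) <= weight al x <= expR (al * l).
Proof.
move=> al0 xl; rewrite !ler_expR -ler_norml normrN !normrM sigma1 mulr1.
by rewrite ger0_norm// ler_wpM2l// ler_norml.
Qed.

Let weight_profile al : profile (- l) l (weight al) (fun x => - (al * sigma) * weight al x).
Proof.
apply: C1_profile => //.
  by move=> x; apply: cvgM; [exact: cvg_cst|exact: weight_cont].
by move=> x; exact: ltW.
Qed.

Let finI : (mu I < +oo)%E. Proof. exact: lebesgue_itv_lty. Qed.
Let bEt t : bm I (fun x => E (x, t)). Proof. exact: bmT_pair1. Qed.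
Let bQt t : bm I (fun x => Q (x, t)). Proof. exact: bmT_pair1. Qed.
Let bw al : bm I (weight al). Proof. by apply: bm_itv; exact: weight_cont. Qed.
Let bEw al t : bm I (fun x => E (x, t) * weight al x). Proof. exact: (bmM (bEt t) (bw al)). Qed.

Let X_ge0 al t : 0 <= X al t.
Proof. by apply: Rintegral_ge0 => x _; rewrite mulr_ge0// ltW. Qed.

Let X_bm al s t : bm `]s, t[ (X al).
Proof.
apply: (@bm_Rint_fst _ I `]s, t[ (fun p => E p * weight al p.1)) => //.
by apply: bmM; [exact: bmS bE|exact: bmT_fst].
Qed.

(** Differentiating the weight yields the factor [- (al * sigma)], and [speed] bounds [sigma * Q]
    below by [c * E]. *)
Let X_ineq al s t : 0 <= al -> 0 < s -> s < t -> t < Tm ->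
  X al t - X al s <= - (al * c) * \int[mu]_(tau in `]s, t[) X al tau.
Proof.
move=> al0 s0 st tT.
have finst : (mu (`]s, t[ : set R) < +oo)%E by exact: lebesgue_itv_lty.
have ol : {ae mu, forall t, 0 < t < Tm -> outflow (- l) l Q (weight al) t}.
  apply: ae_imp out => tau h /h; apply: (@outflow_scale _ _ _ _ (expR (al * l))) => // x xl.
  by have /andP[_ ->] := weight_bounds al0 xl; rewrite ltW ?weight_gt0.
have := entropic_boundary ll bE bQ EQ (weight_profile al) ol s0 st tT.
move=> h; apply: (le_trans h).
rewrite -(RintZ _ finst _ (X_bm al s t))//; apply: le_Rint => //.
- apply: (@bm_Rint_fst _ I `]s, t[ (fun p => Q p * (- (al * sigma) * weight al p.1))) => //.
  apply: bmM; first exact: bmS bQ.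
  by apply: (@bmT_fst _ I `]s, t[ (fun x => - (al * sigma) * weight al x)); exact: bmZ.
- exact: (bmZ _ (X_bm al s t)).
move=> tau _; rewrite -(RintZ _ finI _ (bEw al tau))//; apply: le_Rint => //.
- exact: (bmM (bQt tau) (bmZ _ (bw al))).
- exact: (bmZ _ (bEw al tau)).
move=> x _; have sp := speed (x, tau).
rewrite (_ : Q _ * _ = - (al * weight al x * (sigma * Q (x, tau)))); last by ring.
rewrite (_ : - (al * c) * _ = - (al * weight al x * (c * E (x, tau)))); last by ring.
by rewrite lerN2 ler_wpM2l// mulr_ge0// ltW.
Qed.

Let X_noninc al s t : 0 <= al -> 0 < s -> s <= t -> t < Tm -> X al t <= X al s.
Proof.
move=> al0 s0; rewrite le_eqVlt => /predU1P[->//|st] tT.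
have := X_ineq al0 s0 st tT.
have h : 0 <= al * c * \int[mu]_(tau in `]s, t[) X al tau.
  rewrite mulr_ge0// ?mulr_ge0// ?(ltW c0)//.
  by apply: Rintegral_ge0 => tau _; exact: X_ge0.
by move=> h2; rewrite -subr_le0 (le_trans h2)// mulNr oppr_le0.
Qed.

(** An implicit Euler step instead of a Gronwall argument: [X] does not increase, so its integral
    over []s, t[] is at least [X al t * (t - s)]. *)
Let X_contract al s t : 0 <= al -> 0 < s -> s < t -> t < Tm ->
  (1 + al * c * (t - s)) * X al t <= X al s.
Proof.
move=> al0 s0 st tT.
have finst : (mu (`]s, t[ : set R) < +oo)%E by exact: lebesgue_itv_lty.
have := X_ineq al0 s0 st tT.
suff h : X al t * (t - s) <= \int[mu]_(tau in `]s, t[) X al tau.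
  have ac : 0 <= al * c by rewrite mulr_ge0// ltW.
  by move=> h2; exact: (contraction_arith ac h h2).
rewrite -(fine_lebesgue_itv false true (ltW st)) -Rint_cst//.
apply: le_Rint => //; [exact: bm_cst|exact: X_bm|].
move=> tau; rewrite /= in_itv/= => /andP[sta tat].
by apply: X_noninc => //; [exact: lt_trans sta|exact: ltW].
Qed.

Let X_iter al (d : R) (n : nat) s : 0 <= al -> 0 < s -> 0 < d -> al * c * d = 1 ->
  s + n%:R * d < Tm -> 2 ^+ n * X al (s + n%:R * d) <= X al s.
Proof.
move=> al0 s0 d0 acd; elim: n => [|n IH].
  by rewrite expr0 mul0r addr0 mul1r.
move=> nT; have h1 : s + n%:R * d < s + n.+1%:R * d.
  by rewrite ltrD2l ltr_pM2r// ltr_nat.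
apply: le_trans (IH _); last exact: lt_trans nT.
have hs : 0 < s + n%:R * d by rewrite ltr_pwDl// mulr_ge0// ltW.
have := X_contract al0 hs h1 nT.
rewrite (_ : s + n.+1%:R * d - _ = d); last by rewrite -natr1; ring.
rewrite acd => h; rewrite exprSr -mulrA ler_wpM2l// ?exprn_ge0//.
Qed.

(* For [al = n / (c (t - s))] the weighted mass is halved [n] times between [s]
   and [t], whereas the extremal values of the weight have ratio at most
   [(3 / 2) ^+ n]. *)
Lemma finite_time_decay (s t : R) : 0 < s -> t < Tm ->
  s + 2 * l / (c * ln (3 / 2)) <= t ->
  {ae mu, forall x, - l < x < l -> E (x, t) = 0}.
Proof.
move=> s0 tT sT.
have ln0 : 0 < ln (3 / 2 : R) by rewrite ln_gt0//; lra.
have cl0 : 0 < c * ln (3 / 2 : R) by rewrite mulr_gt0.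
have w0 : 0 < 2 * l / (c * ln (3 / 2)) by rewrite divr_gt0// mulr_gt0.
have st : 0 < t - s by lra.
pose Y tau := \int[mu]_(x in I) E (x, tau).
have Y0 tau : 0 <= Y tau by apply: Rintegral_ge0 => x _.
have key n : Y t <= (3 / 4) ^+ n * Y s.
  have [->|n0] := posnP n.
    have := X_noninc (lexx 0) s0 (ltac:(lra) : s <= t) tT.
    have XE tau : X 0 tau = Y tau.
      by apply: eq_Rint => x _; rewrite /exp_weight !mul0r oppr0 expR0 mulr1.
    by rewrite !XE expr0 mul1r.
  have n0' : 0 < n%:R :> R by rewrite ltr0n.
  pose al := n%:R / (c * (t - s)); pose d := (t - s) / n%:R.
  have al0 : 0 <= al by rewrite divr_ge0// mulr_ge0// ltW.
  have d0 : 0 < d by rewrite divr_gt0.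
  have acd : al * c * d = 1.
    by rewrite /al /d; field; rewrite !gt_eqF.
  have nd : s + n%:R * d = t by rewrite /d mulrC divfK ?gt_eqF//; ring.
  have := @X_iter al d n s al0 s0 d0 acd; rewrite nd => /(_ tT) h.
  have h1 : expR (- (al * l)) * Y t <= X al t.
    rewrite -(RintZ _ finI _ (bEt t))//; apply: le_Rint => //; [exact: (bmZ _ (bEt t))|exact: bEw|].
    move=> x; rewrite /= in_itv/= => /andP[? ?]; rewrite mulrC ler_wpM2l//.
    by have /andP[] := @weight_bounds al x al0 (ltac:(by rewrite !ltW)).
  have h2 : X al s <= expR (al * l) * Y s.
    rewrite -(RintZ _ finI _ (bEt s))//; apply: le_Rint => //; [exact: bEw|exact: (bmZ _ (bEt s))|].
    move=> x; rewrite /= in_itv/= => /andP[? ?]; rewrite [leRHS]mulrC ler_wpM2l//.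
    by have /andP[] := @weight_bounds al x al0 (ltac:(by rewrite !ltW)).
  (* This is where the waiting time comes from: with [al = n / (c (t - s))] it amounts to
     [2 l / (c (t - s)) <= ln (3 / 2)]. Together with [n] halvings it gives the ratio
     [(3 / 4) ^+ n]. *)
  have h3 : expR (al * l) ^+ 2 <= (3 / 2) ^+ n.
    rewrite -expRM_natl -[leRHS](@lnK _ ((3 / 2) ^+ n)); last by rewrite posrE exprn_gt0//; lra.
    rewrite ler_expR lnXn; last by lra.
    rewrite -[leRHS]mulr_natl /al.
    rewrite (_ : 2%:R * _ = n%:R * (2 * l / (c * (t - s)))); last first.
      by field; rewrite !gt_eqF.
    rewrite ler_wpM2l// ler_pdivrMr ?mulr_gt0//.
    move: (ltac:(lra) : 2 * l / (c * ln (3 / 2)) <= t - s).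
    rewrite ler_pdivrMr// => h4; rewrite (le_trans h4)// le_eqVlt.
    by apply/orP; left; apply/eqP; ring.
  have e0 := expR_gt0 (al * l).
  have h5 : Y t <= expR (al * l) * X al t.
    by move: h1; rewrite expRN ler_pdivrMl.
  have p2 : 0 < 2 ^+ n :> R by rewrite exprn_gt0.
  rewrite (_ : (3 / 4 : R) = 3 / 2 * 2^-1); last by field.
  rewrite exprMn exprVn mulrAC ler_pdivlMr// mulrC.
  apply: (@le_trans _ _ (expR (al * l) * (2 ^+ n * X al t))).
    by rewrite mulrCA ler_wpM2l// ltW.
  apply: (@le_trans _ _ (expR (al * l) * (expR (al * l) * Y s))).
    by rewrite ler_wpM2l ?(ltW e0)// (le_trans h).
  by rewrite mulrA -expr2 ler_wpM2r.
have Yt0 : Y t = 0.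
  apply/eqP; rewrite eq_le Y0 andbT.
  have c34 : (3 / 4 : R) ^+ n @[n --> \oo] --> 0.
    by apply: cvg_expr; rewrite ger0_norm; lra.
  have := ler_cvg_to (cvg_cst (Y t)) (cvgM c34 (cvg_cst (Y s))).
  by rewrite mul0r; apply; apply: nearW.
apply: ae_imp (Rint_eq0_ae _ finI (bEt t) _ Yt0) => //.
Qed.

End Decay.

(** * Potentials and extinction *)

Section Primitive.
Context {R : realType}.
Local Notation mu := (@lebesgue_measure R).
Implicit Types (h : R -> R) (c x y K : R).

Definition primitive c h x := \int[mu]_(y in `]c, x]) h y.

Lemma primitive_bm h K (A : set R) : measurable_fun setT h ->
  (forall x, `|h x| <= K) -> bm A h.
Proof. by move=> mh hK; split => //; exists K => x _. Qed.

Lemma primitive_id c h : primitive c h c = 0.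
Proof. by rewrite /primitive set_itv_ge ?bnd_simp// Rintegral_set0. Qed.

Lemma primitiveB c h K x y : measurable_fun setT h ->
  (forall x, `|h x| <= K) -> c <= x -> x <= y ->
  primitive c h y - primitive c h x = \int[mu]_(z in `]x, y]) h z.
Proof.
move=> mh hK cx xy; apply: Rintegral_itvB; rewrite ?bnd_simp//.
apply: bm_integrable => //; first exact: lebesgue_itv_lty.
exact: primitive_bm hK.
Qed.

Lemma primitive_lip c h K x y : measurable_fun setT h ->
  (forall x, `|h x| <= K) -> c <= x -> x <= y ->
  `|primitive c h y - primitive c h x| <= K * (y - x).
Proof.
move=> mh hK cx xy; rewrite (primitiveB mh hK cx xy).
rewrite -(fine_lebesgue_itv false false xy).
apply: norm_Rint_le_cst => //; first exact: lebesgue_itv_lty.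
exact: primitive_bm hK.
Qed.

Lemma primitive_derive c h K : measurable_fun setT h ->
  (forall x, `|h x| <= K) ->
  {ae mu, forall x, c < x -> is_derive x (1 : R) (primitive c h) (h x)}.
Proof.
move=> mh hK.
have ih y : mu.-integrable `]c, y] (EFin \o h).
  apply: bm_integrable => //; first exact: lebesgue_itv_lty.
  exact: primitive_bm hK.
have lh : locally_integrable [set: R] h.
  split => //; first exact: openT.
  move=> C _ cC; have : mu.-integrable C (EFin \o h).
    apply: bm_integrable; first exact: compact_measurable.
      exact: compact_finite_measure.
    exact: primitive_bm hK.
  by case/integrableP.
have := FTC1 ih lh; apply: ae_imp => x hx cx.
have [|dP <-] := hx; first by rewrite lte_fin.
exact: is_derive_derive1.
Qed.

Lemma primitive_ge0 c h x : (forall x, 0 <= h x) -> 0 <= primitive c h x.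
Proof. by move=> h0; apply: Rintegral_ge0. Qed.

End Primitive.

(** * Potentials of a conserved function with values between the two states *)

Section Gaps.
Context {R : realType}.
Local Notation mu := (@lebesgue_measure R).
Variables (l m M T0 Tm : R) (f : R -> R) (w : R * R -> R).

(* [left_gap] and [right_gap] are the differences between the potential
   [\int_(-l)^x w] and its extremal values [M (x + l)] and [C + m (x - l)]. *)
Definition left_gap t x := primitive (- l) (fun y => M - w (y, t)) x.
Definition right_gap t x := left_gap t x - left_gap t l + (M - m) * (l - x).

Hypotheses (l0 : 0 < l) (mM : m < M).
Hypothesis mw : measurable_fun setT w.
Hypothesis w_itv : forall p, m <= w p <= M.
Local Notation I := (`]- l, l[%classic : set R).

Let ll : - l < l. Proof. by rewrite gtrN. Qed.
Let finI : (mu I < +oo)%E. Proof. exact: lebesgue_itv_lty. Qed.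

Lemma gap_norm p : `|M - w p| <= M - m.
Proof. by have /andP[? ?] := w_itv p; rewrite ger0_norm; lra. Qed.

Lemma gap_measurable t : measurable_fun setT (fun y => M - w (y, t)).
Proof. by apply: measurable_funB => //; exact: measurable_fun_pair1. Qed.

Lemma left_gap_left t : left_gap t (- l) = 0.
Proof. exact: primitive_id. Qed.

Lemma right_gap_right t : right_gap t l = 0.
Proof. by rewrite /right_gap !subrr mulr0 addr0. Qed.

Lemma left_gap_ge0 t x : 0 <= left_gap t x.
Proof.
by apply: primitive_ge0 => y; have /andP[? ?] := w_itv (y, t); rewrite subr_ge0.
Qed.

Lemma left_gap_mono t x y : - l <= x -> x <= y ->
  0 <= left_gap t y - left_gap t x <= (M - m) * (y - x).
Proof.
move=> lx xy; have h := primitive_lip (gap_measurable t)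
  (fun y => gap_norm (y, t)) lx xy.
rewrite (le_trans (ler_norm _) h) andbT /left_gap.
rewrite (primitiveB (gap_measurable t) (fun y => gap_norm (y, t)) lx xy).
by apply: Rintegral_ge0 => z _; have /andP[? ?] := w_itv (z, t); rewrite subr_ge0.
Qed.

Lemma right_gap_mono t x y : - l <= x -> x <= y ->
  - ((M - m) * (y - x)) <= right_gap t y - right_gap t x <= 0.
Proof.
move=> lx xy; have /andP[h1 h2] := left_gap_mono t lx xy.
by rewrite /right_gap; apply/andP; split; lra.
Qed.

Lemma right_gap_ge0 t x : - l <= x <= l -> 0 <= right_gap t x.
Proof.
case/andP => lx xl; have /andP[_] := right_gap_mono t lx xl.
by rewrite right_gap_right sub0r oppr_le0.
Qed.

Lemma left_gap_le t x : - l <= x <= l -> left_gap t x <= 2 * l * (M - m).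
Proof.
case/andP => lx xl; have /andP[_] := left_gap_mono t (lexx _) lx.
rewrite left_gap_left subr0 => h; rewrite (le_trans h)// mulrC.
by rewrite ler_wpM2r ?subr_ge0 ?(ltW mM)//; lra.
Qed.

Lemma right_gap_le t x : - l <= x <= l -> right_gap t x <= 2 * l * (M - m).
Proof.
case/andP => lx xl; have /andP[h _] := right_gap_mono t lx xl.
move: h; rewrite right_gap_right sub0r lerN2 => h; rewrite (le_trans h)// mulrC.
by rewrite ler_wpM2r ?subr_ge0 ?(ltW mM)//; lra.
Qed.

Lemma left_gap_derive t : {ae mu, forall x, - l < x < l ->
  is_derive x (1 : R) (left_gap t) (M - w (x, t))}.
Proof.
apply: ae_imp (primitive_derive (- l) (gap_measurable t)
  (fun y => gap_norm (y, t))) => x h /andP[lx _]; exact: h.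
Qed.

Lemma right_gap_derive t : {ae mu, forall x, - l < x < l ->
  is_derive x (1 : R) (right_gap t) (m - w (x, t))}.
Proof.
apply: ae_imp (left_gap_derive t) => x h /h d1.
have d2 : is_derive x (1 : R) (fun x => (M - m) * (l - x)) (m - M).
  by apply: is_derive_eq; rewrite /GRing.scale/=; ring.
have d3 : is_derive x (1 : R) (fun x => left_gap t x - left_gap t l) (M - w (x, t) - 0).
  by apply: is_deriveB.
by apply: (is_derive_eq (is_deriveD d3 d2)); ring.
Qed.

(** An equality, for weights that need not vanish at the ends: it expresses both the conservation
    law and the absence of flux [f(w) - f M] through the boundary. *)
Definition conserved : Prop := forall psi g, profile (- l) l psi g ->
  forall s t, T0 < s -> s < t -> t < Tm ->
  \int[mu]_(x in I) (w (x, t) * psi x) - \int[mu]_(x in I) (w (x, s) * psi x)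
  = \int[mu]_(tau in `]s, t[) \int[mu]_(x in I) ((f (w (x, tau)) - f M) * g x).

Hypothesis cons : conserved.
Hypothesis cf : continuous f.
Hypothesis f_le : forall y, m <= y <= M -> f y - f M <= 0.
Variable K : R.
Hypothesis f_ge : forall y, m <= y <= M -> - K <= f y - f M.

Local Notation F p := (f (w p) - f M).

Lemma bm_flux : bm setT (fun p => F p).
Proof.
split.
  apply: measurable_funB => //.
  by apply: measurableT_comp => //; exact: continuous_measurable_fun.
exists K => p _; have h1 := f_le (w_itv p); have h2 := f_ge (w_itv p).
by rewrite ler0_norm//; lra.
Qed.

Lemma bm_w t : bm I (fun x => w (x, t)).
Proof.
split; first exact: measurable_fun_pair1.
exists (`|m| + `|M|) => x _; have /andP[h1 h2] := w_itv (x, t).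
have := ler_norm M; have := ler_norm (- m); rewrite normrN.
have := normr_ge0 M; have := normr_ge0 m.
by rewrite ler_norml => *; apply/andP; split; lra.
Qed.

(** Conservation tested with the weight 1. Consequently both gaps have the same increment in
    time. *)
Lemma left_gap_right_const s t : T0 < s -> s < t -> t < Tm ->
  left_gap t l = left_gap s l.
Proof.
move=> s0 st tT.
have finst : (mu (`]s, t[ : set R) < +oo)%E by exact: lebesgue_itv_lty.
have gapE tau : left_gap tau l = M * (2 * l) - \int[mu]_(x in I) (w (x, tau) * 1).
  rewrite /left_gap /primitive -Rintegral_itv_bndo_bndc; last first.
    apply: bm_integrable => //.
    exact: primitive_bm (gap_measurable tau) (fun y => gap_norm (y, tau)).
  rewrite (RintB _ finI (bm_cst _ _) (bm_w tau))// Rint_cst//.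
  rewrite fine_lebesgue_itv ?(ltW ll)//; congr (_ * _ - _); first by ring.
  by apply: eq_Rint => x _; rewrite mulr1.
have p1 : profile (- l) l (fun=> 1) (fun=> 0).
  by apply: C1_profile => // x; exact: cvg_cst.
have := cons p1 s0 st tT.
rewrite [RHS](@eq_Rint _ _ _ _ _ _ (fun=> 0)); last first.
  move=> tau _; rewrite (@eq_Rint _ _ _ _ _ _ (fun=> 0)).
    by rewrite Rint_cst// mul0r.
  by move=> x _; rewrite mulr0.
rewrite Rint_cst// mul0r => /eqP; rewrite subr_eq0 => /eqP E.
by rewrite !gapE E.
Qed.

Lemma right_gapB s t x : T0 < s -> s < t -> t < Tm ->
  right_gap t x - right_gap s x = left_gap t x - left_gap s x.
Proof. by move=> s0 st tT; rewrite /right_gap (left_gap_right_const s0 st tT); ring. Qed.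

Definition step_width x n : R := (l - x) / 2 * n.+1%:R^-1.

Lemma step_profile x r : 0 < r -> - l < x -> x + r < l ->
  profile (- l) l (fun y => 1 - ramp x r y) (fun y => - dramp x r y).
Proof.
move=> r0 lx xl; split.
- by move=> y _; have /andP[? ?] := ramp_itv x r y; rewrite subr_ge0.
- exists r^-1 => y z _ _; rewrite -normrN.
  rewrite (_ : - (1 - ramp x r y - (1 - ramp x r z)) =
    ramp x r y - ramp x r z); last by ring.
  exact: ramp_lip.
- split; last first.
    exists 1 => y _; have /andP[? ?] := ramp_itv x r y.
    by rewrite ger0_norm ?subr_ge0//; lra.
  apply: measurable_funB => //.
  exact: lipschitz_measurable (ramp_lip x r0).
- apply: bmN; split; first exact: measurable_dramp.
  by exists r^-1 => y _; exact: dramp_bound.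
- apply: ae_imp (ramp_ae_derive x r0) => y d1 _.
  have := is_deriveB (is_derive_cst (1 : R) y (1 : R)) d1.
  by rewrite sub0r.
Qed.

Definition flux_integral s t x := \int[mu]_(tau in `]s, t[) F (x, tau).

Lemma measurable_flux_integral s t : measurable_fun setT (flux_integral s t).
Proof.
have mI : measurable (`]s, t[%classic : set R) by exact: measurable_itv.
exact: (measurable_Rint_snd mu mI (proj1 bm_flux)).
Qed.

Lemma flux_integral_itv s t x : s <= t ->
  - (K * (t - s)) <= flux_integral s t x <= 0.
Proof.
move=> st; have finst : (mu (`]s, t[ : set R) < +oo)%E by exact: lebesgue_itv_lty.
have bF : bm `]s, t[ (fun tau => F (x, tau)) by exact: bmT_pair2 bm_flux.
rewrite -mulNr -(fine_lebesgue_itv false true st) -Rint_cst//.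
apply/andP; split.
  by apply: le_Rint => // [|tau _]; [exact: bm_cst|exact: f_ge].
rewrite -[leRHS](mul0r (fine (mu `]s, t[))) -Rint_cst//.
by apply: le_Rint => // [|tau _]; [exact: bm_cst|exact: f_le].
Qed.

Lemma flux_integral_norm s t x : s <= t ->
  `|flux_integral s t x| <= K * (t - s).
Proof.
move=> st; have /andP[h1 h2] := flux_integral_itv x st.
by rewrite ler0_norm//; lra.
Qed.

Lemma step_width_gt0 x n : x < l -> 0 < step_width x n.
Proof. by move=> xl; rewrite mulr_gt0 ?invr_gt0// divr_gt0// subr_gt0. Qed.

Lemma step_width_lt x n : x < l -> x + step_width x n < l.
Proof.
move=> xl; have : step_width x n <= (l - x) / 2; last by move=> ?; lra.
by rewrite ler_piMr ?divr_ge0 ?subr_ge0 ?(ltW xl)// invf_le1// ler1n.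
Qed.

Lemma step_width_cvg x : step_width x @ \oo --> (0 : R).
Proof.
rewrite -[X in _ --> X](mulr0 ((l - x) / 2)).
by apply: cvgM; [exact: cvg_cst|exact: cvg_harmonic].
Qed.

(** The weight [1 - ramp x r] approximates the indicator of []- l, x]]. Conservation turns the
    change of its integral into the mean of [flux_integral] over []x, x + r[], with a limit at every
    [x]. *)
Lemma left_gap_cvg s t x : T0 < s -> s < t -> t < Tm -> - l < x < l ->
  \int[mu]_(y in I) (dramp x (step_width x n) y * flux_integral s t y)
    @[n --> \oo] --> left_gap t x - left_gap s x.
Proof.
move=> s0 st tT /andP[lx xl].
have finst : (mu (`]s, t[ : set R) < +oo)%E by exact: lebesgue_itv_lty.
pose r := step_width x.
have r0 n : 0 < r n by exact: step_width_gt0.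
have rl n : x + r n < l by exact: step_width_lt.
pose psi n y := 1 - ramp x (r n) y.
have psi_itv n y : 0 <= psi n y <= 1.
  by have /andP[? ?] := ramp_itv x (r n) y; rewrite /psi; apply/andP; split; lra.
have sub : `]- l, x]%classic `<=` I by apply: subset_itvl; rewrite bnd_simp.
have psi_cvg tau : \int[mu]_(y in I) (w (y, tau) * psi n y) @[n --> \oo] -->
    \int[mu]_(y in I) (w (y, tau) * \1_(`]- l, x]%classic : set R) y).
  have [mwt [C wC]] := bm_w tau.
  apply: (@bounded_cvg _ _ _ mu I _ finI _ _ (C * 1)) => //.
  - move=> n; apply: measurable_funM => //.
    by apply: measurable_funB => //; exact: lipschitz_measurable (ramp_lip x (r0 n)).
  - by apply: measurable_funM => //; exact: measurable_indic.
  - move=> n y Iy; rewrite normrM; apply: ler_pM => //; first exact: wC.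
    by have /andP[? ?] := psi_itv n y; rewrite ger0_norm.
  apply: aeW => y; rewrite /= in_itv/= => /andP[ly yl].
  apply: cvgM; first exact: cvg_cst.
  rewrite indicE; have [yx|xy] := leP y x.
    rewrite mem_set/= ?in_itv/= ?ly//; apply: cvg_near_cst; apply: nearW => n.
    by rewrite /psi ramp_le// subr0.
  rewrite memNset/= ?in_itv/= ?ly ?leNgt ?xy//; apply: cvg_near_cst.
  have yx0 : 0 < y - x by rewrite subr_gt0.
  apply: filterS (cvgr_lt _ (step_width_cvg x) _ yx0) => n rn.
  by rewrite /psi ramp_ge ?subrr//; rewrite /r; lra.
have gapE tau : left_gap tau x = M * (x + l) -
    \int[mu]_(y in I) (w (y, tau) * \1_(`]- l, x]%classic : set R) y).
  rewrite /left_gap /primitive.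
  rewrite RintB//; [|exact: lebesgue_itv_lty|exact: bm_cst|exact: (bmS sub (bm_w tau))].
  rewrite Rint_cst// fine_lebesgue_itv ?(ltW lx)//; congr (_ * _ - _); first by ring.
  by rewrite -(Rint_indic_mul _ sub); apply: eq_Rint => y _; rewrite mulrC.
have bdr n : bm I (dramp x (r n)).
  split; first exact: measurable_dramp.
  by exists (r n)^-1 => y _; exact: dramp_bound.
have eqn n : \int[mu]_(y in I) (w (y, s) * psi n y) -
    \int[mu]_(y in I) (w (y, t) * psi n y) =
    \int[mu]_(y in I) (dramp x (r n) y * flux_integral s t y).
  have h := cons (step_profile (r0 n) lx (rl n)) s0 st tT.
  rewrite -[LHS]opprB h.
  have bF y : bm `]s, t[ (fun tau => F (y, tau)) by exact: bmT_pair2 bm_flux.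
  have -> : \int[mu]_(y in I) (dramp x (r n) y * flux_integral s t y) =
      \int[mu]_(y in I) \int[mu]_(tau in `]s, t[) (dramp x (r n) y * F (y, tau)).
    by apply: eq_Rint => y _; rewrite (RintZ _ finst _ (bF y)).
  have bDF : bm (I `*` `]s, t[) (fun p => dramp x (r n) p.1 * F p).
    by apply: bmM; [exact: bmT_fst|exact: bmS bm_flux].
  have -> : \int[mu]_(y in I) \int[mu]_(tau in `]s, t[) (dramp x (r n) y * F (y, tau)) =
      \int[mu]_(tau in `]s, t[) \int[mu]_(y in I) (dramp x (r n) y * F (y, tau)).
    by apply/esym; exact: (Rint_swap _ _ finI finst bDF).
  have bG : bm `]s, t[ (fun tau => \int[mu]_(y in I) (dramp x (r n) y * F (y, tau))).
    exact: (bm_Rint_fst _ finI bDF).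
  rewrite -[RHS]opprK; congr (- _).
  rewrite -(RintN _ finst bG)//; apply: eq_Rint => tau _ /=.
  have bFt : bm I (fun y => F (y, tau)) by exact: bmT_pair1 bm_flux.
  rewrite -(RintN _ finI (bmM (bdr n) bFt))//.
  by apply: eq_Rint => y _; ring.
have c : \int[mu]_(y in I) (dramp x (r n) y * flux_integral s t y) @[n --> \oo] -->
  \int[mu]_(y in I) (w (y, s) * \1_(`]- l, x]%classic : set R) y) -
  \int[mu]_(y in I) (w (y, t) * \1_(`]- l, x]%classic : set R) y).
  have h := cvgB (psi_cvg s) (psi_cvg t).
  by under eq_fun do rewrite -eqn; exact: h.
rewrite !gapE (_ : M * (x + l) - _ - _ =
  \int[mu]_(y in I) (w (y, s) * \1_(`]- l, x]%classic : set R) y) -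
  \int[mu]_(y in I) (w (y, t) * \1_(`]- l, x]%classic : set R) y))//.
by ring.
Qed.

Lemma bm_flux_integral s t (A : set R) : s <= t -> bm A (flux_integral s t).
Proof.
move=> st; split; first exact: measurable_flux_integral.
by exists (K * (t - s)) => y _; exact: flux_integral_norm.
Qed.

Lemma bm_dramp (A : set R) x r : 0 < r -> bm A (dramp x r).
Proof.
move=> r0; split; first exact: measurable_dramp.
by exists r^-1 => y _; exact: dramp_bound.
Qed.

(** Means of [flux_integral] inherit its bounds and pass them to the limit. The validity at every
    [x] is needed for the monotonicity of the product of the gaps at a fixed point. *)
Lemma left_gap_time s t x : T0 < s -> s < t -> t < Tm -> - l < x < l ->
  - (K * (t - s)) <= left_gap t x - left_gap s x <= 0.
Proof.
move=> s0 st tT xl; have /andP[lx xl'] := xl.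
have c := left_gap_cvg s0 st tT xl.
have bd n := bm_dramp I x (step_width_gt0 n xl').
have bP := bm_flux_integral I (ltW st).
have I1 n : \int[mu]_(y in I) dramp x (step_width x n) y = 1.
  apply: Rint_dramp; [exact: step_width_gt0|exact: ltW|].
  exact/ltW/step_width_lt.
apply/andP; split.
  apply: (ler_cvg_to (cvg_cst _) c); apply: nearW => n.
  rewrite -[leLHS]mulr1 -(I1 n) -(RintZ _ finI _ (bd n))//.
  apply: le_Rint => //; [exact: bmZ (bd n)|exact: (bmM (bd n) bP)|].
  move=> y _; rewrite mulrC ler_wpM2l//; first exact/dramp_ge0/step_width_gt0.
  by have /andP[] := flux_integral_itv y (ltW st).
apply: (ler_cvg_to c (cvg_cst _)); apply: nearW => n.
rewrite -[leRHS](mul0r (fine (mu I))) -Rint_cst//.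
apply: le_Rint => //; [exact: (bmM (bd n) bP)|exact: bm_cst|].
move=> y _; rewrite mulr_ge0_le0//; first exact/dramp_ge0/step_width_gt0.
by have /andP[] := flux_integral_itv y (ltW st).
Qed.

(** Almost everywhere the means over []x, x + r[] converge to the value at [x], by differentiation
    of the primitive; this identifies the limit in [left_gap_cvg]. *)
Lemma left_gap_time_ae s t : T0 < s -> s < t -> t < Tm ->
  {ae mu, forall x, - l < x < l ->
    left_gap t x - left_gap s x = flux_integral s t x}.
Proof.
move=> s0 st tT.
have mP := measurable_flux_integral s t.
have PK y : `|flux_integral s t y| <= K * (t - s).
  exact: flux_integral_norm (ltW st).
apply: ae_imp (primitive_derive (- l) mP PK) => x dP xl; have /andP[lx xl'] := xl.
have c := left_gap_cvg s0 st tT xl.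
have c2 := is_derive_quotient_seq (dP lx) (fun n => step_width_gt0 n xl') (step_width_cvg x).
apply: (cvg_unique _ c) => //; move: c2.
rewrite (_ : (fun n => _) = (fun n => \int[mu]_(y in I)
  (dramp x (step_width x n) y * flux_integral s t y)))//.
apply/funext => n; have r0 := step_width_gt0 n xl'; have rl := step_width_lt n xl'.
rewrite (primitiveB mP PK (ltW lx)) ?lerDl ?(ltW r0)//.
have iP : mu.-integrable `]x, (x + step_width x n)[ (EFin \o flux_integral s t).
  apply: bm_integrable => //; first exact: lebesgue_itv_lty.
  exact: bm_flux_integral (ltW st).
rewrite -Rintegral_itv_bndo_bndc//.
have sub : `]x, (x + step_width x n)[%classic `<=` I.
  by apply: subset_itv; rewrite bnd_simp ltW.
rewrite -(Rint_indic_mul _ sub) -RintZ//.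
  by apply: eq_Rint => y _; rewrite /dramp mulrA.
apply: bmM; last exact: bm_flux_integral (ltW st).
split; first exact: measurable_indic.
by exists 1 => y _; rewrite indicE; case: (_ \in _); rewrite ?normr0 ?normr1.
Qed.

End Gaps.

Lemma nonexpansive_continuous (R : realType) (h : R -> R) :
  (forall x y, `|h x - h y| <= `|x - y|) -> continuous h.
Proof.
by move=> hL; apply: (@lipschitz_continuous _ _ 1) => x y; rewrite mul1r.
Qed.

(** * The Lyapunov functional and its decay over a short time step *)

Section Lyapunov.
Context {R : realType}.
Local Notation mu := (@lebesgue_measure R).
Variables (l m M T0 Tm : R) (f : R -> R) (w : R * R -> R).
Variables (K L c k1 k2 eps : R).
Local Notation I := (`]- l, l[%classic : set R).
Local Notation F y := (f y - f M).

Definition two_entropy (y : R) : R := `|y - k1| + `|y - k2|.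
Definition two_flux (y : R) : R := kflux f k1 y + kflux f k2 y.
(** The minimum bounds from below the factors [M - k] and [k - m] of the dissipation inequalities at
    both levels; [k2 - k1] is the lower bound of [two_entropy]. *)
Definition dissipation_rate : R := c * Num.min (M - k2) (k1 - m) * (k2 - k1).

(** The clamped argument makes the gaps Lipschitz, hence measurable, on the whole line. *)
Definition lgap s x := left_gap l M w s (clamp (- l) l x).
Definition rgap s x := right_gap l m M w s (clamp (- l) l x).
Definition gap_product s x := lgap s x * rgap s x.
(** Concave on [z >= 0], bounded by 1 whatever [eps] is, and at least 1/2 as soon as [z >= eps]. *)
Definition saturate z : R := z / (eps + z).
Definition dsaturate z : R := eps / (eps + z) ^+ 2.
Definition gap_weight s x := saturate (gap_product s x).
Definition dgap_weight s x := dsaturate (gap_product s x) *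
  (rgap s x * (M - w (x, s)) + lgap s x * (m - w (x, s))).
Definition lyapunov s :=
  \int[mu]_(x in I) (gap_weight s x * two_entropy (w (x, s))).

Hypotheses (l0 : 0 < l) (mM : m < M) (c0 : 0 < c) (eps0 : 0 < eps).
Hypotheses (mk1 : m < k1) (k12 : k1 < k2) (k2M : k2 < M).
Hypothesis mw : measurable_fun setT w.
Hypothesis w_itv : forall p, m <= w p <= M.
Hypothesis cons : conserved l M T0 Tm f w.
Hypothesis cf : continuous f.
Hypothesis f_le : forall y, m <= y <= M -> F y <= 0.
Hypothesis f_ge : forall y, m <= y <= M -> - K <= F y.
Hypothesis L0 : 0 <= L.
Hypothesis f_lip : forall x y, m <= x <= M -> m <= y <= M ->
  `|f x - f y| <= L * `|x - y|.
Hypothesis ent : forall k, m <= k <= M -> entropic (- l) l Tm T0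
  (fun p => `|w p - k|) (fun p => kflux f k (w p)).
Hypothesis diss_l : forall k y, m <= k <= M -> m <= y <= M ->
  `|y - k| * F y + kflux f k y * (M - y) <= - c * (M - k) * (M - y) * `|y - k|.
Hypothesis diss_r : forall k y, m <= k <= M -> m <= y <= M ->
  `|y - k| * F y - kflux f k y * (y - m) <= - c * (k - m) * (y - m) * `|y - k|.

Lemma two_entropy_ge0 y : 0 <= two_entropy y.
Proof. by rewrite addr_ge0. Qed.

Lemma two_entropy_le y : m <= y <= M -> two_entropy y <= 2 * (M - m).
Proof.
have a1 := mk1; have a2 := k12; have a3 := k2M.
move=> /andP[my yM]; rewrite mulr_natl mulr2n lerD// ler_norml; apply/andP; split; lra.
Qed.

Lemma two_entropy_lip x y :
  `|two_entropy x - two_entropy y| <= 2 * `|x - y|.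
Proof.
have aux (k : R) : `| `|x - k| - `|y - k| | <= `|x - y|.
  apply: (le_trans (ler_dist_dist _ _)).
  by rewrite opprB addrA subrK.
rewrite /two_entropy opprD addrACA (le_trans (ler_normD _ _))//.
by rewrite mulr_natl mulr2n lerD.
Qed.

Lemma kflux_lip k x y : m <= k <= M -> m <= x <= M -> m <= y <= M ->
  `|kflux f k x - kflux f k y| <= 2 * L * `|x - y|.
Proof.
move=> kI xI yI; rewrite /kflux.
have mx z : m <= z <= M -> m <= Num.max z k <= M.
  by move=> zI; rewrite /Num.max; case: ifP.
have mn z : m <= z <= M -> m <= Num.min z k <= M.
  by move=> zI; rewrite /Num.min; case: ifP.
rewrite (_ : _ - _ - (_ - _) = (f (Num.max x k) - f (Num.max y k)) +
   (f (Num.min y k) - f (Num.min x k))); last by ring.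
rewrite (le_trans (ler_normD _ _))// -mulrA mulr_natl mulr2n lerD//.
  by apply: (le_trans (f_lip (mx _ xI) (mx _ yI))); rewrite ler_wpM2l// maxr_lip.
apply: (le_trans (f_lip (mn _ yI) (mn _ xI))); rewrite ler_wpM2l//.
by rewrite [leRHS]distrC minr_lip.
Qed.

Lemma kflux_norm k y : m <= k <= M -> m <= y <= M ->
  `|kflux f k y| <= 2 * L * (M - m).
Proof.
move=> kI yI; rewrite -[kflux f k y]subr0.
have kk : kflux f k k = 0 by rewrite /kflux maxxx minxx subrr.
rewrite -kk (le_trans (kflux_lip kI yI kI))// ler_wpM2l ?mulr_ge0//.
by case/andP : kI => ? ?; case/andP : yI => ? ?; rewrite ler_norml; apply/andP; split; lra.
Qed.

Let k1I : m <= k1 <= M. Proof. by rewrite (ltW mk1)/= (le_trans (ltW k12))// ltW. Qed.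
Let k2I : m <= k2 <= M. Proof. by rewrite (ltW k2M) andbT (le_trans (ltW mk1))// ltW. Qed.

Lemma two_flux_lip x y : m <= x <= M -> m <= y <= M ->
  `|two_flux x - two_flux y| <= 4 * L * `|x - y|.
Proof.
move=> xI yI; rewrite /two_flux opprD addrACA (le_trans (ler_normD _ _))//.
have := kflux_lip k1I xI yI; have := kflux_lip k2I xI yI; move=> h1 h2.
by have := lerD h1 h2; move=> h; lra.
Qed.

Lemma two_flux_norm y : m <= y <= M -> `|two_flux y| <= 4 * L * (M - m).
Proof.
move=> yI; rewrite /two_flux (le_trans (ler_normD _ _))//.
have := kflux_norm k1I yI; have := kflux_norm k2I yI; move=> h1 h2.
by have := lerD h1 h2; move=> h; lra.
Qed.

Lemma dissipation_rate_gt0 : 0 < dissipation_rate.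
Proof.
by rewrite mulr_gt0 ?subr_gt0// mulr_gt0// lt_min !subr_gt0 k2M mk1.
Qed.

Lemma two_entropy_ge y : k2 - k1 <= two_entropy y.
Proof.
rewrite /two_entropy; have := ler_norm (y - k1); have := ler_norm (k2 - y).
by rewrite distrC => *; lra.
Qed.

(** Here [A] and [B] stand for the left and right gaps. The left side is [B] times the left
    dissipation plus [A] times the right one, summed over both levels. With a single level [k] the
    gain would vanish at [y = k]. *)
Lemma two_dissipation (y A B : R) : m <= y <= M -> 0 <= A -> 0 <= B ->
  two_flux y * (B * (M - y) + A * (m - y)) + (A + B) * two_entropy y * F y
    <= - dissipation_rate * (B * (M - y) + A * (y - m)).
Proof.
move=> yI A0 B0; have /andP[my yM] := yI.
have hk := two_entropy_ge y; have c0' := c0.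
have n1 := normr_ge0 (y - k1); have n2 := normr_ge0 (y - k2).
pose mn := Num.min (M - k2) (k1 - m).
have mn1 : mn <= M - k2 by rewrite ge_min lexx.
have mn2 : mn <= k1 - m by rewrite ge_min lexx orbT.
have mn0 : 0 <= mn by rewrite le_min !subr_ge0 !ltW.
have k12' := ltW k12.
have hl : two_entropy y * F y + two_flux y * (M - y) <= - dissipation_rate * (M - y).
  have h1 := diss_l k1I yI; have h2 := diss_l k2I yI.
  have b1 : mn * `|y - k1| <= (M - k1) * `|y - k1| by rewrite ler_wpM2r//; lra.
  have b2 : mn * `|y - k2| <= (M - k2) * `|y - k2| by rewrite ler_wpM2r.
  have b3 : mn * (k2 - k1) <= (M - k1) * `|y - k1| + (M - k2) * `|y - k2|.
    apply: (le_trans _ (lerD b1 b2)); rewrite -mulrDr ler_wpM2l//.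
  have cy : 0 <= c * (M - y) by rewrite mulr_ge0 ?subr_ge0// ltW.
  have := ler_wpM2l cy b3; rewrite /dissipation_rate -/mn /two_entropy /two_flux.
  by move=> b4; lra.
have hr : two_entropy y * F y - two_flux y * (y - m) <= - dissipation_rate * (y - m).
  have h1 := diss_r k1I yI; have h2 := diss_r k2I yI.
  have b1 : mn * `|y - k1| <= (k1 - m) * `|y - k1| by rewrite ler_wpM2r.
  have b2 : mn * `|y - k2| <= (k2 - m) * `|y - k2| by rewrite ler_wpM2r//; lra.
  have b3 : mn * (k2 - k1) <= (k1 - m) * `|y - k1| + (k2 - m) * `|y - k2|.
    apply: (le_trans _ (lerD b1 b2)); rewrite -mulrDr ler_wpM2l//.
  have cy : 0 <= c * (y - m) by rewrite mulr_ge0 ?subr_ge0// ltW.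
  have := ler_wpM2l cy b3; rewrite /dissipation_rate -/mn /two_entropy /two_flux.
  by move=> b4; lra.
have := lerD (ler_wpM2l B0 hl) (ler_wpM2l A0 hr).
by move=> h; lra.
Qed.

Let ll : - l < l. Proof. by rewrite gtrN. Qed.
Let finI : (mu I < +oo)%E. Proof. exact: lebesgue_itv_lty. Qed.
Let cin x : - l <= clamp (- l) l x <= l. Proof. exact/clamp_itv/ltW. Qed.
Local Notation D := (M - m).
Local Notation C := (2 * l * (M - m)).

Lemma gap_lip_itv s x y : - l <= x <= l -> - l <= y <= l ->
  `|left_gap l M w s x - left_gap l M w s y| <= D * `|x - y| /\
  `|right_gap l m M w s x - right_gap l m M w s y| <= D * `|x - y|.
Proof.
wlog xy : x y / x <= y.
  move=> h xI yI; have [xy|/ltW yx] := leP x y; first exact: h.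
  have [h1 h2] := h _ _ yx yI xI.
  by rewrite distrC (distrC (right_gap _ _ _ _ _ x)) (distrC x).
move=> /andP[lx xl] /andP[ly yl].
rewrite distrC (distrC (right_gap _ _ _ _ _ x)) (distrC x).
rewrite [`|y - x|]ger0_norm ?subr_ge0//.
have /andP[h1 h2] := left_gap_mono mw w_itv s lx xy.
have /andP[h3 h4] := right_gap_mono mw w_itv s lx xy.
by rewrite ger0_norm// ler0_norm// lerNl.
Qed.

Lemma lgap_lip s x y : `|lgap s x - lgap s y| <= D * `|x - y|.
Proof.
apply: (le_trans (proj1 (gap_lip_itv s (cin x) (cin y)))).
by rewrite ler_wpM2l ?subr_ge0 ?(ltW mM)// clamp_lip.
Qed.

Lemma rgap_lip s x y : `|rgap s x - rgap s y| <= D * `|x - y|.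
Proof.
apply: (le_trans (proj2 (gap_lip_itv s (cin x) (cin y)))).
by rewrite ler_wpM2l ?subr_ge0 ?(ltW mM)// clamp_lip.
Qed.

Lemma lgap_itv s x : 0 <= lgap s x <= C.
Proof.
by apply/andP; split; [exact: left_gap_ge0|exact: left_gap_le (cin x)].
Qed.

Lemma rgap_itv s x : 0 <= rgap s x <= C.
Proof.
apply/andP; split; [exact: right_gap_ge0 (cin x)|exact: right_gap_le (cin x)].
Qed.

Lemma gap_product_ge0 s x : 0 <= gap_product s x.
Proof.
by have /andP[? _] := lgap_itv s x; have /andP[? _] := rgap_itv s x; exact: mulr_ge0.
Qed.

Lemma gap_product_lip s x y :
  `|gap_product s x - gap_product s y| <= 2 * C * D * `|x - y|.
Proof.
rewrite /gap_product (_ : _ - _ = lgap s x * (rgap s x - rgap s y) +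
  rgap s y * (lgap s x - lgap s y)); last by ring.
have /andP[a0 aC] := lgap_itv s x; have /andP[b0 bC] := rgap_itv s y.
rewrite (le_trans (ler_normD _ _))// !normrM (ger0_norm a0) (ger0_norm b0).
rewrite (_ : 2 * C * D * _ = C * (D * `|x - y|) + C * (D * `|x - y|)); last by ring.
by apply: lerD; apply: ler_pM => //; [exact: rgap_lip|exact: lgap_lip].
Qed.

Lemma saturate_lip (z z' : R) : 0 <= z -> 0 <= z' ->
  `|saturate z - saturate z'| <= eps^-1 * `|z - z'|.
Proof.
move=> z0 z'0; have e0 := eps0.
have ez : 0 < eps + z by lra.
have ez' : 0 < eps + z' by lra.
rewrite /saturate (_ : _ - _ = (eps / ((eps + z) * (eps + z'))) * (z - z')); last first.
  by field; rewrite !gt_eqF.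
rewrite normrM ler_wpM2r// ger0_norm; last first.
  by rewrite divr_ge0 ?mulr_ge0// ltW.
rewrite ler_pdivrMr ?mulr_gt0// mulrC ler_pdivlMr//.
have : 0 <= eps * z + eps * z' + z * z' by rewrite !addr_ge0// mulr_ge0// ltW.
by move=> ?; lra.
Qed.

Lemma saturate_itv (z : R) : 0 <= z -> 0 <= saturate z <= 1.
Proof.
move=> z0; have e0 := eps0; have ez : 0 < eps + z by lra.
apply/andP; split; first by rewrite divr_ge0// ltW.
by rewrite ler_pdivrMr// mul1r lerDr ltW.
Qed.

Lemma dsaturate_itv (z : R) : 0 <= z -> 0 <= dsaturate z <= eps^-1.
Proof.
move=> z0; have e0 := eps0; have ez : 0 < eps + z by lra.
apply/andP; split; first by rewrite divr_ge0 ?exprn_ge0// ltW.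
rewrite ler_pdivrMr ?exprn_gt0// mulrC ler_pdivlMr//.
have : 0 <= eps * z by rewrite mulr_ge0// ltW.
by have : 0 <= z * z by [exact: mulr_ge0|]; rewrite expr2; move=> ? ?; lra.
Qed.

Lemma saturate_derive (z : R) : 0 <= z -> is_derive z (1 : R) saturate (dsaturate z).
Proof.
move=> z0; have e0 := eps0; have ez : eps + z != 0 by rewrite gt_eqF//; lra.
have d1 : is_derive z (1 : R) (fun y : R => eps + y) (1 : R).
  have h := is_deriveD (is_derive_cst eps z (1 : R)) (is_derive_id z (1 : R)).
  exact: (is_derive_eq h (add0r _)).
have d2 := is_deriveV ez d1.
have d3 := is_deriveM (is_derive_id z (1 : R)) d2.
apply: (is_derive_eq d3); rewrite /dsaturate /GRing.scale/=.
by field.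
Qed.

(** Concavity: the tangent bounds the increment from above without any second-order error. *)
Lemma saturate_tangent (z z' : R) : 0 <= z -> 0 <= z' ->
  saturate z' - saturate z <= dsaturate z * (z' - z).
Proof.
move=> z0 z'0; have e0 := eps0.
have ez : 0 < eps + z by lra.
have ez' : 0 < eps + z' by lra.
rewrite -subr_ge0 (_ : _ - _ = eps * (z' - z) ^+ 2 / ((eps + z) ^+ 2 * (eps + z'))).
  by apply: divr_ge0; apply: mulr_ge0; rewrite ?sqr_ge0// ltW.
by rewrite /saturate /dsaturate; field; rewrite !gt_eqF.
Qed.

Lemma gap_weight_lip s x y :
  `|gap_weight s x - gap_weight s y| <= eps^-1 * (2 * C * D) * `|x - y|.
Proof.
rewrite (le_trans (saturate_lip (gap_product_ge0 _ _) (gap_product_ge0 _ _)))//.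
by rewrite -mulrA ler_wpM2l ?invr_ge0 ?(ltW eps0)// gap_product_lip.
Qed.

Lemma gap_weight_itv s x : 0 <= gap_weight s x <= 1.
Proof. exact/saturate_itv/gap_product_ge0. Qed.

Lemma dsaturate_gap_measurable s :
  measurable_fun setT (fun x => dsaturate (gap_product s x)).
Proof.
apply: continuous_measurable_fun => x.
have cz := lipschitz_continuous (gap_product_lip s).
have ce : eps + gap_product s z @[z --> x] --> eps + gap_product s x.
  by apply: cvgD; [exact: cvg_cst|exact: cz].
apply: cvgM; first exact: cvg_cst.
apply: cvgV; last by rewrite expr2; under eq_fun do rewrite expr2; exact: cvgM.
by rewrite expf_neq0// gt_eqF// ltr_pwDl// gap_product_ge0.
Qed.

Lemma bm_dsaturate s (A : set R) : bm A (fun x => dsaturate (gap_product s x)).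
Proof.
split; first exact: dsaturate_gap_measurable.
exists eps^-1 => x _; have /andP[? ?] := dsaturate_itv (gap_product_ge0 s x).
by rewrite ger0_norm.
Qed.

Lemma bm_lgap s (A : set R) : bm A (lgap s).
Proof.
split; first exact: lipschitz_measurable (lgap_lip s).
by exists C => x _; have /andP[? ?] := lgap_itv s x; rewrite ger0_norm.
Qed.

Lemma bm_rgap s (A : set R) : bm A (rgap s).
Proof.
split; first exact: lipschitz_measurable (rgap_lip s).
by exists C => x _; have /andP[? ?] := rgap_itv s x; rewrite ger0_norm.
Qed.

Lemma bm_gap_weight s (A : set R) : bm A (gap_weight s).
Proof.
split; first exact: lipschitz_measurable (gap_weight_lip s).
by exists 1 => x _; have /andP[? ?] := gap_weight_itv s x; rewrite ger0_norm.
Qed.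

Lemma bm_wT (h : R -> R) (H : R) : continuous h ->
  (forall y, m <= y <= M -> `|h y| <= H) -> bm setT (fun p => h (w p)).
Proof.
move=> ch hH; split; last by exists H => p _; exact: hH.
by apply: measurableT_comp => //; exact: continuous_measurable_fun.
Qed.

Lemma bm_slope (k s : R) (A : set R) : bm A (fun x => k - w (x, s)).
Proof.
apply: (@bmT_pair1 _ A (fun p => k - w p)); apply: (@bm_wT (fun y => k - y) (`|k| + (`|m| + `|M|))).
  by move=> y; apply: cvgB; [exact: cvg_cst|exact: cvg_id].
move=> y /andP[my yM]; rewrite (le_trans (ler_normB _ _))// lerD2l.
have := ler_norm M; have := ler_norm (- m); rewrite normrN.
by have := normr_ge0 M; have := normr_ge0 m; rewrite ler_norml => *; apply/andP; split; lra.
Qed.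

Lemma bm_dgap_weight s (A : set R) : bm A (dgap_weight s).
Proof.
apply: bmM; first exact: bm_dsaturate.
by apply: bmD; apply: bmM; [exact: bm_rgap|exact: bm_slope|exact: bm_lgap|exact: bm_slope].
Qed.

Lemma gap_weight_derive s : {ae mu, forall x, - l < x < l ->
  is_derive x (1 : R) (gap_weight s) (dgap_weight s x)}.
Proof.
apply: ae_imp2 (left_gap_derive l mw w_itv s) (right_gap_derive l mw w_itv s) => x h1 h2 xl.
have /andP[lx xl'] := xl.
have nearc : \forall z \near x, clamp (- l) l z = z.
  near=> z; have az : - l <= z by near: z; exact: lt_le_nbhsr.
  have zb : z <= l by near: z; exact: lt_le_nbhsl.
  by rewrite clamp_id// az.
have d1 : is_derive x (1 : R) (lgap s) (M - w (x, s)).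
  by apply: near_eq_is_derive (h1 xl); apply: filterS nearc => z; rewrite /lgap => ->.
have d2 : is_derive x (1 : R) (rgap s) (m - w (x, s)).
  by apply: near_eq_is_derive (h2 xl); apply: filterS nearc => z; rewrite /rgap => ->.
have d3 := is_deriveM d1 d2.
have d4 := is_derive1_comp (saturate_derive (gap_product_ge0 s x)) d3.
apply: (is_derive_eq d4); rewrite /dgap_weight /GRing.scale/=; ring.
Unshelve. all: by end_near. Qed.

Lemma gap_weight_profile s : profile (- l) l (gap_weight s) (dgap_weight s).
Proof.
split.
- by move=> x _; have /andP[] := gap_weight_itv s x.
- by exists (eps^-1 * (2 * C * D)) => x y _ _; exact: gap_weight_lip.
- exact: bm_gap_weight.
- exact: bm_dgap_weight.
- exact: gap_weight_derive.
Qed.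

Definition step_error : R := eps^-1 * (12 * L * C * D + 4 * C * K).

Lemma flux_norm y : m <= y <= M -> `|F y| <= K.
Proof.
by move=> yI; have h1 := f_le yI; have h2 := f_ge yI; rewrite ler0_norm//; lra.
Qed.

Lemma K_ge0 : 0 <= K.
Proof. exact: le_trans (normr_ge0 _) (flux_norm k1I). Qed.

Let D0 : 0 <= D. Proof. by rewrite subr_ge0 ltW. Qed.
Let C_ge0 : 0 <= C. Proof. by rewrite !mulr_ge0// ltW. Qed.

Lemma step_error_ge0 : 0 <= step_error.
Proof.
have h1 := K_ge0; have h2 := D0; have h3 := C_ge0.
rewrite mulr_ge0 ?invr_ge0 ?(ltW eps0)// addr_ge0// mulr_ge0// mulr_ge0//.
by rewrite mulr_ge0.
Qed.

(** To be read with [y0], [y1], [y2] the values of [w] at the times [s], [tau], [t]. The dissipation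
    inequality holds when all three agree, so everything is compared with [y0]. *)
Lemma pointwise_step (A B d y0 y1 y2 : R) : 0 <= A <= C -> 0 <= B <= C ->
  0 <= d <= eps^-1 -> m <= y0 <= M -> m <= y1 <= M -> m <= y2 <= M ->
  two_flux y1 * (d * (B * (M - y0) + A * (m - y0))) +
    d * (A + B) * two_entropy y2 * F y1
  <= - dissipation_rate * (d * (B * (M - y0) + A * (y0 - m))) +
     step_error * (`|y1 - y0| + `|y2 - y0|).
Proof.
move=> /andP[A0 AC] /andP[B0 BC] /andP[d0 de] y0I y1I y2I.
pose X := B * (M - y0) + A * (m - y0).
pose n1 := `|y1 - y0|; pose n2 := `|y2 - y0|.
have n10 : 0 <= n1 by exact: normr_ge0.
have n20 : 0 <= n2 by exact: normr_ge0.
have h1 := K_ge0; have h2 := D0; have h3 := C_ge0; have h4 := L0.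
have X_le : `|X| <= 2 * C * D.
  have /andP[my yM] := y0I.
  have b1 : B * (M - y0) <= C * D by apply: ler_pM => //; lra.
  have b2 : A * (y0 - m) <= C * D by apply: ler_pM => //; lra.
  have b3 : 0 <= B * (M - y0) by rewrite mulr_ge0// subr_ge0.
  have b4 : 0 <= A * (y0 - m) by rewrite mulr_ge0// subr_ge0.
  by rewrite ler_norml /X; apply/andP; split; lra.
have e1 : (two_flux y1 - two_flux y0) * X <= 4 * L * n1 * (2 * C * D).
  rewrite (le_trans (ler_norm _))// normrM; apply: ler_pM => //.
  exact: two_flux_lip.
have e2 : (two_entropy y2 - two_entropy y0) * F y1 <= 2 * n2 * K.
  rewrite (le_trans (ler_norm _))// normrM; apply: ler_pM => //.
    exact: two_entropy_lip.
  exact: flux_norm.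
have e3 : two_entropy y0 * (F y1 - F y0) <= 2 * D * (L * n1).
  rewrite (le_trans (ler_norm _))// normrM; apply: ler_pM => //.
    by rewrite ger0_norm ?two_entropy_ge0// two_entropy_le.
  by rewrite (_ : F y1 - F y0 = f y1 - f y0); [exact: f_lip|ring].
have e4 : (A + B) * ((two_entropy y2 - two_entropy y0) * F y1 +
    two_entropy y0 * (F y1 - F y0)) <= 2 * C * (2 * n2 * K + 2 * D * (L * n1)).
  apply: (@le_trans _ _ ((A + B) * (2 * n2 * K + 2 * D * (L * n1)))).
    by rewrite ler_wpM2l ?addr_ge0// lerD.
  apply: ler_wpM2r; last by lra.
  by rewrite addr_ge0// !mulr_ge0.
have e5 : two_flux y0 * X + (A + B) * two_entropy y0 * F y0
    <= - dissipation_rate * (B * (M - y0) + A * (y0 - m)).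
  exact: two_dissipation.
pose S := (12 * L * C * D + 4 * C * K) * (n1 + n2).
have S_ge : 4 * L * n1 * (2 * C * D) + 2 * C * (2 * n2 * K + 2 * D * (L * n1)) <= S.
  have q1 := mulr_ge0 (mulr_ge0 (mulr_ge0 h4 h3) h2) n20.
  have q2 := mulr_ge0 (mulr_ge0 h3 h1) n10.
  by rewrite /S; move: q1 q2; generalize C => C'; move=> q1 q2; lra.
have S0 : 0 <= S.
  have q1 := mulr_ge0 (mulr_ge0 h4 h3) h2; have q2 := mulr_ge0 h3 h1.
  by apply: mulr_ge0; rewrite ?addr_ge0//; lra.
have e6 : two_flux y1 * X + (A + B) * two_entropy y2 * F y1 <=
    - dissipation_rate * (B * (M - y0) + A * (y0 - m)) + S.
  rewrite (_ : _ + _ = (two_flux y0 * X + (A + B) * two_entropy y0 * F y0) +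
    ((two_flux y1 - two_flux y0) * X + (A + B) *
     ((two_entropy y2 - two_entropy y0) * F y1 + two_entropy y0 * (F y1 - F y0)))).
    exact: (lerD e5 (le_trans (lerD e1 e4) S_ge)).
  by ring.
have e7 := ler_wpM2l d0 e6.
have e8 := ler_wpM2r S0 de.
rewrite -/X -/n1 -/n2 (_ : step_error * (n1 + n2) = eps^-1 * S); last first.
  by rewrite /step_error /S -[LHS]mulrA.
have -> : two_flux y1 * (d * X) + d * (A + B) * two_entropy y2 * F y1 =
  d * (two_flux y1 * X + (A + B) * two_entropy y2 * F y1) by ring.
apply: (le_trans e7); rewrite mulrDr; apply: lerD => //.
by rewrite mulrCA.
Qed.

Lemma bm_two_entropy : bm setT (fun p => two_entropy (w p)).
Proof.
apply: (@bm_wT _ (2 * D)) => [|y yI].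
  by apply: lipschitz_continuous; exact: two_entropy_lip.
by rewrite ger0_norm ?two_entropy_ge0// two_entropy_le.
Qed.

Lemma kflux_continuous k : continuous (kflux f k).
Proof.
move=> y; apply: cvgB.
  apply: (@cvg_comp _ _ _ (fun y => Num.max y k) f _ (nbhs (Num.max y k))); last exact: cf.
  by apply: (@nonexpansive_continuous _ (fun y => Num.max y k)) => a b; exact: maxr_lip.
apply: (@cvg_comp _ _ _ (fun y => Num.min y k) f _ (nbhs (Num.min y k))); last exact: cf.
by apply: (@nonexpansive_continuous _ (fun y => Num.min y k)) => a b; exact: minr_lip.
Qed.

Lemma bm_kflux k : m <= k <= M -> bm setT (fun p => kflux f k (w p)).
Proof.
move=> kI; apply: (@bm_wT _ (2 * L * D)); first exact: kflux_continuous.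
by move=> y yI; exact: kflux_norm.
Qed.

Lemma bm_two_flux : bm setT (fun p => two_flux (w p)).
Proof. exact: (bmD (bm_kflux k1I) (bm_kflux k2I)). Qed.

Lemma bm_dist (k : R) : m <= k <= M -> bm setT (fun p => `|w p - k|).
Proof.
move=> kI; apply: (@bm_wT (fun y => `|y - k|) D) => [|y yI].
  apply: nonexpansive_continuous => x y.
  apply: (le_trans (ler_dist_dist _ _)).
  by rewrite opprB addrA subrK.
by move: kI yI => /andP[? ?] /andP[? ?]; rewrite normr_id ler_norml; apply/andP; split; lra.
Qed.

Lemma entropic_two : entropic (- l) l Tm T0
  (fun p => two_entropy (w p)) (fun p => two_flux (w p)).
Proof.
by apply: entropicD; [exact: bm_dist k1I|exact: bm_kflux k1I|exact: bm_dist k2I|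
  exact: bm_kflux k2I|exact: ent k1I|exact: ent k2I].
Qed.

Lemma gap_weight_left s : gap_weight s (- l) = 0.
Proof.
rewrite /gap_weight /gap_product /lgap clamp_id ?lexx ?(ltW ll)//.
by rewrite left_gap_left mul0r /saturate mul0r.
Qed.

Lemma gap_weight_right s : gap_weight s l = 0.
Proof.
rewrite /gap_weight /gap_product /rgap clamp_id ?lexx ?(ltW ll)//.
by rewrite right_gap_right mulr0 /saturate mul0r.
Qed.

(* The weight vanishes linearly at both ends. *)
Lemma outflow_gap_weight s t :
  outflow (- l) l (fun p => two_flux (w p)) (gap_weight s) t.
Proof.
pose N := 4 * L * D * (eps^-1 * (2 * C * D)).
have N0 : 0 <= N.
  have h1 := D0; have h2 := C_ge0.
  by rewrite /N !mulr_ge0// ?invr_ge0 ?ltW.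
have N1 : 0 < N + 1 by rewrite ltr_wpDl.
have aux (x z : R) : gap_weight s z = 0 ->
    `|two_flux (w (x, t)) * gap_weight s x| <= N * `|x - z|.
  move=> gz; rewrite normrM /N -mulrA; apply: ler_pM => //.
    exact: two_flux_norm.
  by rewrite -[gap_weight s x]subr0 -gz gap_weight_lip.
have near0 (e x z : R) : 0 < e -> gap_weight s z = 0 -> `|x - z| <= e / (N + 1) ->
    `|two_flux (w (x, t)) * gap_weight s x| <= e.
  move=> e0 gz xz; apply: (le_trans (aux x z gz)).
  apply: (@le_trans _ _ (N * (e / (N + 1)))); first by rewrite ler_wpM2l.
  rewrite mulrA ler_pdivrMr// mulrC ler_wpM2l// ?(ltW e0)//.
  by rewrite lerDl.
split=> e e0; exists (e / (N + 1)); rewrite ?divr_gt0//; apply: aeW => x.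
  case/andP => lx xe; have := @near0 e x (- l) e0 (gap_weight_left s).
  rewrite ger0_norm; last by rewrite subr_ge0 ltW.
  have xd : x - - l <= e / (N + 1) by lra.
  by move=> /(_ xd); apply: le_trans; exact: ler_norm.
case/andP => ex xl; have := @near0 e x l e0 (gap_weight_right s).
rewrite ler0_norm; last by rewrite subr_le0 ltW.
have xd : - (x - l) <= e / (N + 1) by lra.
by move=> /(_ xd); rewrite ler_norml => /andP[].
Qed.

(** Both gaps change by the same amount [h], and [(a + h) (b + h) - a b = (a + b) h + h ^+ 2]. *)
Lemma gap_product_time s t x : T0 < s -> s < t -> t < Tm -> - l < x < l ->
  gap_product t x - gap_product s x =
  (lgap s x + rgap s x) * (left_gap l M w t x - left_gap l M w s x) +
  (left_gap l M w t x - left_gap l M w s x) ^+ 2.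
Proof.
move=> s0 st tT xl; have xl' : - l <= x <= l by case/andP : xl => ? ?; rewrite !ltW.
have h := right_gapB l0 mw w_itv cons x s0 st tT.
rewrite /gap_product /lgap /rgap clamp_id//.
have -> : right_gap l m M w t x = right_gap l m M w s x +
    (left_gap l M w t x - left_gap l M w s x) by rewrite -h; ring.
by ring.
Qed.

(** Cost of the square of the gap increment: the slope of [saturate] is at most [eps^-1], the
    increment at most [K (t - s)], the entropy at most [2 D], and the interval has length [2 l]. *)
Definition time_error : R := eps^-1 * K ^+ 2 * (2 * D) * (2 * l).

(** The tangent bound is applied to [gap_product_time], where the common increment of the gaps is
    almost everywhere the time integral of the flux. *)
Lemma gap_weight_time s t : T0 < s -> s < t -> t < Tm ->
  \int[mu]_(x in I) ((gap_weight t x - gap_weight s x) * two_entropy (w (x, t)))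
  <= \int[mu]_(x in I) (dsaturate (gap_product s x) * (lgap s x + rgap s x) *
       two_entropy (w (x, t)) * flux_integral M f w s t x)
     + time_error * (t - s) ^+ 2.
Proof.
move=> s0 st tT.
pose H : R := eps^-1 * K ^+ 2 * (2 * D) * (t - s) ^+ 2.
have bE : bm I (fun x => two_entropy (w (x, t))) by exact: bmT_pair1 bm_two_entropy.
have bF : bm I (flux_integral M f w s t).
  exact: (bm_flux_integral mw w_itv cf f_le f_ge _ (ltW st)).
have bR : bm I (fun x => dsaturate (gap_product s x) * (lgap s x + rgap s x) *
    two_entropy (w (x, t))).
  apply: bmM => //; apply: bmM; first exact: bm_dsaturate.
  by apply: bmD; [exact: bm_lgap|exact: bm_rgap].
have -> : time_error * (t - s) ^+ 2 = \int[mu]_(x in I) H.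
  rewrite Rint_cst// fine_lebesgue_itv ?(ltW ll)// /time_error /H.
  by rewrite (_ : l - - l = 2 * l); ring.
rewrite -(RintD _ finI (bmM bR bF) (bm_cst _ _))//.
apply: le_Rint_ae => //.
- by apply: bmM => //; apply: bmB; exact: bm_gap_weight.
- by apply: bmD; [exact: bmM|exact: bm_cst].
apply: ae_imp (left_gap_time_ae mw w_itv cons cf f_le f_ge s0 st tT) => x.
rewrite /= in_itv/= => Dx xl; have {}Dx := Dx xl.
have e0 := two_entropy_ge0 (w (x, t)).
have eD := two_entropy_le (w_itv (x, t)).
have z0 := gap_product_ge0 s x; have z1 := gap_product_ge0 t x.
have tg := saturate_tangent z0 z1.
rewrite (gap_product_time s0 st tT xl) Dx in tg.
set Phi := flux_integral _ _ _ _ _ _ in tg *.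
have /andP[d0 de] := dsaturate_itv z0.
have PK : Phi ^+ 2 <= (K * (t - s)) ^+ 2.
  rewrite -[leLHS]real_normK ?num_real// ler_sqr ?nnegrE//.
    exact: (flux_integral_norm mw w_itv cf f_le f_ge _ (ltW st)).
  by rewrite mulr_ge0 ?K_ge0// subr_ge0 ltW.
have h1 := ler_wpM2r e0 tg.
apply: (le_trans h1).
rewrite [leLHS](_ : _ = dsaturate (gap_product s x) * (lgap s x + rgap s x) *
  two_entropy (w (x, t)) * Phi +
  dsaturate (gap_product s x) * Phi ^+ 2 * two_entropy (w (x, t))); last by ring.
rewrite lerD2l.
rewrite /H (_ : eps^-1 * K ^+ 2 * (2 * D) * (t - s) ^+ 2 =
  eps^-1 * (K * (t - s)) ^+ 2 * (2 * D)); last by ring.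
apply: ler_pM => //; first by rewrite mulr_ge0 ?sqr_ge0.
by apply: ler_pM => //; rewrite ?sqr_ge0.
Qed.

(** The entropy inequality with the weight frozen at time [s]; the weight vanishes at both ends, so
    [outflow] holds at every time. *)
Lemma lyapunov_space s t : T0 < s -> s < t -> t < Tm ->
  \int[mu]_(x in I) (gap_weight s x * (two_entropy (w (x, t)) - two_entropy (w (x, s))))
  <= \int[mu]_(tau in `]s, t[) \int[mu]_(x in I)
        (two_flux (w (x, tau)) * dgap_weight s x).
Proof.
move=> s0 st tT.
have bE tau : bm I (fun x => two_entropy (w (x, tau))) by exact: bmT_pair1 bm_two_entropy.
have bG := bm_gap_weight s I.
have out : {ae mu, forall t, T0 < t < Tm ->
    outflow (- l) l (fun p => two_flux (w p)) (gap_weight s) t}.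
  by apply: aeW => tau _; exact: outflow_gap_weight.
have := entropic_boundary ll bm_two_entropy bm_two_flux entropic_two
  (gap_weight_profile s) out s0 st tT.
rewrite -(RintB _ finI (bmM (bE t) bG) (bmM (bE s) bG))//.
apply: le_trans; rewrite le_eqVlt; apply/orP; left; apply/eqP.
by apply: eq_Rint => x _; ring.
Qed.

(** Changing [m - w] into [w - m] only increases the derivative of the weight and makes the
    integrand nonnegative, so the integral may be cut at [y], where the fundamental theorem
    applies. *)
Lemma dissipation_integral s y : - l < y < l ->
  \int[mu]_(x in I) (dsaturate (gap_product s x) *
     (rgap s x * (M - w (x, s)) + lgap s x * (w (x, s) - m))) >= gap_weight s y.
Proof.
move=> /andP[ly yl].
have sub : `]- l, y[%classic `<=` I by apply: subset_itvl; rewrite bnd_simp ltW.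
have E : \int[mu]_(x in `]- l, y[) dgap_weight s x = gap_weight s y.
  have [_ [B dB]] := bm_dgap_weight s `]- l, y[.
  rewrite (@lipschitz_FTC _ (- l) y (gap_weight s) (dgap_weight s)
    (eps^-1 * (2 * C * D)) B)//.
  - by rewrite gap_weight_left subr0.
  - by move=> a b _ _; exact: gap_weight_lip.
  - by have [] := bm_dgap_weight s I.
  - apply: ae_imp (gap_weight_derive s) => x h /andP[lx xy].
    by apply: h; rewrite lx (lt_trans xy).
rewrite -E -(Rint_indic_mul _ sub).
have bi : bm I (\1_(`]- l, y[%classic : set R) : R -> R).
  split; first exact: measurable_indic.
  by exists 1 => x _; rewrite indicE; case: (_ \in _); rewrite ?normr0 ?normr1.
have bs : bm I (fun x => w (x, s) - m).
  have -> : (fun x => w (x, s) - m) = (fun x => - (m - w (x, s))).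
    by apply/funext => x; rewrite opprB.
  exact: (bmN (bm_slope m s I)).
apply: le_Rint => //.
- by apply: bmM => //; exact: bm_dgap_weight.
- apply: bmM; first exact: bm_dsaturate.
  by apply: bmD; apply: bmM => //; [exact: bm_rgap|exact: bm_slope|exact: bm_lgap].
move=> x _; have /andP[d0 _] := dsaturate_itv (gap_product_ge0 s x).
have /andP[mw0 wM0] := w_itv (x, s).
have /andP[a0 _] := lgap_itv s x; have /andP[b0 _] := rgap_itv s x.
have q1 : 0 <= rgap s x * (M - w (x, s)) by rewrite mulr_ge0// subr_ge0.
have q2 : 0 <= lgap s x * (w (x, s) - m) by rewrite mulr_ge0// subr_ge0.
rewrite indicE; case: (x \in _); last by rewrite mul0r mulr_ge0// addr_ge0.
by rewrite mul1r /dgap_weight ler_wpM2l//; lra.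
Qed.

(** Discrete product rule: first the weight varies against the entropy at time [t], then the entropy
    varies under the weight at time [s]. The error per unit of time is small once [om], the
    oscillation in L^1, and [t - s] are small. *)
Lemma lyapunov_step s t (om y : R) : T0 < s -> s < t -> t < Tm ->
  (forall tau, s <= tau <= t -> \int[mu]_(x in I) `|w (x, tau) - w (x, s)| <= om) ->
  - l < y < l ->
  lyapunov t - lyapunov s <= (t - s) * (- dissipation_rate * gap_weight s y +
    step_error * (om + om) + time_error * (t - s)).
Proof.
move=> s0 st tT hom yl.
have finst : (mu (`]s, t[ : set R) < +oo)%E by exact: lebesgue_itv_lty.
have bE tau : bm I (fun x => two_entropy (w (x, tau))) by exact: bmT_pair1 bm_two_entropy.
have bG tau := bm_gap_weight tau I.
have bQ tau : bm I (fun x => two_flux (w (x, tau))) by exact: bmT_pair1 bm_two_flux.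
have bF := bm_flux mw w_itv cf f_le f_ge.
have bdG := bm_dgap_weight s I.
pose rho x := dsaturate (gap_product s x) * (lgap s x + rgap s x) *
    two_entropy (w (x, t)).
have brho : bm I rho.
  apply: bmM => //; apply: bmM; first exact: bm_dsaturate.
  by apply: bmD; [exact: bm_lgap|exact: bm_rgap].
have split : lyapunov t - lyapunov s =
  \int[mu]_(x in I) ((gap_weight t x - gap_weight s x) * two_entropy (w (x, t))) +
  \int[mu]_(x in I) (gap_weight s x * (two_entropy (w (x, t)) - two_entropy (w (x, s)))).
  rewrite /lyapunov -(RintB _ finI (bmM (bG t) (bE t)) (bmM (bG s) (bE s)))//.
  rewrite -(RintD _ finI (bmM (bmB (bG t) (bG s)) (bE t)) (bmM (bG s) (bmB (bE t) (bE s))))//.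
  by apply: eq_Rint => x _; ring.
(* Fubini puts the variation of the weight under the same integral in [tau] as the entropy flux;
   only their sum has a sign. *)
have swap : \int[mu]_(x in I) (rho x * flux_integral M f w s t x) =
    \int[mu]_(tau in `]s, t[) \int[mu]_(x in I) (rho x * F (w (x, tau))).
  have bRF : bm (I `*` `]s, t[) (fun p => rho p.1 * F (w p)).
    by apply: bmM; [exact: bmT_fst|exact: bmS bF].
  transitivity (\int[mu]_(x in I) \int[mu]_(tau in `]s, t[) (rho x * F (w (x, tau)))).
    apply: eq_Rint => x _; have bFx : bm `]s, t[ (fun tau => F (w (x, tau))).
      exact: bmT_pair2 bF.
    by rewrite (RintZ _ finst _ bFx).
  by apply/esym; exact: (Rint_swap _ _ finI finst bRF).
have h1 := gap_weight_time s0 st tT.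
have h2 := lyapunov_space s0 st tT.
rewrite -/rho in h1.
have h1' : \int[mu]_(x in I) ((gap_weight t x - gap_weight s x) * two_entropy (w (x, t)))
  <= \int[mu]_(tau in `]s, t[) \int[mu]_(x in I) (rho x * F (w (x, tau)))
     + time_error * (t - s) ^+ 2 by rewrite -swap.
rewrite split; apply: (le_trans (lerD h1' h2)).
have bFt tau : bm I (fun x => F (w (x, tau))) by exact: bmT_pair1 bF.
have bA : bm `]s, t[ (fun tau => \int[mu]_(x in I) (rho x * F (w (x, tau)))).
  apply: (@bm_Rint_fst _ I `]s, t[ (fun p => rho p.1 * F (w p))) => //.
  by apply: bmM; [exact: bmT_fst|exact: bmS bF].
have bB : bm `]s, t[ (fun tau => \int[mu]_(x in I) (two_flux (w (x, tau)) * dgap_weight s x)).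
  apply: (@bm_Rint_fst _ I `]s, t[ (fun p => two_flux (w p) * dgap_weight s p.1)) => //.
  by apply: bmM; [exact: bmS bm_two_flux|exact: bmT_fst].
rewrite addrAC -(RintD _ finst bA bB)//.
pose V : R := - dissipation_rate * gap_weight s y + step_error * (om + om).
have -> : (t - s) * (- dissipation_rate * gap_weight s y + step_error * (om + om) +
    time_error * (t - s)) = \int[mu]_(tau in `]s, t[) V + time_error * (t - s) ^+ 2.
  by rewrite Rint_cst// fine_lebesgue_itv ?(ltW st)// /V; ring.
rewrite lerD2r; apply: le_Rint => //; [exact: (bmD bA bB)|exact: bm_cst|].
move=> tau; rewrite /= in_itv/= => /andP[stau taut].
rewrite -(RintD _ finI (bmM brho (bFt tau)) (bmM (bQ tau) bdG))//.
have bd tau' : bm I (fun x => `|w (x, tau') - w (x, s)|).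
  have -> : (fun x => `|w (x, tau') - w (x, s)|) =
      (fun x => `|(0 - w (x, s)) - (0 - w (x, tau'))|).
    by apply/funext => x; congr `| _ |; ring.
  exact: (bm_norm (bmB (bm_slope 0 s I) (bm_slope 0 tau' I))).
have bs : bm I (fun x => w (x, s) - m).
  have -> : (fun x => w (x, s) - m) = (fun x => - (m - w (x, s))).
    by apply/funext => x; rewrite opprB.
  exact: (bmN (bm_slope m s I)).
pose dis x := dsaturate (gap_product s x) *
     (rgap s x * (M - w (x, s)) + lgap s x * (w (x, s) - m)).
have bdis : bm I dis.
  apply: bmM; first exact: bm_dsaturate.
  by apply: bmD; apply: bmM => //; [exact: bm_rgap|exact: bm_slope|exact: bm_lgap].
apply: (@le_trans _ _ (\int[mu]_(x in I) (- dissipation_rate * dis x +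
    step_error * (`|w (x, tau) - w (x, s)| + `|w (x, t) - w (x, s)|)))).
  apply: le_Rint => //.
  - exact: (bmD (bmM brho (bFt tau)) (bmM (bQ tau) bdG)).
  - exact: (bmD (bmZ _ bdis) (bmZ _ (bmD (bd tau) (bd t)))).
  move=> x _; have := pointwise_step (lgap_itv s x) (rgap_itv s x)
    (dsaturate_itv (gap_product_ge0 s x)) (w_itv (x, s)) (w_itv (x, tau)) (w_itv (x, t)).
  by rewrite addrC.
rewrite (RintD _ finI (bmZ _ bdis) (bmZ _ (bmD (bd tau) (bd t))))//.
rewrite (RintZ _ finI _ bdis)// (RintZ _ finI _ (bmD (bd tau) (bd t)))//.
rewrite (RintD _ finI (bd tau) (bd t))//; apply: lerD.
  rewrite !mulNr lerN2 ler_wpM2l ?(ltW dissipation_rate_gt0)//.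
  exact: dissipation_integral.
rewrite ler_wpM2l ?step_error_ge0//; apply: lerD; apply: hom.
  by rewrite !ltW.
by rewrite (ltW st) lexx.
Qed.

End Lyapunov.

Section ForwardDecrease.
Context {R : realType}.

(* No continuity of [J] is needed: an upward jump of [J] at the supremum is
   excluded by the one-sided Lipschitz bound. *)
Lemma forward_decrease (J : R -> R) (T1 T C lam : R) : T1 <= T ->
  (forall s t, T1 <= s -> s < t -> t <= T -> J t <= J s + C * (t - s)) ->
  (forall s, T1 <= s -> s < T -> exists2 d : R, 0 < d &
    forall t, s < t -> t < s + d -> t <= T -> J t <= J s - lam * (t - s)) ->
  J T <= J T1 - lam * (T - T1).
Proof.
move=> T1T lipJ decJ.
pose S := [set t | T1 <= t <= T /\ J t <= J T1 - lam * (t - T1)].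
have S1 : S T1 by split; rewrite ?lexx ?T1T// subrr mulr0 subr0.
have supS : has_sup S.
  by split; [exists T1|exists T => t [/andP[]]].
pose ts := sup S.
have t1 : T1 <= ts by apply: sup_upper_bound.
have t2 : ts <= T by apply: sup_le_ub => [|t [/andP[]]//]; exists T1.
have Jts : J ts <= J T1 - lam * (ts - T1).
  apply/ler_addgt0Pr => e e0.
  pose N := `|C + lam| + 1; have N0 : 0 < N by rewrite ltr_wpDl.
  have eN : 0 < e / N by rewrite divr_gt0.
  have [t [/andP[h1 h2] h3] h4] := sup_adherent eN supS.
  have tts : t <= ts by apply: sup_upper_bound => //; split => //; rewrite h1.
  move: tts; rewrite le_eqVlt => /predU1P[<-|tts].
    by rewrite (le_trans h3)// lerDl ltW.
  have := lipJ _ _ h1 tts t2 => h5.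
  have h6 : (C + lam) * (ts - t) <= e.
    apply: (@le_trans _ _ (N * (e / N))); last by rewrite mulrC divfK// gt_eqF.
    apply: (@le_trans _ _ (N * (ts - t))).
      apply: ler_wpM2r; first by rewrite subr_ge0 ltW.
      by rewrite (le_trans (ler_norm _))// lerDl.
    by rewrite ler_wpM2l ?(ltW N0)// lerBlDr addrC -lerBlDr ltW// -/ts.
  by lra.
move: t2; rewrite le_eqVlt => /predU1P[<-//|tT].
have [d d0 dJ] := decJ ts t1 tT.
pose t := Num.min (ts + d / 2) T.
have tst : ts < t by rewrite lt_min tT andbT ltrDl divr_gt0.
have td : t < ts + d by rewrite gt_min; apply/orP; left; lra.
have tT' : t <= T by rewrite ge_min lexx orbT.
have St : S t.
  split; first by rewrite tT' andbT (le_trans t1)// ltW.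
  by have := dJ _ tst td tT'; lra.
have : t <= ts by apply: sup_upper_bound.
by rewrite leNgt tst.
Qed.

Lemma is_derive_unique (g : R -> R) (x a b : R) :
  is_derive x (1 : R) g a -> is_derive x (1 : R) g b -> a = b.
Proof. by move=> [_ <-] [_ <-]. Qed.

End ForwardDecrease.

(** * Extinction in finite time and the step profile *)

Section Conclusion.
Context {R : realType}.
Local Notation mu := (@lebesgue_measure R).
Variables (l m M T0 Tm : R) (f : R -> R) (w : R * R -> R).
Variables (K L c k1 k2 : R).
Local Notation I := (`]- l, l[%classic : set R).
Local Notation F y := (f y - f M).
Local Notation D := (M - m).
Local Notation rate := (dissipation_rate m M c k1 k2).

Hypotheses (l0 : 0 < l) (mM : m < M) (c0 : 0 < c).
Hypotheses (mk1 : m < k1) (k12 : k1 < k2) (k2M : k2 < M).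
Hypothesis mw : measurable_fun setT w.
Hypothesis w_itv : forall p, m <= w p <= M.
Hypothesis cons : conserved l M T0 Tm f w.
Hypothesis cf : continuous f.
Hypothesis f_le : forall y, m <= y <= M -> F y <= 0.
Hypothesis f_ge : forall y, m <= y <= M -> - K <= F y.
Hypothesis L0 : 0 <= L.
Hypothesis f_lip : forall x y, m <= x <= M -> m <= y <= M ->
  `|f x - f y| <= L * `|x - y|.
Hypothesis ent : forall k, m <= k <= M -> entropic (- l) l Tm T0
  (fun p => `|w p - k|) (fun p => kflux f k (w p)).
Hypothesis diss_l : forall k y, m <= k <= M -> m <= y <= M ->
  `|y - k| * F y + kflux f k y * (M - y) <= - c * (M - k) * (M - y) * `|y - k|.
Hypothesis diss_r : forall k y, m <= k <= M -> m <= y <= M ->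
  `|y - k| * F y - kflux f k y * (y - m) <= - c * (k - m) * (y - m) * `|y - k|.
Hypothesis cw : forall t, T0 < t < Tm -> forall e : R, 0 < e ->
  exists2 d : R, 0 < d & forall s, T0 < s < Tm -> `|s - t| < d ->
    \int[mu]_(x in I) `|w (x, s) - w (x, t)| < e.

Let finI : (mu I < +oo)%E. Proof. exact: lebesgue_itv_lty. Qed.
Let ll : - l < l. Proof. by rewrite gtrN. Qed.

Lemma gap_product_noninc s t y : T0 < s -> s < t -> t < Tm -> - l < y < l ->
  gap_product l m M w t y <= gap_product l m M w s y.
Proof.
move=> s0 st tT yl; have yl' : - l <= y <= l by case/andP : yl => ? ?; rewrite !ltW.
have /andP[_ h1] := left_gap_time mw w_itv cons cf f_le f_ge s0 st tT yl.
have h2 := right_gapB l0 mw w_itv cons y s0 st tT.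
rewrite /gap_product /lgap /rgap clamp_id//.
apply: ler_pM.
- exact: left_gap_ge0.
- exact: right_gap_ge0.
- by rewrite -subr_le0.
- by rewrite -subr_le0 h2.
Qed.

(** Origin of the constant: [J T1 <= 4 l D] and [J] decreases at the rate [rate / 4] as long as the
    weight at [y] is at least 1/2, so it would be negative after a time longer than
    [16 l D / rate]. *)
Lemma gap_product_extinct (T1 T y : R) : T0 < T1 -> T < Tm ->
  T1 + 16 * l * D / rate < T -> - l < y < l -> gap_product l m M w T y = 0.
Proof.
move=> T01 TTm T1T yl.
have rate0 : 0 < rate by exact: dissipation_rate_gt0 c0 mk1 k12 k2M.
have D0 : 0 <= D by rewrite subr_ge0 ltW.
have l0' := l0.
have z0 : 0 <= gap_product l m M w T y by exact: gap_product_ge0 l0 mM mw w_itv T y.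
apply/eqP/contraT; rewrite neq_lt ltNge z0 /= => eps0.
set eps := gap_product l m M w T y in eps0.
have TT : T1 < T.
  apply: le_lt_trans T1T; rewrite lerDl; apply: divr_ge0; last exact: ltW.
  by apply: mulr_ge0 => //; apply: mulr_ge0 => //; exact: ltW.
have half s : T1 <= s <= T -> 1 / 2 <= gap_weight l m M w eps s y.
  move=> /andP[T1s sT].
  have zs : eps <= gap_product l m M w s y.
    move: sT; rewrite le_eqVlt => /predU1P[->//|sT].
    by apply: gap_product_noninc => //; exact: lt_le_trans T1s.
  by rewrite /gap_weight /saturate ler_pdivlMr; lra.
pose J := lyapunov l m M w k1 k2 eps.
pose se := step_error l m M K L eps; pose te := time_error l m M K eps.
have se0 : 0 <= se by exact: step_error_ge0 l0 mM eps0 mk1 k12 k2M f_le f_ge L0.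
have te0 : 0 <= te.
  have K0 : 0 <= K.
    have mI : m <= m <= M by rewrite lexx ltW.
    by have := f_le mI; have := f_ge mI; move=> *; lra.
  have D2 : 0 <= 2 * D by rewrite mulr_ge0.
  have l2 : 0 <= 2 * l by rewrite mulr_ge0// ltW.
  rewrite /te /time_error; apply: mulr_ge0 => //; apply: mulr_ge0 => //.
  by rewrite mulr_ge0 ?exprn_ge0// invr_ge0 ltW.
have bw t : bm I (fun x => w (x, t)) by exact: (bm_w l mw w_itv t).
have bd s t : bm I (fun x => `|w (x, s) - w (x, t)|) by exact: (bm_norm (bmB (bw s) (bw t))).
have step s t om : T1 <= s -> s < t -> t <= T ->
    (forall tau, s <= tau <= t -> \int[mu]_(x in I) `|w (x, tau) - w (x, s)| <= om) ->
    J t - J s <= (t - s) * (- rate * gap_weight l m M w eps s y + se * (om + om) + te * (t - s)).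
  move=> T1s st tT hom; apply: (lyapunov_step l0 mM c0 eps0 mk1 k12 k2M mw w_itv cons cf f_le f_ge L0
    f_lip ent diss_l diss_r) => //.
  - exact: lt_le_trans T1s.
  - exact: le_lt_trans TTm.
have Jdec : J T <= J T1 - rate / 4 * (T - T1).
  apply: (@forward_decrease _ J T1 T (se * (2 * l * D + 2 * l * D) + te * (T - T1))).
  - exact: ltW.
  (* One-sided Lipschitz bound: the oscillation is bounded crudely by [2 l D] and the dissipation is
     dropped. *)
  - move=> s t T1s st tT; rewrite -lerBlDl.
    apply: (le_trans (step s t (2 * l * D) T1s st tT _)).
      move=> tau _; apply: (@le_trans _ _ (\int[mu]_(x in I) D)).
        apply: le_Rint => //; [exact: bd|exact: bm_cst|].
        move=> x _; have /andP[h1 h2] := w_itv (x, tau); have /andP[h3 h4] := w_itv (x, s).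
        by rewrite ler_norml; apply/andP; split; lra.
      rewrite Rint_cst// fine_lebesgue_itv ?(ltW ll)//.
      by rewrite (_ : D * (l - - l) = 2 * l * D); [exact: lexx|ring].
    have ts : 0 <= t - s by rewrite subr_ge0 ltW.
    rewrite mulrC ler_wpM2r//.
    have g0 : 0 <= rate * gap_weight l m M w eps s y.
      rewrite mulr_ge0 ?(ltW rate0)//.
      have := half s; rewrite T1s (le_trans (ltW st) tT) => /(_ isT); move=> ?; lra.
    have q : te * (t - s) <= te * (T - T1) by apply: ler_wpM2l => //; lra.
    rewrite mulNr; lra.
  move=> s T1s sT.
  (* Each of the two errors is then at most [rate / 8], and [rate / 2 - rate / 8 - rate / 8 = rate /
     4]. Adding 1 avoids a division by zero. *)
  pose om := rate / (16 * (se + 1)); pose h := rate / (8 * (te + 1)).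
  have om0 : 0 < om by rewrite divr_gt0// mulr_gt0// ltr_wpDl.
  have h0 : 0 < h by rewrite divr_gt0// mulr_gt0// ltr_wpDl.
  have sI : T0 < s < Tm by rewrite (lt_le_trans T01)// (lt_trans sT).
  have [d d0 dw] := cw sI om0.
  exists (Num.min d h); first by rewrite lt_min d0.
  move=> t st; rewrite -ltrBlDl lt_min => /andP[td th] tT.
  have := step s t om T1s st tT _.
  have ts : 0 <= t - s by rewrite subr_ge0 ltW.
  have hom tau : s <= tau <= t -> \int[mu]_(x in I) `|w (x, tau) - w (x, s)| <= om.
    move=> /andP[stau taut]; apply/ltW/dw.
      by apply/andP; split; [exact: lt_le_trans (lt_le_trans T01 T1s) stau|
        exact: le_lt_trans (le_trans taut tT) TTm].
    by rewrite ger0_norm ?subr_ge0//; lra.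
  move=> /(_ hom) hs.
  have e1 : se * (om + om) <= rate / 8.
    rewrite /om (_ : se * _ = rate / 8 * (se / (se + 1))); last by field; rewrite gt_eqF// ltr_wpDl.
    rewrite ler_piMr ?divr_ge0 ?(ltW rate0)// ler_pdivrMr ?ltr_wpDl//.
    by rewrite mul1r lerDl.
  have e2 : te * (t - s) <= rate / 8.
    apply: (@le_trans _ _ (te * h)); first by rewrite ler_wpM2l// ltW.
    rewrite /h (_ : te * _ = rate / 8 * (te / (te + 1))); last by field; rewrite gt_eqF// ltr_wpDl.
    rewrite ler_piMr ?divr_ge0 ?(ltW rate0)// ler_pdivrMr ?ltr_wpDl//.
    by rewrite mul1r lerDl.
  have e3 : - rate * gap_weight l m M w eps s y <= - rate * (1 / 2).
    by rewrite !mulNr lerN2 ler_wpM2l ?(ltW rate0)// half// T1s ltW.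
  have e4 : - rate * gap_weight l m M w eps s y + se * (om + om) + te * (t - s)
    <= - (rate / 4) by lra.
  have := le_trans hs (ler_wpM2l ts e4).
  by move=> ?; lra.
have JT0 : 0 <= J T.
  apply: Rintegral_ge0 => x _; apply: mulr_ge0; last exact: two_entropy_ge0.
  by have /andP[] := gap_weight_itv l0 mM eps0 mw w_itv T x.
have JT1 : J T1 <= 4 * l * D.
  apply: (@le_trans _ _ (\int[mu]_(x in I) (1 * (2 * D)))).
    apply: le_Rint => //.
    - apply: bmM; first exact: (bm_gap_weight l0 mM eps0 mw w_itv T1 I).
      exact: (bmT_pair1 _ _ (bm_two_entropy mk1 k12 k2M mw w_itv)).
    - exact: bm_cst.
    move=> x _; have /andP[g0 g1] := gap_weight_itv l0 mM eps0 mw w_itv T1 x.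
    apply: ler_pM => //; first exact: two_entropy_ge0.
    exact: (two_entropy_le mk1 k12 k2M (w_itv _)).
  rewrite Rint_cst// fine_lebesgue_itv ?(ltW ll)//.
  by rewrite (_ : 1 * (2 * D) * (l - - l) = 4 * l * D); [exact: lexx|ring].
have q1 : 16 * l * D / rate < T - T1 by lra.
move: q1; rewrite ltr_pdivrMr// => q1.
by exfalso; lra.
Qed.

(** The point [xi] is the supremum of the zeros of the left gap. By monotonicity this gap vanishes
    to the left of [xi]; to the right it is nonzero, so the right gap must vanish. Their derivatives
    [M - w] and [m - w] are then zero almost everywhere on the respective sides. *)
Lemma extinct_U_hyp (T : R) :
  (forall y, - l < y < l -> gap_product l m M w T y = 0) ->
  exists xi : R, - l <= xi <= l /\
    {ae mu, forall x : R, - l < x < l -> w (x, T) = U_hyp l M m xi x}.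
Proof.
move=> ext.
pose S := [set y : R | - l <= y <= l /\ left_gap l M w T y = 0].
have S1 : S (- l) by split; rewrite ?lexx ?(ltW ll)// left_gap_left.
have supS : has_sup S by split; [exists (- l)|exists l => t [/andP[]]].
pose xi := sup S.
have x1 : - l <= xi by apply: sup_upper_bound.
have x2 : xi <= l by apply: sup_le_ub => [|t [/andP[]]//]; exists (- l).
exists xi; split; first by rewrite x1.
have gl y : - l <= y -> y < xi -> left_gap l M w T y = 0.
  move=> ly yxi; have e0 : 0 < xi - y by rewrite subr_gt0.
  have [y' [/andP[y1 y2] y3] y4] := sup_adherent e0 supS.
  have yy' : y <= y' by rewrite ltW// (le_lt_trans _ y4)// /xi subKr.
  have /andP[+ _] := left_gap_mono mw w_itv T ly yy'.
  rewrite y3 sub0r oppr_ge0 => h; apply/eqP; rewrite eq_le h.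
  exact: left_gap_ge0.
have gr y : xi < y -> y < l -> right_gap l m M w T y = 0.
  move=> xiy yl; have yI : - l < y < l by rewrite yl (le_lt_trans x1).
  have yI' : - l <= y <= l by case/andP : yI => ? ?; rewrite !ltW.
  have := ext y yI; rewrite /gap_product /lgap /rgap clamp_id// => /eqP.
  rewrite mulf_eq0 => /orP[/eqP h|/eqP//].
  have : y <= xi by apply: sup_upper_bound.
  by rewrite leNgt xiy.
have ax := left_gap_derive l mw w_itv T; have bx := right_gap_derive l mw w_itv T.
have abx := ae_imp2 (fun x h1 h2 => conj h1 h2) ax bx.
apply: ae_imp2 abx (ae_neq xi) => x [d1 d2] xneq xl.
have /andP[lx xl'] := xl; rewrite /U_hyp !indicE.
have [xxi|xix|xE] := ltgtP x xi; last by rewrite xE eqxx in xneq.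
- rewrite mem_set/= ?in_itv/= ?lx// memNset/= ?in_itv/=; last first.
    by rewrite ltNge (ltW xxi).
  rewrite mulr1 mulr0 addr0; apply/esym/eqP; rewrite -subr_eq0; apply/eqP.
  apply: (is_derive_unique (d1 xl)).
  apply: (@near_eq_is_derive _ _ _ (cst (0 : R))).
  near=> z; rewrite gl//; near: z; first exact: lt_le_nbhsr.
  exact: lt_nbhsl.
- rewrite memNset/= ?in_itv/=; last by rewrite [x < xi]ltNge (ltW xix) andbF.
  rewrite mem_set/= ?in_itv/= ?xix// mulr1 mulr0 add0r.
  apply/esym/eqP; rewrite -subr_eq0; apply/eqP.
  apply: (is_derive_unique (d2 xl)).
  apply: (@near_eq_is_derive _ _ _ (cst (0 : R))).
  near=> z; rewrite gr//; near: z; first exact: lt_nbhsr.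
  exact: lt_nbhsl.
Unshelve. all: by end_near. Qed.

End Conclusion.

(** * The entropy solution *)

Section TestFunctions.
Context {R : realType}.
Variables (l Tm : R).
Implicit Types S D Th dTh : R -> R.

Lemma product_deriv_t S D Th dTh : smooth_profile (- l) l S D ->
  smooth_profile 0 Tm Th dTh ->
  deriv_t (fun p : R * R => S p.1 * Th p.2) = (fun p => S p.1 * dTh p.2).
Proof.
move=> sS sT; apply/funext => -[x t]; rewrite /deriv_t/= derive1E.
by have [_ dT _ _] := sT; have [_ ->] := is_deriveZ (S x) (dT t).
Qed.

Lemma product_deriv_x S D Th dTh : smooth_profile (- l) l S D ->
  smooth_profile 0 Tm Th dTh ->
  deriv_x (fun p : R * R => S p.1 * Th p.2) = (fun p => D p.1 * Th p.2).
Proof.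
move=> sS sT; apply/funext => -[x t]; rewrite /deriv_x/= derive1E.
have [_ dS _ _] := sS; have [_ E] := is_deriveZ (Th t) (dS x).
rewrite (_ : (fun y => S y * Th t) = (Th t \*: S)); last first.
  by apply/funext => y; rewrite /GRing.scale/= mulrC.
by rewrite E /GRing.scale/= mulrC.
Qed.

Lemma product_continuous (g h : R -> R) : continuous g -> continuous h ->
  continuous (fun p : R * R => g p.1 * h p.2).
Proof.
move=> cg ch p; apply: cvgM.
  by apply: cvg_comp; [exact: cvg_fst|exact: cg].
by apply: cvg_comp; [exact: cvg_snd|exact: ch].
Qed.

Lemma product_test_function S D Th dTh : smooth_profile (- l) l S D ->
  smooth_profile 0 Tm Th dTh ->
  test_function l (fun p : R * R => S p.1 * Th p.2).
Proof.
move=> sS sT.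
have [S0 dS cD [r r0 Sr]] := sS; have [T0 dT cdT [q q0 Tq]] := sT.
pose box : set (R * R) := `[- l + r, l - r] `*` `[0 + q, Tm - q].
have cbox : compact box by apply: compact_setX; exact: segment_compact.
have clbox : closed box.
  rewrite (_ : box = fst @^-1` `[- l + r, l - r] `&` snd @^-1` `[0 + q, Tm - q])//.
  apply: closedI; apply: preimage_closed; try exact: itv_closed.
    by move=> p _; exact: cvg_fst.
  by move=> p _; exact: cvg_snd.
have sub : tsupport (fun p : R * R => S p.1 * Th p.2) `<=` box.
  rewrite (closure_id box).1//; apply: closureS => -[x t] /= h.
  split => /=; rewrite in_itv/=.
    by apply: contraT => /Sr[E _]; rewrite E mul0r eqxx in h.
  by apply: contraT => /Tq[E _]; rewrite E mulr0 eqxx in h.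
split.
- split.
  + move=> x t; have [h _] := is_deriveZ (Th t) (dS x).
    rewrite (_ : (fun y => _) = (Th t \*: S))//.
    by apply/funext => y; rewrite /GRing.scale/= mulrC.
  + by move=> x t; have [h _] := is_deriveZ (S x) (dT t).
  + rewrite (product_deriv_x sS sT); apply: product_continuous => //.
    exact: smooth_profile_cont sT.
  + rewrite (product_deriv_t sS sT); apply: product_continuous => //.
    exact: smooth_profile_cont sS.
- by apply: subclosed_compact cbox sub; exact: closed_closure.
- move=> p /sub[/=]; rewrite !in_itv/= => /andP[h1 h2] /andP[h3 h4].
  by split; rewrite /dom_x/= in_itv/= ?andbT; [apply/andP; split|]; lra.
- by move=> p; rewrite mulr_ge0.
Qed.

End TestFunctions.

(** * A bounded, globally measurable version of the solution *)

Section Truncation.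
Context {R : realType}.
Local Notation mu := (@lebesgue_measure R).
Local Notation mu2 := ((@lebesgue_measure R \x @lebesgue_measure R)%E).
Variables (l um up : R) (f u0 : R -> R) (u : R * R -> R).
Hypothesis u_sol : entropy_solution l f um up u0 u.
Hypothesis l0 : 0 < l.
Hypothesis cf : continuous f.
Variables (Tm K : R).
Hypothesis K0 : 0 <= K.
Hypothesis uK : {ae mu2, forall p,
  (dom_x l `*` `]0, Tm[ : set (R * R)) p -> `|u p| <= K}.
Local Notation I := (`]- l, l[%classic : set R).
Local Notation J := (`]0, Tm[%classic : set R).
Local Notation domain := (I `*` `[0, +oo[ : set (R * R)).

(** The solution is measurable on its domain only and bounded only almost everywhere. Clamping, with
    the value 0 outside the domain, makes both properties global and changes [u] on a null set only,
    before time [Tm]. *)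
Definition truncate (p : R * R) : R := ((clamp (- K) K \o u) \_ domain) p.
Local Notation v := truncate.

Let KK : - K <= K. Proof. by rewrite (@le_trans _ _ 0)// oppr_le0. Qed.
Let mdom : measurable domain. Proof. by apply: measurableX. Qed.

Lemma clamp_continuous (a b : R) : continuous (clamp a b).
Proof. by apply: nonexpansive_continuous => x y; exact: clamp_lip. Qed.

Lemma truncateE x t : - l < x < l -> 0 <= t -> v (x, t) = clamp (- K) K (u (x, t)).
Proof.
move=> xl t0; rewrite /truncate patchE mem_set//=.
by split; rewrite /= in_itv/= ?andbT.
Qed.

Lemma truncate_itv p : - K <= v p <= K.
Proof.
rewrite /truncate patchE; case: ifP => _; first exact: clamp_itv.
by rewrite oppr_le0 K0.
Qed.

Lemma measurable_truncate : measurable_fun setT v.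
Proof.
have mc : measurable_fun setT (clamp (- K) K).
  by apply: continuous_measurable_fun; exact: clamp_continuous.
exact: (measurable_restrictT _ mdom).1 (measurableT_comp mc (es_measurable u_sol)).
Qed.

Lemma bm_truncate (h : R -> R) : continuous h -> bm setT (fun p => h (v p)).
Proof.
move=> ch; split.
  by apply: measurableT_comp => //; [exact: continuous_measurable_fun|exact: measurable_truncate].
have [_ [C hC]] := bm_itv (- K - 1) (K + 1) ch.
exists C => p _; apply: hC; rewrite /= in_itv/=; have /andP[? ?] := truncate_itv p.
by apply/andP; split; lra.
Qed.

Lemma truncate_smooth_weak (k : R) :
  smooth_weak (- l) l Tm (fun p => `|v p - k|) (fun p => kflux f k (v p)).
Proof.
move=> S D Th dTh sS sT.
have tf := product_test_function sS sT.
have := es_kruzhkov u_sol k tf.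
rewrite (product_deriv_t sS sT) (product_deriv_x sS sT).
set G := (X in \int[mu2]_(p in spacetime l) X p).
pose H p := `|v p - k| * (S p.1 * dTh p.2) + kflux f k (v p) * (D p.1 * Th p.2).
rewrite (_ : \int[mu2]_(p in spacetime l) G p = \int[mu2]_(p in I `*` J) H p)//.
have mst : measurable (spacetime l : set (R * R)).
  by apply: measurableX; exact: measurable_itv.
have mbox : measurable (I `*` J : set (R * R)) by exact: measurableX.
have sub : I `*` J `<=` spacetime l.
  by move=> p [h1 h2]; split => //; move: h2; rewrite /= !in_itv/= => /andP[-> _].
have -> : \int[mu2]_(p in I `*` J) H p =
    \int[mu2]_(p in spacetime l) (H \_ (I `*` J)) p.
  by rewrite -[in LHS](setIidr sub) -Rintegral_mkcondr.
congr fine.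
have mS (g : R -> R) : continuous g -> measurable_fun setT (fun p : R * R => g p.1).
  by move=> cg; apply: measurableT_comp => //; exact: continuous_measurable_fun.
have mT (g : R -> R) : continuous g -> measurable_fun setT (fun p : R * R => g p.2).
  by move=> cg; apply: measurableT_comp => //; exact: continuous_measurable_fun.
have cS := smooth_profile_cont sS; have cT := smooth_profile_cont sT.
have [_ _ cD [r r0 Sr]] := sS; have [_ _ cdT [q q0 Tq]] := sT.
have cabs : continuous (fun y => `|y - k|).
  apply: nonexpansive_continuous => x y.
  apply: (le_trans (ler_dist_dist _ _)).
  by rewrite opprB addrA subrK.
have mP1 : measurable_fun setT (fun p : R * R => S p.1 * dTh p.2).
  by apply: measurable_funM; [exact: mS|exact: mT].
have mP2 : measurable_fun setT (fun p : R * R => D p.1 * Th p.2).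
  by apply: measurable_funM; [exact: mS|exact: mT].
have mu_st : measurable_fun (spacetime l) u.
  apply: measurable_funS (es_measurable u_sol) => //.
  move=> p [h1 h2]; split => //; move: h2; rewrite /= !in_itv/= !andbT; exact: ltW.
have comp (h : R -> R) : continuous h -> measurable_fun (spacetime l) (fun p => h (u p)).
  move=> ch; apply: measurableT_comp => //; exact: continuous_measurable_fun.
apply: ae_eq_integral => //.
- apply/measurable_EFinP.
  rewrite (_ : G = fun p => `|u p - k| * (S p.1 * dTh p.2) +
    kflux f k (u p) * (D p.1 * Th p.2)); last first.
    by apply/funext => p; rewrite /G kfluxE.
  apply: measurable_funD; apply: measurable_funM.
  + exact: (comp _ cabs).
  + exact: measurable_funTS mP1.
  + exact: (comp _ (@kflux_continuous _ f cf k)).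
  + exact: measurable_funTS mP2.
- apply/measurable_EFinP; apply: measurable_funTS.
  apply: (measurable_restrictT _ mbox).1; apply: measurable_funTS.
  apply: measurable_funD; apply: measurable_funM => //.
  + by have [] := bm_truncate cabs.
  + by have [] := bm_truncate (@kflux_continuous _ f cf k).
apply: ae_imp uK => -[x t] hK [/= xI tI]; congr EFin.
rewrite patchE; case: ifPn => [/set_mem[/= _ tJ]|notin].
  have := hK (conj xI tJ) => {}hK.
  rewrite /G /H/= -kfluxE (truncateE _ _).
  - by rewrite clamp_id// -ler_norml.
  - by move: xI; rewrite /dom_x/= in_itv.
  - by move: tI; rewrite /= in_itv/= andbT => /ltW.
(* Outside the box the time factor and its derivative both vanish, so neither the later times nor
   the values of [u] there matter. *)
have tout : ~~ (0 + q <= t <= Tm - q).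
  apply: contra notin => /andP[t1 t2]; rewrite inE; split => //=.
  by rewrite in_itv/=; apply/andP; split; lra.
by have [Th0 dTh0] := Tq _ tout; rewrite /G/= Th0 dTh0 !mulr0 addr0.
Qed.

Lemma truncate_L1 t : 0 <= t -> forall e : R, 0 < e ->
  exists2 d : R, 0 < d & forall s, 0 <= s -> `|s - t| < d ->
    \int[mu]_(x in I) `|v (x, s) - v (x, t)| < e.
Proof.
move=> t0 e e0.
have mU s : 0 <= s -> measurable_fun I (fun x => u (x, s)).
  move=> s0; have := (measurable_restrictT _ mdom).1 (es_measurable u_sol).
  move=> /(measurable_fun_pair1 s)/(@measurable_funTS _ _ _ _ I).
  apply: eq_measurable_fun => x /set_mem/= xI; rewrite patchE mem_set//.
  by split => //=; rewrite in_itv/= s0.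
have : \forall s \near within `[0, +oo[ (nbhs t),
    (\int[mu]_(x in I) `|u (x, s) - u (x, t)|%:E < e%:E)%E.
  exact: (es_continuous u_sol t0 (@nbhs_open_ereal_lt _ 0 (fun=> e) e0)).
rewrite near_withinE => /nbhs_ballP[d d0 hd]; exists d => // s s0 sd.
have {hd} : (\int[mu]_(x in I) `|u (x, s) - u (x, t)|%:E < e%:E)%E.
  by apply: hd; rewrite /ball/= 1?distrC// in_itv/= s0.
have bv : bm I (fun x => `|v (x, s) - v (x, t)|).
  have cid : continuous (fun y : R => y) by move=> y; exact: cvg_id.
  by apply: bm_norm; apply: bmB; apply: bmT_pair1; exact: bm_truncate cid.
(* The comparison is made in the extended reals, because [fine] would send an infinite integral of
   [u] to 0. *)
have le : (\int[mu]_(x in I) `|v (x, s) - v (x, t)|%:E <=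
    \int[mu]_(x in I) `|u (x, s) - u (x, t)|%:E)%E.
  apply: ge0_le_integral => //.
  - by apply/measurable_EFinP; apply: measurable_funTS; have [] := bv.
  - apply/measurable_EFinP; apply: measurableT_comp => //.
    by apply: measurable_funB; exact: mU.
  - move=> x /=; rewrite in_itv/= => xl.
    by rewrite lee_fin !truncateE//; exact: clamp_lip.
move=> /(le_lt_trans le) lte; rewrite -lte_fin /Rintegral fineK//.
rewrite ge0_fin_numE; first by rewrite (lt_trans lte)// ltry.
by apply: integral_ge0 => x _; rewrite lee_fin.
Qed.

End Truncation.

(** * The reflected state and the admissible boundary values *)

Section FluxLevels.
Context {R : realType} (c0 m M : R) (f : R -> R).
Hypothesis c0_gt0 : 0 < c0.
Hypothesis f_derivable : forall v : R, derivable f v 1.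
Hypothesis df_derivable : forall v : R, derivable (f^`())%classic v 1.
Hypothesis f_convex : forall v : R, c0 <= (f^`(2) v)%classic.

Lemma level_set_lt3 (x y z : R) : x < y -> y < z -> f x = f y -> f y = f z -> False.
Proof.
move=> xy yz fxy fyz.
have := strong_convexity f_derivable df_derivable f_convex (ltW xy) (ltW yz).
rewrite fxy -fyz => h.
have : 0 < c0 / 2 * (z - y) * (y - x) * (z - x).
  by rewrite !mulr_gt0 ?subr_gt0// (lt_trans xy).
by move=> h2; lra.
Qed.

(** Since [b] is a witness, the default value of [xget] is not returned; and a strictly convex
    function takes no value three times, so the chosen point is [b]. *)
Lemma reflect_flux_unique (a b : R) : a != b -> f a = f b -> reflect_flux f a = b.
Proof.
move=> ab fab; rewrite /reflect_flux.
have : exists w, [set w | w != a /\ f w = f a] w by exists b; rewrite /= eq_sym.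
move=> /(xgetPex a); set w := xget _ _ => -[wa fw].
case: (ltgtP a b) => [ab'|ba|abE]; last by rewrite abE eqxx in ab.
- case: (ltgtP w a) => [wlta|altw|wE]; last by rewrite wE eqxx in wa.
    by have [] := level_set_lt3 wlta ab'.
  case: (ltgtP w b) => // [wb|bw].
    by have [] := level_set_lt3 altw wb; rewrite ?fw.
  by have [] := level_set_lt3 ab' bw; rewrite ?fw.
- case: (ltgtP w a) => [wlta|altw|wE]; last by rewrite wE eqxx in wa.
    case: (ltgtP w b) => // [wb|bw].
      by have [] := level_set_lt3 wb ba; rewrite ?fw.
    by have [] := level_set_lt3 bw wlta; rewrite ?fw.
  by have [] := level_set_lt3 ba altw; rewrite ?fw.
Qed.

Hypotheses (mM : m < M) (f_eq : f m = f M).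

Lemma BLN_leftE c : BLN_left f M c -> c <= m \/ c = M.
Proof.
by rewrite /BLN_left (@reflect_flux_unique M m) ?gt_eqF.
Qed.

Lemma BLN_rightE c : BLN_right f m c -> c = m \/ M <= c.
Proof.
rewrite /BLN_right (@reflect_flux_unique m M) ?lt_eqF//.
by case=> [->|/=]; [left|rewrite in_itv/= andbT => Mc; right].
Qed.

End FluxLevels.

(** * Trapping between the two states and the resulting conserved function *)

Section Trapping.
Context {R : realType}.
Local Notation mu := (@lebesgue_measure R).
Local Notation mu2 := ((@lebesgue_measure R \x @lebesgue_measure R)%E).
Variables (l m M c0 : R) (f u0 : R -> R) (u : R * R -> R).
Hypotheses (l0 : 0 < l) (mM : m < M) (c0_gt0 : 0 < c0).
Hypothesis f_derivable : forall v : R, derivable f v 1.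
Hypothesis df_derivable : forall v : R, derivable (f^`())%classic v 1.
Hypothesis f_convex : forall v : R, c0 <= (f^`(2) v)%classic.
Hypotheses (df_m : (f^`() m)%classic < 0) (df_M : 0 < (f^`() M)%classic).
Hypothesis f_eq : f m = f M.
Hypothesis u_sol : entropy_solution l f M m u0 u.
Variables (Tm K : R).
Hypothesis K0 : 0 <= K.
Hypothesis uK : {ae mu2, forall p,
  (dom_x l `*` `]0, Tm[ : set (R * R)) p -> `|u p| <= K}.
Hypotheses (mK : - K <= m) (MK : M <= K).
Local Notation I := (`]- l, l[%classic : set R).
Local Notation v := (truncate l u K).
Local Notation F y := (f y - f M).

Lemma derivable_continuous : continuous f.
Proof. by move=> x; apply: differentiable_continuous; apply/derivable1_diffP. Qed.
Let cf := derivable_continuous.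
Let ll : - l < l. Proof. by rewrite gtrN. Qed.
Let KK : - K <= K. Proof. by rewrite (@le_trans _ _ 0)// oppr_le0. Qed.
Let finI : (mu I < +oo)%E. Proof. exact: lebesgue_itv_lty. Qed.
Let cid : continuous (fun y : R => y). Proof. by move=> y; exact: cvg_id. Qed.
Let bmv (h : R -> R) : continuous h -> bm setT (fun p => h (v p)).
Proof. by move=> ch; exact: (bm_truncate u_sol K0 ch). Qed.

Let cabs k : continuous (fun y : R => `|y - k|).
Proof.
apply: nonexpansive_continuous => x y.
by apply: (le_trans (ler_dist_dist _ _)); rewrite opprB addrA subrK.
Qed.
Let cF : continuous (fun y => F y).
Proof. by move=> y; apply: cvgB; [exact: cf|exact: cvg_cst]. Qed.
Let ckf k : continuous (kflux f k). Proof. exact: (@kflux_continuous _ f cf k). Qed.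

Lemma truncate_entropic k :
  entropic (- l) l Tm 0 (fun p => `|v p - k|) (fun p => kflux f k (v p)).
Proof.
refine (exact_time (bmv (@cabs k)) (bmv (@ckf k)) _ _).
- move=> t /andP[t0 _] e e0.
  have [d d0 hd] := truncate_L1 u_sol K0 (ltW t0) e0.
  exists d => // s /andP[s0 _] st; apply: le_lt_trans (hd _ (ltW s0) st).
  have b1 q : bm I (fun x => v (x, q)) by exact: (bmT_pair1 _ _ (bmv (@cid))).
  have b2 q : bm I (fun x => `|v (x, q) - k|) by exact: (bmT_pair1 _ _ (bmv (@cabs k))).
  apply: le_Rint => //; [exact: bm_norm (bmB (b2 s) (b2 t))|exact: bm_norm (bmB (b1 s) (b1 t))|].
  move=> x _; apply: (le_trans (ler_dist_dist _ _)).
  by rewrite opprB addrA subrK.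
- exact: (truncate_smooth_weak u_sol cf K0 uK).
Qed.

(** The level [k = - K] lies below all values, where [|v - k|] is [v + K]; constants are then
    removed. The level [K] gives the opposite inequality, and both together are the conservation
    law. *)
Lemma truncate_entropic_pos : entropic (- l) l Tm 0 v (fun p => F (v p)).
Proof.
have h := entropicD (bmv (@cabs (- K))) (bmv (@ckf (- K))) (bm_cst _ _) (bm_cst _ _)
  (truncate_entropic (- K)) (@entropic_cst _ _ _ Tm ll 0 (- K) (f (- K) - f M)).
congr (entropic _ _ _ _ _ _) : h; apply/funext => p /=.
  have /andP[? _] := truncate_itv l u K0 p.
  by rewrite ger0_norm ?opprK ?addrK// -lerBlDr sub0r.
have /andP[? _] := truncate_itv l u K0 p.
by rewrite /kflux max_l// min_r//; ring.
Qed.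

Lemma truncate_entropic_neg :
  entropic (- l) l Tm 0 (fun p => - v p) (fun p => - F (v p)).
Proof.
have h := entropicD (bmv (@cabs K)) (bmv (@ckf K)) (bm_cst _ _) (bm_cst _ _)
  (truncate_entropic K) (@entropic_cst _ _ _ Tm ll 0 (- K) (f M - f K)).
congr (entropic _ _ _ _ _ _) : h; apply/funext => p /=.
  have /andP[_ ?] := truncate_itv l u K0 p.
  by rewrite ler0_norm ?subr_le0//; ring.
have /andP[_ ?] := truncate_itv l u K0 p.
by rewrite /kflux max_r// min_l//; ring.
Qed.

(** By continuity it suffices to know the sign of the flux at the admissible traces. The clamp
    appears because traces are those of [u] and may lie outside [[- K, K]]. *)
Lemma truncate_outflow (h : R -> R) : continuous h ->
  (forall c, c <= m \/ c = M -> h (clamp (- K) K c) <= 0) ->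
  (forall c, c = m \/ M <= c -> 0 <= h (clamp (- K) K c)) ->
  {ae mu, forall t, 0 < t < Tm ->
    outflow (- l) l (fun p => h (v p)) (fun=> 1) t}.
Proof.
move=> ch hl hr.
have near_value (c e : R) : 0 < e -> exists2 r : R, 0 < r & forall y,
    `|y - c| < r -> `|h (clamp (- K) K y) - h (clamp (- K) K c)| < e.
  move=> e0; have cc : {for c, continuous (h \o clamp (- K) K)}.
    by apply: continuous_comp; [exact: clamp_continuous|exact: ch].
  have /cvgrPdist_lt/(_ _ e0)/nbhs_ballP[r r0 hy] := cc; exists r => // y yc.
  by rewrite distrC; apply: hy; rewrite /ball/= distrC.
apply: ae_imp2 (es_left u_sol) (es_right u_sol) => t trl trr /andP[t0 tT].
have l2 : 0 < 2 * l by have l0' := l0; lra.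
split => e e0.
- have [c trc /(BLN_leftE c0_gt0 f_derivable df_derivable f_convex mM f_eq)/hl hc] := trl t0.
  have [r r0 hr'] := near_value c _ e0; have [d d0 hd] := trc _ r0.
  exists (Num.min d (2 * l)); first by rewrite lt_min d0.
  apply: ae_imp hd => x hd /andP[x1 x2].
  have [xd xl] : x < - l + d /\ x < l.
    have h1 : Num.min d (2 * l) <= d by rewrite ge_min lexx.
    have h2 : Num.min d (2 * l) <= 2 * l by rewrite ge_min lexx orbT.
    by split; lra.
  rewrite mulr1 truncateE; [|by rewrite x1|exact: ltW].
  have := hr' _ (hd (ltac:(by rewrite x1))).
  by rewrite ltr_norml => /andP[_ ?]; lra.
- have [c trc /(BLN_rightE c0_gt0 f_derivable df_derivable f_convex mM f_eq)/hr hc] := trr t0.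
  have [r r0 hr'] := near_value c _ e0; have [d d0 hd] := trc _ r0.
  exists (Num.min d (2 * l)); first by rewrite lt_min d0.
  apply: ae_imp hd => x hd /andP[x1 x2].
  have [xd xl] : l - d < x /\ - l < x.
    have h1 : Num.min d (2 * l) <= d by rewrite ge_min lexx.
    have h2 : Num.min d (2 * l) <= 2 * l by rewrite ge_min lexx orbT.
    by split; lra.
  rewrite mulr1 truncateE; [|by rewrite xl|exact: ltW].
  have := hr' _ (hd (ltac:(by rewrite xd))).
  by rewrite ltr_norml => /andP[? _]; lra.
Qed.

(** The entropy [|v - M| + v - M] is twice the excess over [M], and its flux [g] is at least [f'(M)]
    times it by the tangent at [M]. Admissible traces at [- l] do not exceed [M], where [g = 0]; at
    [l] it is enough that [g >= 0]. The decay is started at time 1 since the inequalities hold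
    between positive times. *)
Lemma truncate_le_M t : 1 + 2 * l / ((f^`() M)%classic * ln (3 / 2)) <= t -> t < Tm ->
  {ae mu, forall x, - l < x < l -> v (x, t) <= M}.
Proof.
move=> t1 tT; pose g y := kflux f M y + F y.
have gM y : y <= M -> g y = 0 by move=> yM; rewrite /g /kflux max_r// min_l//; ring.
have sp y : (f^`() M)%classic * (`|y - M| + y - M) <= g y.
  have [yM|/ltW My] := leP y M.
    by rewrite gM// ler0_norm ?subr_le0// [leLHS](_ : _ = 0)//; ring.
  have := tangent_le_right c0_gt0 f_derivable df_derivable f_convex My.
  by rewrite /g /kflux max_l// min_r// ger0_norm ?subr_ge0//; lra.
have E0 y : 0 <= `|y - M| + y - M by have := ler_norm (- (y - M)); rewrite normrN; lra.
have cg : continuous g by move=> y; apply: cvgD; [exact: ckf|exact: cF].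
have cE : continuous (fun y => `|y - M| + y - M).
  move=> y; apply: cvgB; last exact: cvg_cst.
  by apply: cvgD; [exact: (@cabs M)|exact: cid].
have ent : entropic (- l) l Tm 0 (fun p => `|v p - M| + v p - M) (fun p => g (v p)).
  have h := entropicD (bmD (bmv (@cabs M)) (bmv (@cid))) (bmD (bmv (@ckf M)) (bmv (@cF)))
    (bm_cst _ _) (bm_cst _ _) (entropicD (bmv (@cabs M)) (bmv (@ckf M)) (bmv (@cid))
    (bmv (@cF)) (truncate_entropic M) truncate_entropic_pos)
    (@entropic_cst _ _ _ Tm ll 0 (- M) 0).
  by congr (entropic _ _ _ _ _ _) : h; apply/funext => p /=; rewrite addr0.
have out := truncate_outflow (h := g) cg.
have := finite_time_decay (sigma := 1) l0 df_M (normr1 _) (bmv (@cE)) (bmv (@cg)) ent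
  (fun p => E0 (v p)) _ _ ltr01 tT t1.
move=> /(_ _)/wrap[p|].
  by rewrite mul1r.
move=> /(_ _)/wrap[|].
  apply: out => c hc.
    rewrite gM// /clamp ge_max ge_min (le_trans mK (ltW mM))/=.
    by case: hc => [cm|->]; rewrite ?lexx ?orbT// (le_trans cm (ltW mM)) orbT.
  by apply: le_trans (sp _); rewrite mulr_ge0// ltW.
apply: ae_imp => x h xl; move: (h xl) => {}h; rewrite leNgt; apply/negP => Mv; move: h.
by rewrite gtr0_norm ?subr_gt0//; lra.
Qed.

(** Reflection of the previous argument: twice the deficit below [m] travels to the left with speed
    at least [- f'(m)], and admissible traces at [l] are at least [m]. *)
Lemma truncate_ge_m t : 1 + 2 * l / (- (f^`() m)%classic * ln (3 / 2)) <= t -> t < Tm ->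
  {ae mu, forall x, - l < x < l -> m <= v (x, t)}.
Proof.
move=> t1 tT; pose g y := kflux f m y - F y.
have gm y : m <= y -> g y = 0.
  by move=> ym; rewrite /g /kflux max_l// min_r// f_eq; ring.
have sp y : - (f^`() m)%classic * (`|y - m| - y + m) <= - g y.
  have [my|/ltW ym] := leP m y.
    by rewrite gm// ger0_norm ?subr_ge0// [leLHS](_ : _ = 0) ?oppr0//; ring.
  have := tangent_le_left c0_gt0 f_derivable df_derivable f_convex ym.
  by rewrite /g /kflux max_r// min_l// ler0_norm ?subr_le0// f_eq; lra.
have E0 y : 0 <= `|y - m| - y + m by have := ler_norm (y - m); lra.
have cg : continuous g by move=> y; apply: cvgB; [exact: ckf|exact: cF].
have cE : continuous (fun y => `|y - m| - y + m).
  move=> y; apply: cvgD; last exact: cvg_cst.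
  by apply: cvgB; [exact: (@cabs m)|exact: cid].
have ent : entropic (- l) l Tm 0 (fun p => `|v p - m| - v p + m) (fun p => g (v p)).
  have h := entropicD (bmB (bmv (@cabs m)) (bmv (@cid))) (bmB (bmv (@ckf m)) (bmv (@cF)))
    (bm_cst _ _) (bm_cst _ _) (entropicD (bmv (@cabs m)) (bmv (@ckf m)) (bmN (bmv (@cid)))
    (bmN (bmv (@cF))) (truncate_entropic m) truncate_entropic_neg)
    (@entropic_cst _ _ _ Tm ll 0 m 0).
  by congr (entropic _ _ _ _ _ _) : h; apply/funext => p /=; rewrite addr0.
have out := truncate_outflow (h := g) cg.
have dm0 : 0 < - (f^`() m)%classic by rewrite oppr_gt0.
have := finite_time_decay (sigma := -1) l0 dm0 (normrN1 _) (bmv (@cE)) (bmv (@cg)) ent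
  (fun p => E0 (v p)) _ _ ltr01 tT t1.
move=> /(_ _)/wrap[p|].
  by rewrite mulN1r.
move=> /(_ _)/wrap[|].
  apply: out => c hc.
    by rewrite -oppr_ge0; apply: le_trans (sp _); rewrite mulr_ge0// ltW.
  have mc : m <= c by case: hc => [->//|]; exact: (le_trans (ltW mM)).
  by rewrite gm// /clamp le_max le_min mc (le_trans (ltW mM) MK) orbT.
apply: ae_imp => x h xl; move: (h xl) => {}h; rewrite leNgt; apply/negP => vm; move: h.
by rewrite ltr0_norm ?subr_lt0//; lra.
Qed.

Definition trap_time := 1 + Num.max (2 * l / ((f^`() M)%classic * ln (3 / 2)))
  (2 * l / (- (f^`() m)%classic * ln (3 / 2))).
Local Notation T0 := trap_time.

Lemma trap_time_gt0 : 0 < T0.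
Proof.
have ln0 : 0 < ln (3 / 2 : R) by rewrite ln_gt0//; lra.
rewrite /trap_time ltr_pwDl// le_max; apply/orP; left.
by rewrite divr_ge0// mulr_ge0// ltW.
Qed.

Lemma truncate_trapped t : T0 <= t -> t < Tm ->
  {ae mu, forall x, - l < x < l -> m <= v (x, t) <= M}.
Proof.
move=> Tt tT.
have hM := @truncate_le_M t (le_trans _ Tt) tT.
have hm := @truncate_ge_m t (le_trans _ Tt) tT.
apply: ae_imp2 (hm _) (hM _) => [x h1 h2 xl||].
- by rewrite h1// h2.
- by rewrite lerD2l le_max lexx orbT.
- by rewrite lerD2l le_max lexx.
Qed.

(** A second clamp makes the bounds hold at every point; at each time from [trap_time] on and before
    [Tm] it changes [v] on a null set only. *)
Definition trapped_part (p : R * R) : R := clamp m M (v p).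
Local Notation w := trapped_part.

Lemma trapped_part_eq t : T0 <= t -> t < Tm ->
  {ae mu, forall x, - l < x < l -> w (x, t) = v (x, t)}.
Proof.
by move=> Tt tT; apply: ae_imp (truncate_trapped Tt tT) => x h xl; rewrite /w clamp_id ?h.
Qed.

Lemma trapped_part_itv p : m <= w p <= M.
Proof. by apply: clamp_itv; exact: ltW. Qed.

Let bmw (h : R -> R) : continuous h -> bm setT (fun p => h (w p)).
Proof.
move=> ch; apply: (bmv (h := h \o clamp m M)) => y.
by apply: continuous_comp; [exact: clamp_continuous|exact: ch].
Qed.

Lemma entropic_trapped (h g : R -> R) : continuous h -> continuous g ->
  entropic (- l) l Tm 0 (fun p => h (v p)) (fun p => g (v p)) ->
  entropic (- l) l Tm T0 (fun p => h (w p)) (fun p => g (w p)).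
Proof.
move=> ch cg ent psi dpsi pp s t s0 st tT.
have T00 := trap_time_gt0.
have [bpsi bdpsi] := lip_profile_bm pp.
have E q (r z : R -> R) : continuous r -> bm I z -> T0 < q -> q < Tm ->
    \int[mu]_(x in I) (r (w (x, q)) * z x) = \int[mu]_(x in I) (r (v (x, q)) * z x).
  move=> cr bz qT0 qT; apply: eq_Rint_ae => //.
  - exact: (bmM (bmT_pair1 _ _ (bmw cr)) bz).
  - exact: (bmM (bmT_pair1 _ _ (bmv cr)) bz).
  - apply: ae_imp (trapped_part_eq (ltW qT0) qT) => x h1 /=.
    by rewrite in_itv/= => xl; rewrite h1.
rewrite (E t h)// ?(lt_trans s0 st)// (E s h)// ?(lt_trans st tT)//.
apply: le_trans (ent _ _ pp s t (lt_trans T00 s0) st tT) _.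
rewrite le_eqVlt; apply/orP; left; apply/eqP; apply: eq_Rint => tau /=.
rewrite in_itv/= => /andP[h1 h2]; rewrite (E tau g)//.
  exact: lt_trans h1.
exact: lt_trans tT.
Qed.

(** Every admissible trace is at most [m] or at least [M], so after clamping [F] vanishes at both
    ends. Hence [F] and [- F] both satisfy [outflow], and the two opposite inequalities extend to
    weights reaching the boundary. *)
Lemma trapped_conserved : conserved l M T0 Tm f w.
Proof.
move=> psi g pp s t s0 st tT.
have [psi0 [L0 psiL] bpsi bg _] := pp.
pose C := psi (- l) + `|L0| * (2 * l).
have psiC x : - l <= x <= l -> 0 <= psi x <= C.
  move=> xl; rewrite psi0//=; have /andP[x1 x2] := xl.
  have h1 : - l <= - l <= l by rewrite lexx ltW.
  have := psiL x (- l) xl h1; rewrite ler_norml => /andP[_ h2].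
  have h3 : L0 * `|x - - l| <= `|L0| * (2 * l).
    apply: le_trans (ler_wpM2r (normr_ge0 _) (ler_norm L0)) _.
    by apply: ler_wpM2l => //; rewrite ger0_norm; lra.
  by rewrite /C; lra.
have cFw (e : R) : continuous (fun y => e * F (clamp m M y)).
  move=> y; apply: cvgM; first exact: cvg_cst.
  by apply: (@continuous_comp _ _ _ (clamp m M) (fun y => F y)); [exact: clamp_continuous|exact: cF].
have F0 (y : R) : y <= m \/ M <= y -> F (clamp m M y) = 0.
  have mM' := mM.
  by case=> h; rewrite /clamp; [rewrite min_r ?max_l ?f_eq ?subrr//; lra
    |rewrite min_l// max_r ?subrr// ltW].
have clK c : c <= m \/ M <= c -> clamp (- K) K c <= m \/ M <= clamp (- K) K c.
  have h := le_trans (ltW mM) MK; case=> hc; [left|right].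
    by rewrite /clamp ge_max ge_min mK hc orbT.
  by rewrite /clamp le_max le_min MK hc orbT.
have out e : {ae mu, forall t, T0 < t < Tm ->
    outflow (- l) l (fun p => e * F (w p)) psi t}.
  have := truncate_outflow (cFw e) => /(_ _ _)/wrap[c hc|c hc|].
  - by rewrite F0 ?mulr0//; apply: clK; case: hc => [|->]; [left|right].
  - by rewrite F0 ?mulr0//; apply: clK; case: hc => [->|]; [left|right].
  apply: ae_imp => r h /andP[r0 rT]; apply: (outflow_scale ll psiC); apply: h.
  by rewrite rT (lt_trans trap_time_gt0).
have cN : continuous (fun y : R => - y) by move=> y; apply: cvgN; exact: cvg_id.
have cNF : continuous (fun y => - F y) by move=> y; apply: cvgN; exact: cF.
have out1 : {ae mu, forall t, T0 < t < Tm -> outflow (- l) l (fun p => F (w p)) psi t}.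
  have <- : (fun p => 1 * F (w p)) = (fun p => F (w p)) by apply/funext => p; rewrite mul1r.
  exact: out.
have outN : {ae mu, forall t, T0 < t < Tm -> outflow (- l) l (fun p => - F (w p)) psi t}.
  have <- : (fun p => -1 * F (w p)) = (fun p => - F (w p)).
    by apply/funext => p; rewrite mulN1r.
  exact: out.
have h1 := entropic_boundary ll (bmw (@cid)) (bmw (@cF))
  (entropic_trapped (@cid) (@cF) truncate_entropic_pos) pp out1 s0 st tT.
have h2 := entropic_boundary ll (bmw cN) (bmw cNF)
  (entropic_trapped cN cNF truncate_entropic_neg) pp outN s0 st tT.
have finJ : (mu (`]s, t[%classic : set R) < +oo)%E by exact: lebesgue_itv_lty.
have bwp q : bm I (fun x => w (x, q) * psi x).
  exact: (bmM (bmT_pair1 _ _ (bmw (@cid))) bpsi).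
have N1 q : \int[mu]_(x in I) (- w (x, q) * psi x) =
    - \int[mu]_(x in I) (w (x, q) * psi x).
  by rewrite -(RintN _ finI (bwp q))//; apply: eq_Rint => x _; rewrite mulNr.
have bFg q : bm I (fun x => F (w (x, q)) * g x).
  exact: (bmM (bmT_pair1 _ _ (bmw (@cF))) bg).
have N2 : \int[mu]_(tau in `]s, t[) \int[mu]_(x in I) (- F (w (x, tau)) * g x) =
    - \int[mu]_(tau in `]s, t[) \int[mu]_(x in I) (F (w (x, tau)) * g x).
  have bI : bm `]s, t[ (fun tau => \int[mu]_(x in I) (F (w (x, tau)) * g x)).
    apply: (@bm_Rint_fst _ I `]s, t[ (fun p => F (w p) * g p.1)) => //.
    by apply: bmM; [exact: bmS (bmw (@cF))|exact: bmT_fst].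
  rewrite -(RintN _ finJ bI)//.
  apply: eq_Rint => tau _; rewrite -(RintN _ finI (bFg tau))//.
  by apply: eq_Rint => x _; rewrite mulNr.
move: h1 h2; rewrite !N1 N2 => h1 h2; apply/eqP; rewrite eq_le h1/=.
by rewrite -lerN2 opprB; move: h2; rewrite opprK addrC.
Qed.

Lemma trapped_L1 t : T0 < t < Tm -> forall e : R, 0 < e ->
  exists2 d : R, 0 < d & forall s, T0 < s < Tm -> `|s - t| < d ->
    \int[mu]_(x in I) `|w (x, s) - w (x, t)| < e.
Proof.
have T00 := trap_time_gt0.
move=> /andP[t0 _] e e0.
have [d d0 hd] := truncate_L1 u_sol K0 (ltW (lt_trans T00 t0)) e0.
exists d => // s /andP[s0 _] st; apply: le_lt_trans (hd _ (ltW (lt_trans T00 s0)) st).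
have b1 q : bm I (fun x => v (x, q)) by exact: (bmT_pair1 _ _ (bmv (@cid))).
have b2 q : bm I (fun x => w (x, q)) by exact: (bmT_pair1 _ _ (bmw (@cid))).
apply: le_Rint => //; [exact: bm_norm (bmB (b2 s) (b2 t))|exact: bm_norm (bmB (b1 s) (b1 t))|].
by move=> x _; exact: clamp_lip.
Qed.

(** The two levels trisect [[m, M]], and [c0 / 2] is the constant of the strong convexity
    inequality. *)
Definition shock_rate := dissipation_rate m M (c0 / 2)
  (m + (M - m) / 3) (m + 2 * (M - m) / 3).

Lemma trapped_U_hyp T : T0 + 1 + 16 * l * (M - m) / shock_rate < T -> T < Tm ->
  exists xi : R, - l <= xi <= l /\
    {ae mu, forall x, - l < x < l -> w (x, T) = U_hyp l M m xi x}.
Proof.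
move=> T0T TTm; have mM' := mM; have c02 : 0 < c0 / 2 by rewrite divr_gt0.
have mw : measurable_fun setT w by have [] := bmw (@cid).
have itvN y : m <= y <= M -> `|y| <= K.
  by case/andP => h1 h2; rewrite ler_norml (le_trans mK h1) (le_trans h2 MK).
have [L L0 fL] := convex_lipschitz c0_gt0 f_derivable df_derivable f_convex K.
apply: (extinct_U_hyp l0 mw trapped_part_itv) => y yl.
(* The lower bound [- L (M - m)] for [F] holds because [F] vanishes at [M] and [f] is [L]-Lipschitz.
   The starting time [T0 + 1] is strictly later than [T0], as required. *)
apply: (@gap_product_extinct _ l m M T0 Tm f w (L * (M - m)) L (c0 / 2)
  (m + (M - m) / 3) (m + 2 * (M - m) / 3) l0 mM c02 _ _ _ mw trapped_part_itv
  trapped_conserved cf _ _ L0 _ _ _ _ trapped_L1 (T0 + 1)) => //; try lra.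
- by move=> z zI; exact: (flux_between_le0 c0_gt0 f_derivable df_derivable f_convex f_eq zI).
- move=> z zI; have MI : m <= M <= M by rewrite lexx andbT ltW.
  have := fL z M (itvN _ zI) (itvN _ MI).
  have h : L * `|z - M| <= L * (M - m).
    by apply: ler_wpM2l => //; have /andP[? ?] := zI; rewrite ler0_norm; lra.
  by rewrite ler_norml => /andP[? _]; lra.
- by move=> a b aI bI; apply: fL; exact: itvN.
- by move=> k _; apply: (entropic_trapped (@cabs k) (@ckf k)); exact: truncate_entropic.
- move=> k z /andP[_ kM] /andP[_ zM].
  exact: (left_dissipation f_derivable df_derivable f_convex).
- move=> k z /andP[mk _] /andP[mz _].
  exact: (right_dissipation f_derivable df_derivable f_convex f_eq).
Qed.

End Trapping.

Lemma ae_itv_exists (R : realType) (P : R -> Prop) (a b : R) : a < b ->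
  {ae (@lebesgue_measure R), forall t, P t} -> exists2 t, a < t < b & P t.
Proof.
move=> ab [N [mN N0 PN]]; apply: contrapT => noP.
have sub : `]a, b[ `<=` N.
  move=> t; rewrite /= in_itv/= => tab; apply: PN => Pt.
  by apply: noP; exists t.
have : (@lebesgue_measure R `]a, b[ <= 0)%E.
  by rewrite -N0; apply: le_measure => //; rewrite inE//; exact: measurable_itv.
rewrite lebesgue_measure_itv/= lte_fin ab -EFinB lee_fin.
by rewrite leNgt subr_gt0 ab.
Qed.

Theorem theorem3p1 (R : realType) (l um up c0 : R) (f : R -> R)
  (l_gt0 : 0 < l) (up_lt0 : up < 0) (um_gt0 : 0 < um) (c0_gt0 : 0 < c0)
  (f_derivable : forall v : R, derivable f v 1)
  (df_derivable : forall v : R, derivable (f^`())%classic v 1)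
  (f_convex : forall v : R, c0 <= (f^`(2) v)%classic)
  (df_up : (f^`() up)%classic < 0) (df_um : 0 < (f^`() um)%classic) (f_eq : f up = f um)
  (u0 : R -> R) (u0_BV : in_BV (- l) l u0)
  (u : R * R -> R) (u_sol : entropy_solution l f um up u0 u) :
  exists T : R, 0 < T /\
  exists xi : R, - l <= xi <= l /\
    {ae (@lebesgue_measure R),
      forall x : R, - l < x < l -> u (x, T) = U_hyp l um up xi x}.
Proof.
have upum : up < um by exact: lt_trans um_gt0.
pose T0 := trap_time l up um f; pose delay := 16 * l * (um - up) / shock_rate up um c0.
(* The last unit of time is a window []Tm - 1, Tm[] of admissible final times, from which [T] is
   chosen. *)
pose Tm := T0 + 1 + delay + 1.
have T00 : 0 < T0 by exact: trap_time_gt0.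
have delay0 : 0 <= delay.
  rewrite divr_ge0//; first by rewrite !mulr_ge0// ?subr_ge0 ltW.
  by apply/ltW/dissipation_rate_gt0; lra.
have Tm0 : 0 < Tm by rewrite /Tm; lra.
have [C uC] := es_bounded u_sol Tm0.
(* As [up < 0 < um], the difference [um - up] exceeds both [um] and [- up]. *)
pose K := Num.max C (um - up).
have upK : - K <= up.
  have : um - up <= K by rewrite le_max lexx orbT.
  by lra.
have umK : um <= K.
  have : um - up <= K by rewrite le_max lexx orbT.
  by lra.
have K0 : 0 <= K by lra.
have uK : {ae (@lebesgue_measure R \x @lebesgue_measure R)%E, forall p,
    (dom_x l `*` `]0, Tm[ : set (R * R)) p -> `|u p| <= K}.
  by apply: ae_imp uC => p h /h uC; rewrite le_max uC.
(* The bound on [u] holds almost everywhere in space-time, thus at almost every time for almost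
   every [x]; at such a [T] the truncation coincides with [u] itself. *)
have [T /andP[T1 T2] uT] := ae_itv_exists (ltac:(lra) : Tm - 1 < Tm) (ae_section uK).
have T0T : T0 <= T by move: T1; rewrite /Tm; lra.
have Tpos : 0 < T := lt_le_trans T00 T0T.
exists T; split => //.
have [|xi [xil wU]] := trapped_U_hyp l_gt0 upum c0_gt0 f_derivable df_derivable
  f_convex df_up df_um f_eq u_sol K0 uK upK umK _ T2.
  by move: T1; rewrite /Tm /delay -/T0; lra.
exists xi; split => //.
have wv := trapped_part_eq l_gt0 upum c0_gt0 f_derivable df_derivable
  f_convex df_up df_um f_eq u_sol K0 uK upK umK T0T T2.
have vU : {ae (@lebesgue_measure R), forall x, - l < x < l ->
    truncate l u K (x, T) = U_hyp l um up xi x}.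
  by apply: ae_imp2 wU wv => x h1 h2 xl; rewrite -h1// h2.
apply: ae_imp2 vU uT => x h uxT xl.
rewrite -h// truncateE ?(ltW Tpos)// clamp_id// -ler_norml; apply: uxT.
by split; rewrite /dom_x/= in_itv/= ?xl// Tpos.
Qed.
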